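(* For each fixed integer $k \geq 0$, the decision problem $\textsc{Jelly}$ (given a level of Jelly no Puzzle, decide whether it is solvable), restricted to levels containing at most $k$ movable blocks, is in $\mathsf{NP}$.
   Context: Jelly no Puzzle is a one-player game on a finite $n\times m$ 2D grid. A level consists of immovable gray blocks (walls), movable gray blocks, and colored jellies (movable blocks, each of some color). Movable blocks are the movable gray blocks and the jellies. The player moves a jelly one cell left or right (if there is room, pushing blocks in the way when possible). The game has gravity: any movable block not supported from below falls until it is supported; blocks resting on a moving block are carried along. When two jellies of the same color come into contact, they merge irreversibly into a single (possibly non-rectangular) jelly occupying the union of their cells. A level is solvable if there is a sequence of moves after which, for each color, all jellies of that color have been merged into one. $\textsc{Jelly}$ denotes the set of solvable levels. *)

(* Defs.v *)
From mathcomp Require Import all_boot.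
Set Implicit Arguments. Unset Strict Implicit. Unset Printing Implicit Defensive.

(* A cell is (x, y): x = column (0 = leftmost), y = row (0 = bottom row). *)
Definition cell := (nat * nat)%type.

(* A movable block: its kind (None = movable gray block, Some c = jelly of
   colour c) and the (rigid) set of cells it occupies. *)
Definition block := (option nat * seq cell)%type.
Definition config := seq block.

Record level := Level {
  lw : nat;
  lh : nat;
  lwalls : seq cell;
  lblocks : config
}.

Definition adj4 (p q : cell) : bool :=
  ((p.1 == q.1) && ((p.2 == q.2.+1) || (q.2 == p.2.+1))) ||
  ((p.2 == q.2) && ((p.1 == q.1.+1) || (q.1 == p.1.+1))).

Definition connected_cells (s : seq cell) : Prop :=
  forall a b, a \in s -> b \in s ->
    exists p : seq cell, [/\ path adj4 a p, last a p = b & all (mem s) p].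

Definition all_cells (L : level) : seq cell :=
  lwalls L ++ flatten [seq b.2 | b <- lblocks L].

Definition wf_level (L : level) : Prop :=
  [/\ all (fun p : cell => (p.1 < lw L) && (p.2 < lh L)) (all_cells L),
      uniq (all_cells L) &
      forall b, b \in lblocks L -> b.2 != [::] /\ connected_cells b.2].

Section Mechanics.
Variables (w h : nat) (walls : seq cell).

Definition free_for_fixed (p : cell) : bool :=
  (p.1 < w) && (p.2 < h) && (p \notin walls).

Definition can_shift (d : bool) (p : cell) : bool :=
  if d then free_for_fixed (p.1.+1, p.2)
  else (0 < p.1) && free_for_fixed (p.1.-1, p.2).

Definition shift (d : bool) (p : cell) : cell :=
  if d then (p.1.+1, p.2) else (p.1.-1, p.2).

Definition above (p : cell) : cell := (p.1, p.2.+1).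
Definition below (p : cell) : cell := (p.1, p.2.-1).

Definition cells_of (c : config) (i : nat) : seq cell := (nth (None, [::]) c i).2.
Definition kind_of (c : config) (i : nat) : option nat := (nth (None, [::]) c i).1.

(* When block i moves in direction d, block j must move too if it is in the
   way of i (pushed) or rests on top of i (carried). *)
Definition drags (c : config) (d : bool) (i j : nat) : Prop :=
  i != j /\
  exists p, p \in cells_of c i /\
    ((((0 < p.1) || d) /\ shift d p \in cells_of c j) \/ above p \in cells_of c j).

Inductive moved (c : config) (d : bool) (i0 : nat) : nat -> Prop :=
| moved_base : moved c d i0 i0
| moved_step i j : moved c d i0 i -> j < size c -> drags c d i j -> moved c d i0 j.

Definition move1 (c c' : config) : Prop :=
  exists (i0 : nat) (d : bool) (col : nat),
  [/\ i0 < size c, kind_of c i0 = Some col,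
      (forall j, moved c d i0 j -> all (can_shift d) (cells_of c j)),
      size c' = size c &
      forall j, j < size c ->
        (moved c d i0 j -> nth (None, [::]) c' j =
            (kind_of c j, map (shift d) (cells_of c j))) /\
        (~ moved c d i0 j -> nth (None, [::]) c' j = nth (None, [::]) c j)].

Inductive supported (c : config) : nat -> Prop :=
| supp_base j p : j < size c -> p \in cells_of c j ->
    (p.2 = 0 \/ below p \in walls) -> supported c j
| supp_on j j' p : supported c j' -> j < size c -> p \in cells_of c j ->
    0 < p.2 -> below p \in cells_of c j' -> supported c j.

Definition fall1 (c c' : config) : Prop :=
  (exists j, j < size c /\ ~ supported c j) /\
  size c' = size c /\
  forall j, j < size c ->
    (supported c j -> nth (None, [::]) c' j = nth (None, [::]) c j) /\
    (~ supported c j -> nth (None, [::]) c' j =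
        (kind_of c j, map below (cells_of c j))).

Definition touching_same (c : config) (i j : nat) : Prop :=
  [/\ i < j, j < size c,
      (exists col, kind_of c i = Some col /\ kind_of c j = Some col) &
      (exists p q, [/\ p \in cells_of c i, q \in cells_of c j & adj4 p q])].

Definition drop_nth (j : nat) (s : config) : config := take j s ++ drop j.+1 s.

Definition merge1 (c c' : config) : Prop :=
  exists i j, touching_same c i j /\
    c' = drop_nth j (set_nth (None, [::]) c i
                      (kind_of c i, cells_of c i ++ cells_of c j)).

Definition merge_stable (c : config) : Prop := forall i j, ~ touching_same c i j.
Definition all_supported (c : config) : Prop :=
  forall j, j < size c -> supported c j.

Inductive settle : config -> config -> Prop :=
| settle_merge c c' c'' : merge1 c c' -> settle c' c'' -> settle c c''
| settle_fall c c' c'' : merge_stable c -> fall1 c c' -> settle c' c'' -> settle c c''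
| settle_done c : merge_stable c -> all_supported c -> settle c c.

Definition game_step (c c'' : config) : Prop :=
  exists c', move1 c c' /\ settle c' c''.

Inductive game_reach : config -> config -> Prop :=
| reach_refl c : game_reach c c
| reach_step c c' c'' : game_step c c' -> game_reach c' c'' -> game_reach c c''.

End Mechanics.

Definition solved (c : config) : Prop :=
  forall i j col, i < size c -> j < size c ->
    kind_of c i = Some col -> kind_of c j = Some col -> i = j.

Definition solvable (L : level) : Prop :=
  exists c0 c,
    [/\ settle (lwalls L) (lblocks L) c0,
        game_reach (lw L) (lh L) (lwalls L) c0 c & solved c].

Fixpoint bin_fuel (fuel n : nat) : seq bool :=
  match fuel with
  | 0 => [::]
  | f.+1 => if n is 0 then [::] else odd n :: bin_fuel f n./2
  end.
Definition bin (n : nat) : seq bool := bin_fuel n n.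

(* self-delimiting binary code of a number *)
Definition enc_nat (n : nat) : seq bool :=
  flatten [seq [:: true; b] | b <- bin n] ++ [:: false; false].
(* unary code (used for the grid dimensions, so that the input size is
   polynomially related to the grid size n*m) *)
Definition enc_unary (n : nat) : seq bool := nseq n true ++ [:: false].

Definition enc_list (T : Type) (f : T -> seq bool) (s : seq T) : seq bool :=
  enc_nat (size s) ++ flatten (map f s).
Definition enc_cell (p : cell) : seq bool := enc_nat p.1 ++ enc_nat p.2.
Definition enc_kind (k : option nat) : seq bool :=
  if k is Some col then true :: enc_nat col else [:: false].
Definition enc_block (b : block) : seq bool :=
  enc_kind b.1 ++ enc_list enc_cell b.2.
Definition enc_level (L : level) : seq bool :=
  enc_unary (lw L) ++ enc_unary (lh L) ++
  enc_list enc_cell (lwalls L) ++ enc_list enc_block (lblocks L).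

Definition JellyK (k : nat) (x : seq bool) : Prop :=
  exists L, [/\ wf_level L, size (lblocks L) <= k, enc_level L = x & solvable L].

(* States are 0..tm_nstates-1 with 0 = start, 1 = accept, 2 = reject.
   Tape symbols are 0..tm_nsyms-1 with 0 = blank, 1 = bit 0, 2 = bit 1,
   3 = separator.  Head moves: 0 = left, 1 = right, anything else = stay. *)
Record TM := MkTM {
  tm_nstates : nat;
  tm_nsyms : nat;
  tm_delta : nat -> nat -> nat * nat * nat
}.

Definition wf_TM (M : TM) : Prop :=
  [/\ 3 <= tm_nstates M, 4 <= tm_nsyms M &
      forall q a, q < tm_nstates M -> a < tm_nsyms M ->
        (tm_delta M q a).1.1 < tm_nstates M /\ (tm_delta M q a).1.2 < tm_nsyms M].

(* configuration: (state, reversed tape left of the head,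
                   tape from the head rightwards); the tape is one-way
   infinite, blank beyond the stored part. *)
Definition tm_config := (nat * seq nat * seq nat)%type.

Definition tm_step (M : TM) (cf : tm_config) : tm_config :=
  let: (q, l, r) := cf in
  if (q == 1) || (q == 2) then cf else
  let a := head 0 r in
  let rest := behead r in
  let: (q', a', mv) := tm_delta M q a in
  if mv == 0 then
    (match l with
     | [::] => (q', [::], a' :: rest)
     | b :: l' => (q', l', b :: a' :: rest)
     end)
  else if mv == 1 then (q', a' :: l, rest)
  else (q', l, a' :: rest).

Definition sym_of_bit (b : bool) : nat := if b then 2 else 1.

Definition accepts_within (M : TM) (t : nat) (x y : seq bool) : bool :=
  (iter t (tm_step M)
     (0, [::], map sym_of_bit x ++ 3 :: map sym_of_bit y)).1.1 == 1.

Definition in_NP (Lang : seq bool -> Prop) : Prop :=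
  exists (M : TM) (c e : nat), wf_TM M /\
    forall x : seq bool,
      Lang x <->
      exists y : seq bool,
        size y <= c * (size x) ^ e + c /\
        accepts_within M (c * (size x) ^ e + c) x y.

(* Main.v *)
Require Import Defs.
From mathcomp Require Import all_boot.
From mathcomp Require Import zify.
From Stdlib Require Import FunctionalExtensionality Lia.

(* Between two merges the blocks only translate, so with at most k blocks only
   polynomially many states (phase, number of blocks, positions) can occur on a
   play, and a winning play can be shortened to polynomial length.  The
   certificate is such a play, written out configuration by configuration in
   unary, together with ranks that witness the inductively defined sets of moved
   and supported blocks, spanning-tree ranks for the connectedness of the blocks
   and the positions of the tokens of the input.  All numbers involved are
   polynomially bounded, so each check is a first-order condition on counters.
   Such conditions are evaluated by terms with clipped bounded recursion, which
   are compiled to counter programs; the Turing machine keeps every counter as a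
   unary track over the input.  Clipping makes the polynomial time bound
   automatic, by induction on terms. *)

Set Implicit Arguments.
Unset Strict Implicit.
Unset Printing Implicit Defensive.

(** * Counter programs on a Turing machine *)

(** Colours are the obstacle to counting everything in unary: the input writes them in binary and
    nothing bounds them, whereas the coordinates of a well-formed level lie below the dimensions,
    which the input writes in unary. So the machine never evaluates a colour. A colour is named by
    the position of one of its codes in the input, and two colours are compared bit by bit. This
    agrees with equality of numbers only for codes without leading zeros, which is checked when a
    block is parsed and inherited along the play.

    A fall or a move also depends on which blocks are not supported or not dragged, so
    non-membership in a least fixed point has to be certified too. One rank function settles both
    directions: its support is closed under the rules, hence contains the fixed point, and a
    positive rank always rests on a base case or on a premise of smaller rank, hence nothing else
    belongs to it.

    The exponent of the length bound comes from a pigeonhole argument: for an input of length N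
    there are at most [N.+1 ^ 2] positions for each of k blocks, and merges only lower the number of
    blocks. *)

Definition upd (s : nat -> nat) (r v : nat) : nat -> nat :=
  fun i => if i == r then v else s i.

Lemma upd_id s r : upd s r (s r) = s.
Proof. by apply: functional_extensionality => i; rewrite /upd; case: eqP => [->|]. Qed.

Inductive instr :=
| IInc of nat
| IDec of nat
| IJz of nat & nat
| IJmp of nat
| IRd of nat & nat & nat
| IAcc
| IRej.

Definition mstep (W : seq nat) (code : seq instr) (ps : nat * (nat -> nat)) :=
  let: (pc, s) := ps in
  match nth IRej code pc with
  | IInc r => (pc.+1, upd s r (s r).+1)
  | IDec r => (pc.+1, upd s r (s r).-1)
  | IJz r l => (if s r == 0 then l else pc.+1, s)
  | IJmp l => (l, s)
  | IRd r a l => (if nth 0 W (s r) == a then l else pc.+1, s)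
  | IAcc => (pc, s)
  | IRej => (pc, s)
  end.

Definition instr_reg (i : instr) : nat :=
  match i with
  | IInc r => r | IDec r => r | IJz r _ => r | IRd r _ _ => r | _ => 0
  end.

Definition aconfig := (nat * (nat -> nat) * nat)%type.

(** The tape is a total function and the head an absolute position, so writing is a pointwise
    update. The truncated predecessor agrees with a left move at the end of the one-way tape. *)
Definition astep (M : TM) (cf : aconfig) : aconfig :=
  let: (q, f, p) := cf in
  if (q == 1) || (q == 2) then cf else
  let: (q', a', mv) := tm_delta M q (f p) in
  (q', upd f p a', if mv == 0 then p.-1 else if mv == 1 then p.+1 else p).

Definition repc (cf : tm_config) (ac : aconfig) : Prop :=
  [/\ cf.1.1 = ac.1.1, size cf.1.2 = ac.2 &
      forall i, nth 0 (catrev cf.1.2 cf.2) i = ac.1.2 i].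

Lemma nth_catrev (l r : seq nat) i :
  nth 0 (catrev l r) i = if i < size l then nth 0 l (size l - i.+1) else nth 0 r (i - size l).
Proof. by rewrite catrevE nth_cat size_rev; case: ltnP => // h; rewrite nth_rev. Qed.

Lemma repc_step M cf ac : repc cf ac -> repc (tm_step M cf) (astep M ac).
Proof.
case: cf => [[q l] r]; case: ac => [[q0 f] p] [/= eq <- H]; subst q0.
rewrite /tm_step /astep; case: ifP => // _.
have Hh : f (size l) = head 0 r.
  by rewrite -H nth_catrev ltnn subnn nth0.
rewrite Hh; case: (tm_delta M q (head 0 r)) => [[q' a'] mv].
have Hw i : nth 0 (catrev l (a' :: behead r)) i = upd f (size l) a' i.
  rewrite /upd -H !nth_catrev; case: (ltngtP i (size l)) => // hi.
    have -> : i - size l = (i - size l).-1.+1 by lia.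
    by rewrite /= nth_behead.
  by rewrite hi subnn.
case: eqP => [_|_].
  by case: l H Hh Hw => [|b l'] H Hh Hw; split => //= i; rewrite -Hw.
by case: eqP => [_|_]; split.
Qed.

Lemma repc_iter M n cf ac : repc cf ac -> repc (iter n (tm_step M) cf) (iter n (astep M) ac).
Proof. by move=> H; elim: n => //= n IH; apply: repc_step. Qed.

Lemma astep_halt M n (q : nat) f p : (q == 1) || (q == 2) -> iter n (astep M) (q, f, p) = (q, f, p).
Proof. by move=> hq; elim: n => //= n ->; rewrite /= hq. Qed.

(** * A Turing machine whose tape carries the counters as marks *)

Section CounterTM.
Variables (m : nat) (code : seq instr).

Definition flags : Type := (bool * {set 'I_m.+1})%type.
Definition noflag : flags := (false, set0).
(** [noflag] stands in front, so it has index 0 and an unmarked symbol is its own code; the initial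
    tape is then already a coded tape, apart from the mark on cell 0. *)
Definition flagseq : seq flags := noflag :: enum {: flags}.

Definition senc (a : nat) (f : flags) : nat := a + 4 * index f flagseq.
Definition sbase (n : nat) := n %% 4.
Definition sflags (n : nat) : flags := nth noflag flagseq (n %/ 4).

Lemma sencK_base a f : a < 4 -> sbase (senc a f) = a.
Proof. by move=> h; rewrite /sbase /senc addnC mulnC modnMDl modn_small. Qed.

Lemma sencK_flags a f : a < 4 -> sflags (senc a f) = f.
Proof.
move=> h; rewrite /sflags /senc addnC mulnC divnMDl // divn_small // addn0 nth_index //.
by rewrite inE mem_enum orbT.
Qed.

Lemma senc_lt a f : a < 4 -> senc a f < 4 * (size flagseq).
Proof.
move=> h; rewrite /senc; have : index f flagseq < size flagseq.
  by rewrite index_mem inE mem_enum orbT.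
lia.
Qed.

Lemma senc_noflag a : senc a noflag = a.
Proof. by rewrite /senc /flagseq /= eqxx muln0 addn0. Qed.

(* Control states: mode 0 executes the instruction at pc (the head starts on
   cell 0), mode 1 rewinds to cell 0 and then executes pc, mode 2 erases the
   last mark of the register that the instruction at pc decrements. *)
Definition st (mode pc : nat) : nat := 3 + (minn pc (size code) * 3 + mode).

(** The Boolean flag marks cell 0, and [inord r \in F] marks a cell whose index is below the value
    of register r. The start state only places the mark on cell 0, by which a rewinding head knows
    where to stop. *)
Definition cdelta (q a : nat) : nat * nat * nat :=
  let pc := (q - 3) %/ 3 in
  let mode := (q - 3) %% 3 in
  let b := sbase a in
  let: (e, F) := sflags a in
  let keep q' mv := (q', senc b (e, F), mv) in
  if q < 3 then (st 0 0, senc b (true, set0), 2)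
  else if mode == 0 then
    match nth IRej code pc with
    | IInc r => if inord r \in F then keep (st 0 pc) 1
                else (st 1 pc.+1, senc b (e, inord r |: F), 2)
    | IDec r => if inord r \in F then keep (st 0 pc) 1
                else if e then keep (st 0 pc.+1) 2 else keep (st 2 pc) 0
    | IJz r l => keep (st 0 (if inord r \in F then pc.+1 else l)) 2
    | IJmp l => keep (st 0 l) 2
    | IRd r c l => if inord r \in F then keep (st 0 pc) 1
                   else keep (st 1 (if b == c then l else pc.+1)) 2
    | IAcc => keep 1 2
    | IRej => keep 2 2
    end
  else if mode == 1 then (if e then keep (st 0 pc) 2 else keep (st 1 pc) 0)
  else match nth IRej code pc with
       | IDec r => (st 1 pc.+1, senc b (e, F :\ inord r), 2)
       | _ => keep 2 2
       end.

Definition ctm : TM := MkTM (st 3 (size code)) (4 * size flagseq) cdelta.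

Lemma st_lt mode pc : mode < 3 -> st mode pc < st 3 (size code).
Proof. rewrite /st; lia. Qed.

Lemma ctm_wf : wf_TM ctm.
Proof.
split.
- by rewrite /= /st; lia.
- by rewrite /= /flagseq /=; lia.
- move=> q a _ _.
  have hs f : senc (sbase a) f < 4 * size flagseq by apply: senc_lt; rewrite ltn_mod.
  have h1 : 1 < st 3 (size code) by rewrite /st; lia.
  have h2 : 2 < st 3 (size code) by rewrite /st; lia.
  rewrite /= /cdelta; case: (sflags a) => e F.
  do ![case: ifP => ? | case: (nth _ _ _) => * | split => /= | exact: hs | exact: h1 | exact: h2
      | by apply: st_lt].
Qed.

Lemma st_mode mode pc : mode < 3 -> (st mode pc - 3) %% 3 = mode.
Proof. by move=> h; rewrite /st addKn modnMDl modn_small. Qed.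

Lemma st_pc mode pc : mode < 3 -> (st mode pc - 3) %/ 3 = minn pc (size code).
Proof. by move=> h; rewrite /st addKn divnMDl // divn_small // addn0. Qed.

Lemma st_min mode pc : st mode (minn pc (size code)) = st mode pc.
Proof. by rewrite /st -minnA minnn. Qed.

Lemma st_minS mode pc : st mode (minn pc (size code)).+1 = st mode pc.+1.
Proof. rewrite /st; lia. Qed.

(** Truncating the program counter keeps the state set finite and loses nothing, since every address
    outside the code holds the default [IRej]. *)
Lemma nth_min pc : nth IRej code (minn pc (size code)) = nth IRej code pc.
Proof.
by case: (leqP pc (size code)) => // h; rewrite !nth_default ?leqnn //; lia.
Qed.

Variable W : seq nat.
Hypothesis W4 : forall i, nth 0 W i < 4.
Hypothesis code_regs : forall pc, instr_reg (nth IRej code pc) < m.+1.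

(** Register r marks the cells 0 to [s r - 1], so its value is the index of its first unmarked cell.
    This is also where [IRd] finds the symbol it has to test. *)
Definition atape (s : nat -> nat) : nat -> nat :=
  fun i => senc (nth 0 W i) (i == 0, [set r : 'I_m.+1 | i < s r]).

Lemma sbase_atape s i : sbase (atape s i) = nth 0 W i.
Proof. by rewrite sencK_base. Qed.

Lemma sflags_atape s i : sflags (atape s i) = (i == 0, [set r : 'I_m.+1 | i < s r]).
Proof. by rewrite sencK_flags. Qed.

Lemma st_halt mode pc : (st mode pc == 1) || (st mode pc == 2) = false.
Proof. by rewrite /st. Qed.

Lemma st_ge3 mode pc : st mode pc < 3 = false.
Proof. by rewrite /st. Qed.

Lemma upd_atape s i : upd (atape s) i (atape s i) = atape s.
Proof. exact: upd_id. Qed.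

Lemma mem_reg r (s : nat -> nat) i : r < m.+1 ->
  (inord r \in [set r : 'I_m.+1 | i < s r]) = (i < s r).
Proof. by move=> h; rewrite inE inordK. Qed.

Lemma astep_exec s pc i : astep ctm (st 0 pc, atape s, i) =
  let keep q' mv := (q', atape s, if mv == 0 then i.-1 else if mv == 1 then i.+1 else i) in
  let F := [set r : 'I_m.+1 | i < s r] in
  match nth IRej code pc with
  | IInc r => if i < s r then keep (st 0 pc) 1
              else (st 1 pc.+1, upd (atape s) i (senc (nth 0 W i) (i == 0, inord r |: F)), i)
  | IDec r => if i < s r then keep (st 0 pc) 1
              else if i == 0 then keep (st 0 pc.+1) 2 else keep (st 2 pc) 0
  | IJz r l => keep (st 0 (if i < s r then pc.+1 else l)) 2
  | IJmp l => keep (st 0 l) 2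
  | IRd r c l => if i < s r then keep (st 0 pc) 1
                 else keep (st 1 (if nth 0 W i == c then l else pc.+1)) 2
  | IAcc => keep 1 2
  | IRej => keep 2 2
  end.
Proof.
rewrite /astep st_halt /= /cdelta st_ge3 st_mode // st_pc // sbase_atape sflags_atape /= nth_min.
have := code_regs pc.
case: (nth IRej code pc) => [r|r|r l|l|r c l||] /= hr; rewrite ?mem_reg // ?st_min.
- by case: ifP => _ /=; rewrite ?upd_atape ?st_minS.
- by do ![case: ifP => _ /=]; rewrite ?upd_atape ?st_minS.
- by rewrite upd_atape; case: ifP => _ /=; rewrite ?st_minS.
- by rewrite upd_atape.
- by do ![case: ifP => _ /=]; rewrite ?upd_atape ?st_minS.
- by rewrite upd_atape.
- by rewrite upd_atape.
Qed.

Lemma walk_right s pc r j :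
  (match nth IRej code pc with IInc r' => r == r' | IDec r' => r == r' | IRd r' _ _ => r == r'
   | _ => false end) ->
  j <= s r -> iter j (astep ctm) (st 0 pc, atape s, 0) = (st 0 pc, atape s, j).
Proof.
move=> hi; elim: j => // j IH hj; rewrite iterS IH; last by lia.
rewrite astep_exec; case: (nth IRej code pc) hi => //= [r'|r'|r' c l] /eqP <-;
by rewrite hj.
Qed.

Lemma walk_left s pc j :
  iter j.+1 (astep ctm) (st 1 pc, atape s, j) = (st 0 pc, atape s, 0).
Proof.
have E i : astep ctm (st 1 pc, atape s, i) =
    if i == 0 then (st 0 pc, atape s, i) else (st 1 pc, atape s, i.-1).
  rewrite /astep st_halt /= /cdelta st_ge3 st_mode // st_pc // sbase_atape sflags_atape /=.
  by case: ifP => _ /=; rewrite st_min upd_atape.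
elim: j => [|j IH]; first by rewrite iterS E.
by rewrite iterSr E.
Qed.

Lemma atape_inc s r : r < m.+1 ->
  upd (atape s) (s r) (senc (nth 0 W (s r)) (s r == 0, inord r |: [set r' : 'I_m.+1 | s r < s r']))
  = atape (upd s r (s r).+1).
Proof.
move=> hr; apply: functional_extensionality => i; rewrite /upd /atape.
case: eqP => [->|ne]; congr senc; congr pair; apply/setP => r'; rewrite !inE.
  rewrite -(inj_eq val_inj) /= inordK //; case: eqP => [->|] //=; lia.
case: eqP => // e; rewrite e; lia.
Qed.

Lemma atape_dec s r : r < m.+1 -> 0 < s r ->
  upd (atape s) (s r).-1 (senc (nth 0 W (s r).-1)
    ((s r).-1 == 0, [set r' : 'I_m.+1 | (s r).-1 < s r'] :\ inord r))
  = atape (upd s r (s r).-1).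
Proof.
move=> hr h0; apply: functional_extensionality => i; rewrite /upd /atape.
case: eqP => [->|ne]; congr senc; congr pair; apply/setP => r'; rewrite !inE.
  rewrite -(inj_eq val_inj) /= inordK //; case: eqP => [->|] //=; lia.
case: eqP => // e; rewrite e; lia.
Qed.

Lemma astep_erase s pc r i : nth IRej code pc = IDec r ->
  astep ctm (st 2 pc, atape s, i) =
  (st 1 pc.+1, upd (atape s) i (senc (nth 0 W i)
    (i == 0, [set r' : 'I_m.+1 | i < s r'] :\ inord r)), i).
Proof.
move=> E; rewrite /astep st_halt /= /cdelta st_ge3 st_mode // st_pc //.
by rewrite sbase_atape sflags_atape /= nth_min E st_minS.
Qed.

(** The cost is one walk to the end of the track of the register and one walk back. *)
Lemma sim_step pc s : (nth IRej code pc <> IAcc) -> (nth IRej code pc <> IRej) ->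
  exists2 t, t <= 2 * s (instr_reg (nth IRej code pc)) + 4 &
    iter t (astep ctm) (st 0 pc, atape s, 0) =
    (st 0 (mstep W code (pc, s)).1, atape (mstep W code (pc, s)).2, 0).
Proof.
move=> hA hR; have := code_regs pc; rewrite /mstep.
have wr := @walk_right s pc; have ae := astep_exec s pc; move: wr ae hA hR.
case E : (nth IRej code pc) => [r|r|r l|l|r c l||] //= wr ae _ _ hr.
(* Read from right to left: walk to the first unmarked cell, act there, rewind. *)
- exists ((s r).+1 + 1 + s r); first by lia.
  rewrite !iterD (wr r) // [iter 1 _ _]ae ltnn atape_inc //.
  exact: walk_left.
- case: (posnP (s r)) => h0.
    exists 1; first by lia.
    by rewrite [iter 1 _ _]ae /= h0 ltnn /= -h0 upd_id.
  exists ((s r).-1.+1 + 1 + 1 + s r); first by lia.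
  rewrite !iterD (wr r) // [iter 1 _ (_, _, s r)]ae ltnn (gtn_eqF h0).
  by rewrite [iter 1 _ _](astep_erase _ _ E) atape_dec // walk_left.
- exists 1; first by lia.
  by rewrite [iter 1 _ _]ae /= lt0n; case: eqP.
- by exists 1; [lia | rewrite [iter 1 _ _]ae].
- exists ((s r).+1 + 1 + s r); first by lia.
  by rewrite !iterD (wr r) // [iter 1 _ _]ae ltnn walk_left.
Qed.

Lemma mstep_reg_le pc s B : (forall r, s r <= B) -> forall r, (mstep W code (pc, s)).2 r <= B.+1.
Proof.
move=> hB r; have hr := hB r; rewrite /mstep.
case: (nth IRej code pc) => [q|q|q l|l|q c l||] /=; rewrite ?(leqW hr) // /upd; case: eqP => _;
  by have := hB q; lia.
Qed.

(** An instruction raises a register by at most one, so all tracks stay below [B + n] during n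
    instructions. *)
Lemma sim_iter n pc s B : (forall r, s r <= B) ->
  (forall i, i < n -> nth IRej code (iter i (mstep W code) (pc, s)).1 <> IAcc /\
      nth IRej code (iter i (mstep W code) (pc, s)).1 <> IRej) ->
  exists2 t, t <= n * (2 * (B + n) + 4) &
    iter t (astep ctm) (st 0 pc, atape s, 0) =
    (st 0 (iter n (mstep W code) (pc, s)).1, atape (iter n (mstep W code) (pc, s)).2, 0).
Proof.
elim: n pc s B => [|n IH] pc s B hB hn; first by exists 0.
have [hA hR] := hn 0 isT.
have [t1 ht1 E1] := sim_step s hA hR.
have [|t2 ht2 E2] := IH (mstep W code (pc, s)).1 _ B.+1 (mstep_reg_le pc hB).
  by move=> i hi; have := hn i.+1 hi; rewrite iterSr -surjective_pairing.
exists (t2 + t1).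
  have h := hB (instr_reg (nth IRej code pc)).
  rewrite mulSn addnC leq_add //; first apply: (leq_trans ht1).
    by rewrite leq_add2r leq_mul2l (leq_trans h) // leq_addr.
  by apply: (leq_trans ht2); rewrite leq_mul //; lia.
by rewrite iterD E1 E2 iterSr -surjective_pairing.
Qed.

(** Two steps are added to the simulation: the one that marks cell 0 and the one that enters the
    halting state. *)
Lemma sim_run n (b : bool) (s : nat -> nat) pc :
  iter n (mstep W code) (0, fun=> 0) = (pc, s) ->
  nth IRej code pc = (if b then IAcc else IRej) ->
  exists2 t, t <= n * (2 * n + 4) + 2 &
    forall f, (forall i, f i = nth 0 W i) ->
    (iter t (astep ctm) (0, f, 0)).1.1 = (if b then 1 else 2).
Proof.
move=> E1 E2.
have [n0 [hn0 hb hlt]] : exists n0, [/\ n0 <= n, nth IRej code (iter n0 (mstep W code) (0, fun=> 0)).1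
    = (if b then IAcc else IRej) & forall i, i < n0 ->
    nth IRej code (iter i (mstep W code) (0, fun=> 0)).1 <> IAcc /\
    nth IRej code (iter i (mstep W code) (0, fun=> 0)).1 <> IRej].
  (* The simulation only covers non-halting instructions, so it is cut at the first halting one,
     after which the counter program no longer changes. *)
  pose isf x := match nth IRej code (iter x (mstep W code) (0, fun=> 0)).1 with
                IAcc => true | IRej => true | _ => false end.
  have ex : exists i, isf i by exists n; rewrite /isf E1 /= E2; case: (b).
  case: (ex_minnP ex) => n0 h0 hmin; exists n0.
  have hn : n0 <= n by apply: hmin; rewrite /isf E1 /= E2; case: (b).
  split => //.
    have stay j : iter (j + n0) (mstep W code) (0, fun=> 0) = iter n0 (mstep W code) (0, fun=> 0).
      elim: j => // j IH; rewrite addSn iterS IH; move: h0; rewrite /isf.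
      case: (iter n0 _ _) => pc0 s0 /=; by case: (nth _ _ _).
    by rewrite -[in LHS](stay (n - n0)) subnK // E1.
  move=> i hi; split => e; have := hmin i; rewrite /isf e => /(_ isT); lia.
have [t ht E] := @sim_iter n0 0 (fun=> 0) 0 (fun=> leqnn _) hlt.
exists (1 + t + 1); first by nia.
move=> f hf; rewrite !iterD.
(* After cell 0 is marked, the tape is the one for all counters zero: the other cells carry no
   marks. *)
have -> : iter 1 (astep ctm) (0, f, 0) = (st 0 0, atape (fun=> 0), 0).
  rewrite /= /cdelta /sflags /sbase hf.
  have -> : (nth 0 W 0) %/ 4 = 0 by rewrite divn_small.
  rewrite /= modn_small //; congr (_, _, _); apply: functional_extensionality => i.
  rewrite /upd /atape.
  have -> : [set r : 'I_m.+1 | i < 0] = set0 by apply/setP => r; rewrite !inE.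
  by case: eqP => [->|ne] //; rewrite senc_noflag.
by rewrite E [iter 1 _ _]astep_exec hb; case: (b).
Qed.
End CounterTM.

(** Halting states are fixed, so the verdict at one halting time decides all time bounds. The first
    half also covers bounds shorter than the run, as happens for overlong certificates. *)
Lemma accepts_within_halt (M : TM) t x y f q :
  (forall i, f i = nth 0 (map sym_of_bit x ++ 3 :: map sym_of_bit y) i) ->
  (iter t (astep M) (0, f, 0)).1.1 = q -> (q == 1) || (q == 2) ->
  (forall T, accepts_within M T x y -> q = 1) /\
  (q = 1 -> forall T, t <= T -> accepts_within M T x y).
Proof.
move=> hf hq hq12.
have H T : (iter T (tm_step M) (0, [::], map sym_of_bit x ++ 3 :: map sym_of_bit y)).1.1
           = (iter T (astep M) (0, f, 0)).1.1.
  have [-> _ _] // : repc (iter T (tm_step M) (0, [::], map sym_of_bit x ++ 3 :: map sym_of_bit y))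
      (iter T (astep M) (0, f, 0)).
  by apply: repc_iter; split.
have stay T1 T2 : T1 <= T2 -> let q1 := (iter T1 (astep M) (0, f, 0)).1.1 in
   (q1 == 1) || (q1 == 2) -> (iter T2 (astep M) (0, f, 0)).1.1 = q1.
  move=> h /=; rewrite -(subnK h) iterD.
  by case: (iter T1 _ _) => [[q1 f1] p1] /= h1; rewrite astep_halt.
split=> [T|q1 T hT]; rewrite /accepts_within H.
  move=> /eqP e; case: (leqP t T) => h.
    by rewrite -hq -e -(stay t T) // hq.
  by rewrite -hq (stay T t) ?e // ltnW.
by rewrite (stay t T) // hq ?q1.
Qed.

(** * While programs *)

Inductive cmd :=
| CSkip
| CInc of nat
| CDec of nat
| CSeq of cmd & cmd
| CWhile of nat & cmd
| CIfRd of nat & nat & cmd & cmd.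

(** The count is exact for the assembled code: a round of a loop pays for the test and the jump
    back, and the branch taken when the symbol differs pays for the jump over the other branch. *)
Inductive exec (W : seq nat) : cmd -> (nat -> nat) -> nat -> (nat -> nat) -> Prop :=
| ex_skip s : exec W CSkip s 0 s
| ex_inc r s : exec W (CInc r) s 1 (upd s r (s r).+1)
| ex_dec r s : exec W (CDec r) s 1 (upd s r (s r).-1)
| ex_seq c1 c2 s1 t1 s2 t2 s3 : exec W c1 s1 t1 s2 -> exec W c2 s2 t2 s3 ->
    exec W (CSeq c1 c2) s1 (t1 + t2) s3
| ex_while0 r c s : s r = 0 -> exec W (CWhile r c) s 1 s
| ex_while1 r c s1 t1 s2 t2 s3 : s1 r <> 0 -> exec W c s1 t1 s2 ->
    exec W (CWhile r c) s2 t2 s3 -> exec W (CWhile r c) s1 (1 + t1 + 1 + t2) s3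
| ex_rdT r a c1 c2 s1 t s2 : nth 0 W (s1 r) = a -> exec W c1 s1 t s2 ->
    exec W (CIfRd r a c1 c2) s1 (1 + t) s2
| ex_rdF r a c1 c2 s1 t s2 : nth 0 W (s1 r) <> a -> exec W c2 s1 t s2 ->
    exec W (CIfRd r a c1 c2) s1 (1 + t + 1) s2.

Fixpoint csize (c : cmd) : nat :=
  match c with
  | CSkip => 0
  | CInc _ => 1
  | CDec _ => 1
  | CSeq c1 c2 => csize c1 + csize c2
  | CWhile _ c => (csize c).+2
  | CIfRd _ _ c1 c2 => (csize c1 + csize c2).+2
  end.

Fixpoint asm (o : nat) (c : cmd) : seq instr :=
  match c with
  | CSkip => [::]
  | CInc r => [:: IInc r]
  | CDec r => [:: IDec r]
  | CSeq c1 c2 => asm o c1 ++ asm (o + csize c1) c2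
  | CWhile r c => IJz r (o + (csize c).+2) :: asm o.+1 c ++ [:: IJmp o]
  | CIfRd r a c1 c2 => IRd r a (o + (csize c2).+2) :: asm o.+1 c2 ++
      IJmp (o + (csize c1 + csize c2).+2) :: asm (o + (csize c2).+2) c1
  end.

Lemma size_asm o c : size (asm o c) = csize c.
Proof.
elim: c o => //= [c1 IH1 c2 IH2|r c IH|r a c1 IH1 c2 IH2] o;
by rewrite ?size_cat /= ?size_cat /= ?IH1 ?IH2 ?IH /=; lia.
Qed.

(** Jump targets are absolute, so code is tied to its offset; quantifying over [pre] and [post] lets
    the induction place each subprogram at its own offset. *)
Lemma asm_sound W c s t s' : exec W c s t s' ->
  forall pre post, iter t (mstep W (pre ++ asm (size pre) c ++ post)) (size pre, s)
    = (size pre + csize c, s').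
Proof.
elim=> {c s t s'}.
- by move=> s pre post; rewrite /= addn0.
- by move=> r s pre post; rewrite /= nth_cat ltnn subnn addn1.
- by move=> r s pre post; rewrite /= nth_cat ltnn subnn addn1.
- move=> c1 c2 s1 t1 s2 t2 s3 _ IH1 _ IH2 pre post.
  rewrite /= addnC iterD -!catA IH1 -(size_asm (size pre) c1) -size_cat !catA -catA.
  by rewrite IH2 size_cat addnA.
- by move=> r c s h pre post; rewrite /= nth_cat ltnn subnn /= h eqxx.
- move=> r c s1 t1 s2 t2 s3 /eqP h _ IH1 _ IH2 pre post.
  have -> : 1 + t1 + 1 + t2 = t2 + (1 + (t1 + 1)) by lia.
  rewrite [csize _]/= [asm _ _]/=.
  have := IH1 (rcons pre (IJz r (size pre + (csize c).+2))) (IJmp (size pre) :: post).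
  rewrite size_rcons cat_rcons; set code := pre ++ _ => E1.
  have -> : pre ++ (IJz r (size pre + (csize c).+2) :: asm (size pre).+1 c ++ [:: IJmp (size pre)]) ++ post = code.
    by rewrite /code /= -catA.
  have := IH2 pre post.
  have -> : pre ++ (IJz r (size pre + (csize c).+2) :: asm (size pre).+1 c ++ [:: IJmp (size pre)]) ++ post = code.
    by rewrite /code /= -catA.
  move=> E2.
  rewrite !iterD.
  have -> : iter 1 (mstep W code) (size pre, s1) = ((size pre).+1, s1).
    by rewrite /= {1}/code nth_cat ltnn subnn /= (negbTE h).
  rewrite E1.
  have -> : iter 1 (mstep W code) ((size pre).+1 + csize c, s2) = (size pre, s2).
    rewrite /= {1}/code nth_cat ifF; last by lia.
    have -> : (size pre).+1 + csize c - size pre = (csize c).+1 by lia.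
    by rewrite /= nth_cat size_asm ltnn subnn.
  by rewrite E2.
- move=> r a c1 c2 s1 t s2 h _ IH pre post.
  rewrite addnC iterD /= nth_cat ltnn subnn /= h eqxx.
  have := IH (pre ++ IRd r a (size pre + (csize c2).+2) :: asm (size pre).+1 c2
     ++ [:: IJmp (size pre + (csize c1 + csize c2).+2)]) post.
  rewrite size_cat /= size_cat /= size_asm addn1 -!catA /= -!catA /= => ->.
  by congr (_, _); lia.
- move=> r a c1 c2 s1 t s2 /eqP h _ IH pre post.
  rewrite [csize _]/= [asm _ _]/=.
  have := IH (rcons pre (IRd r a (size pre + (csize c2).+2)))
   (IJmp (size pre + (csize c1 + csize c2).+2) :: asm (size pre + (csize c2).+2) c1 ++ post).
  rewrite size_rcons cat_rcons; set code := pre ++ _ => E1.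
  set code' := pre ++ _.
  have -> : code' = code by rewrite /code /code' /= -catA.
  have -> : 1 + t + 1 = 1 + (t + 1) by lia.
  rewrite !iterD.
  have -> : iter 1 (mstep W code) (size pre, s1) = ((size pre).+1, s1).
    by rewrite /= {1}/code nth_cat ltnn subnn /= (negbTE h).
  rewrite E1 /= {1}/code nth_cat ifF; last by lia.
  have -> : (size pre).+1 + csize c2 - size pre = (csize c2).+1 by lia.
  by rewrite /= nth_cat size_asm ltnn subnn /=.
Qed.

Fixpoint maxreg (c : cmd) : nat :=
  match c with
  | CSkip => 0
  | CInc r => r
  | CDec r => r
  | CSeq c1 c2 => maxn (maxreg c1) (maxreg c2)
  | CWhile r c => maxn r (maxreg c)
  | CIfRd r _ c1 c2 => maxn r (maxn (maxreg c1) (maxreg c2))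
  end.

Lemma asm_regs o c : all (fun i => instr_reg i <= maxreg c) (asm o c).
Proof.
elim: c o => //= [r|r|c1 IH1 c2 IH2|r c IH|r a c1 IH1 c2 IH2] o; rewrite ?leqnn //.
- rewrite all_cat; apply/andP; split.
    by apply: sub_all (IH1 o) => i h; apply: leq_trans h (leq_maxl _ _).
  by apply: sub_all (IH2 _) => i h; apply: leq_trans h (leq_maxr _ _).
- rewrite leq_maxl all_cat /= andbT.
  by apply: sub_all (IH _) => i h; apply: leq_trans h (leq_maxr _ _).
- rewrite leq_maxl all_cat /=; apply/andP; split.
    by apply: sub_all (IH2 _) => i h; lia.
  by apply: sub_all (IH1 _) => i h; lia.
Qed.

Definition runs (W : seq nat) (c : cmd) (s : nat -> nat) (B : nat) (s' : nat -> nat) : Prop :=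
  exists2 t, t <= B & exec W c s t s'.

Lemma runs_le W c s B B' s' : B <= B' -> runs W c s B s' -> runs W c s B' s'.
Proof. by move=> h [t ht E]; exists t => //; apply: leq_trans h. Qed.

Lemma runs_seq W c1 c2 s1 B1 s2 B2 s3 : runs W c1 s1 B1 s2 -> runs W c2 s2 B2 s3 ->
  runs W (CSeq c1 c2) s1 (B1 + B2) s3.
Proof.
by move=> [t1 h1 E1] [t2 h2 E2]; exists (t1 + t2); [rewrite leq_add | apply: ex_seq E1 E2].
Qed.

Lemma runs_skip W s : runs W CSkip s 0 s.
Proof. by exists 0 => //; constructor. Qed.
Lemma runs_inc W s r : runs W (CInc r) s 1 (upd s r (s r).+1).
Proof. by exists 1 => //; constructor. Qed.
Lemma runs_dec W s r : runs W (CDec r) s 1 (upd s r (s r).-1).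
Proof. by exists 1 => //; constructor. Qed.

(** [S i] is the store after i rounds; prescribing the whole family turns a loop into one
    verification condition per round. *)
Lemma runs_loop W r c n B (S : nat -> nat -> nat) :
  (forall i, i <= n -> S i r = n - i) ->
  (forall i, i < n -> runs W c (S i) B (S i.+1)) ->
  runs W (CWhile r c) (S 0) (n * (B + 2) + 1) (S n).
Proof.
elim: n S => [|n IH] S hr hc.
  by exists 1 => //; apply: ex_while0; rewrite hr.
have [t1 h1 E1] := hc 0 isT.
have [||t2 h2 E2] := IH (fun i => S i.+1).
- by move=> i hi; rewrite hr.
- by move=> i hi; apply: hc.
exists (1 + t1 + 1 + t2); last by apply: ex_while1 E1 E2; rewrite hr.
by rewrite mulSn; lia.
Qed.

Lemma runs_ifrd W r a c1 c2 s B s' :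
  (nth 0 W (s r) = a -> runs W c1 s B s') -> (nth 0 W (s r) <> a -> runs W c2 s B s') ->
  runs W (CIfRd r a c1 c2) s (B + 2) s'.
Proof.
move=> h1 h2; case: (eqVneq (nth 0 W (s r)) a) => [e|/eqP ne].
  by case: (h1 e) => t ht E; exists (1 + t); [lia | apply: ex_rdT].
by case: (h2 ne) => t ht E; exists (1 + t + 1); [lia | apply: ex_rdF].
Qed.

Ltac updeq := apply: functional_extensionality => ?; rewrite /upd;
  repeat (case: eqP => ? //; subst); try by lia.

(** * Transfers between counters *)

Definition cclr r := CWhile r (CDec r).
Definition cmov r q := CWhile r (CSeq (CDec r) (CInc q)).
Definition csub r q := CWhile r (CSeq (CDec r) (CDec q)).
Definition ccopy r q t := CSeq (CWhile r (CSeq (CDec r) (CSeq (CInc q) (CInc t)))) (cmov t r).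

Lemma runs_cclr W r s : runs W (cclr r) s (3 * s r + 1) (upd s r 0).
Proof.
have := @runs_loop W r (CDec r) (s r) 1 (fun i => upd s r (s r - i)).
rewrite subn0 upd_id subnn mulnC => H; apply: H => i hi.
  by rewrite /upd eqxx.
by have := @runs_dec W (upd s r (s r - i)) r; congr runs; updeq.
Qed.

Lemma runs_cmov W r q s : r != q ->
  runs W (cmov r q) s (4 * s r + 1) (upd (upd s r 0) q (s q + s r)).
Proof.
move=> /eqP ne.
have := @runs_loop W r (CSeq (CDec r) (CInc q)) (s r) 2 (fun i => upd (upd s r (s r - i)) q (s q + i)).
rewrite subn0 upd_id addn0 upd_id subnn mulnC => H; apply: H => i hi.
  by rewrite /upd eqxx; case: eqP.
have := runs_seq (@runs_dec W (upd (upd s r (s r - i)) q (s q + i)) r) (@runs_inc W _ q).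
by congr runs; updeq.
Qed.

Lemma runs_csub W r q s : r != q ->
  runs W (csub r q) s (4 * s r + 1) (upd (upd s r 0) q (s q - s r)).
Proof.
move=> /eqP ne.
have := @runs_loop W r (CSeq (CDec r) (CDec q)) (s r) 2 (fun i => upd (upd s r (s r - i)) q (s q - i)).
rewrite subn0 upd_id subn0 upd_id subnn mulnC => H; apply: H => i hi.
  by rewrite /upd eqxx; case: eqP.
have := runs_seq (@runs_dec W (upd (upd s r (s r - i)) q (s q - i)) r) (@runs_dec W _ q).
by congr runs; updeq.
Qed.

Lemma runs_ccopy W r q t s : r != q -> t != q -> r != t -> s t = 0 ->
  runs W (ccopy r q t) s (9 * s r + 2) (upd s q (s q + s r)).
Proof.
move=> /eqP n1 /eqP n2 n3 h.
have := @runs_loop W r (CSeq (CDec r) (CSeq (CInc q) (CInc t))) (s r) 3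
  (fun i => upd (upd (upd s r (s r - i)) q (s q + i)) t (s t + i)).
rewrite subn0 upd_id !addn0 upd_id upd_id => H.
have {}H := runs_seq (H _ _) (@runs_cmov W t r _ _).
have := H _ _ _; rewrite eq_sym n3 => {}H; apply: runs_le; last first.
  have -> : upd s q (s q + s r) = upd (upd (upd (upd (upd s r (s r - s r)) q (s q + s r)) t (s t + s r)) t 0) r
    (upd (upd (upd s r (s r - s r)) q (s q + s r)) t (s t + s r) r + upd (upd (upd s r (s r - s r)) q (s q + s r)) t (s t + s r) t).
    move/eqP: n3 => n3; updeq.
  apply: H => // i hi; move/eqP: n3 => n3.
    by rewrite /upd eqxx; do ![case: eqP => //].
  have := runs_seq (@runs_dec W (upd (upd (upd s r (s r - i)) q (s q + i)) t (s t + i)) r)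
     (runs_seq (@runs_inc W _ q) (@runs_inc W _ t)).
  by congr runs; updeq.
by rewrite /upd eqxx h; lia.
Qed.

(** * Bounded-recursion terms run in polynomial time *)

(** [TIs] and [TLen] are the only access to the tape. [TTake] forgets all but the first k variables,
    so a term written for its own arguments can be called in any environment. *)
Inductive term :=
| TV of nat
| TK of nat
| TIs of nat & term
| TLen
| TAdd of term & term
| TSub of term & term
| TMul of term & term
| TLet of term & term
| TTake of nat & term
| TRec of term & term & term.

(** In [TRec] the clip b is evaluated in the outer environment and applied in every round. An
    accumulator therefore never exceeds the value of a fixed term, and growth is not iterated. *)
Fixpoint ev (W e : seq nat) (t : term) : nat :=
  match t with
  | TV i => nth 0 e i
  | TK c => c
  | TIs a p => nth 0 W (ev W e p) == a
  | TLen => find (pred1 0) W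
  | TAdd a b => ev W e a + ev W e b
  | TSub a b => ev W e a - ev W e b
  | TMul a b => ev W e a * ev W e b
  | TLet a b => ev W (ev W e a :: e) b
  | TTake k a => ev W (take k e) a
  | TRec n b st =>
      iteri (ev W e n) (fun i acc => minn (ev W e b) (ev W [:: i, acc & e] st)) 0
  end.

(** [rs] lists the registers of the variables and R is the first free one; registers from R on are
    zero before, the result arrives in R, and all others are restored. In [TRec], R to [R.+3] hold
    the accumulator, the rounds left, the index and the clip. *)
Fixpoint tc (rs : seq nat) (R : nat) (t : term) : cmd :=
  match t with
  | TV i => if i < size rs then ccopy (nth 0 rs i) R R.+1 else CSkip
  | TK c => iter c (CSeq (CInc R)) CSkip
  | TIs a p => CSeq (tc rs R.+1 p) (CSeq (CIfRd R.+1 a (CInc R) CSkip) (cclr R.+1))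
  | TLen => CSeq (CInc R.+1) (CWhile R.+1 (CIfRd R 0 (CDec R.+1) (CInc R)))
  | TAdd a b => CSeq (tc rs R a) (CSeq (tc rs R.+1 b) (cmov R.+1 R))
  | TSub a b => CSeq (tc rs R a) (CSeq (tc rs R.+1 b) (csub R.+1 R))
  | TMul a b => CSeq (tc rs R.+1 a) (CSeq (tc rs R.+2 b) (CSeq
      (CWhile R.+1 (CSeq (CDec R.+1) (ccopy R.+2 R R.+3))) (cclr R.+2)))
  | TLet a b => CSeq (tc rs R a) (CSeq (tc (R :: rs) R.+1 b) (CSeq (cclr R) (cmov R.+1 R)))
  | TTake k a => tc (take k rs) R a
  | TRec n b st => CSeq (tc rs R.+1 n) (CSeq (tc rs R.+3 b) (CSeq
      (CWhile R.+1 (CSeq (CDec R.+1) (CSeq (tc [:: R.+2, R & rs] R.+4 st) (CSeq (cclr R)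
        (CSeq (ccopy R.+4 R.+4.+1 R.+4.+2) (CSeq (ccopy R.+3 R.+4.+2 R.+4.+3)
        (CSeq (csub R.+4.+2 R.+4.+1) (CSeq (csub R.+4.+1 R.+4) (CSeq (cmov R.+4 R)
        (CInc R.+2))))))))))
      (CSeq (cclr R.+2) (cclr R.+3))))
  end.

(** A single power stands for a polynomial; the restriction to b at least 2 lets the exponent absorb
    constants and sums. *)
Definition polyb (g : nat -> nat) := exists E, forall b, 2 <= b -> g b <= b ^ E.

Lemma leq_expn2r m n e : m <= n -> m ^ e <= n ^ e.
Proof. by case: e => // e h; rewrite leq_exp2r. Qed.

Lemma polyb_const c : polyb (fun=> c).
Proof.
exists c => b hb; apply: leq_trans (ltnW (ltn_expl c (ltnSn 1))) _.
exact: leq_expn2r.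
Qed.

Lemma polyb_id : polyb id.
Proof. by exists 1 => b _; rewrite expn1. Qed.

Lemma polyb_mul f g : polyb f -> polyb g -> polyb (fun b => f b * g b).
Proof.
move=> [E1 H1] [E2 H2]; exists (E1 + E2) => b hb.
by rewrite expnD leq_mul ?H1 ?H2.
Qed.

Lemma polyb_add f g : polyb f -> polyb g -> polyb (fun b => f b + g b).
Proof.
move=> [E1 H1] [E2 H2]; exists (E1 + E2).+1 => b hb.
rewrite expnS; apply: (@leq_trans (2 * b ^ (E1 + E2))); last by rewrite leq_mul2r hb orbT.
rewrite mul2n -addnn leq_add //; [apply: leq_trans (H1 b hb) _|apply: leq_trans (H2 b hb) _];
  by rewrite leq_pexp2l //; lia.
Qed.

Lemma polyb_exp f E : polyb f -> polyb (fun b => f b ^ E).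
Proof.
move=> [E1 H1]; exists (E1 * E) => b hb.
by rewrite expnM leq_expn2r // H1.
Qed.

Lemma runs_eq W c s B B' s1 s2 : runs W c s B s1 -> B <= B' -> s1 = s2 -> runs W c s B' s2.
Proof. by move=> h hB <-; apply: runs_le h. Qed.

Lemma runs_cclr_at W r s v : s r = v -> runs W (cclr r) s (3 * v + 1) (upd s r 0).
Proof. by move=> <-; apply: runs_cclr. Qed.

Lemma runs_cmov_at W r q s v u : r != q -> s r = v -> s q = u ->
  runs W (cmov r q) s (4 * v + 1) (upd (upd s r 0) q (u + v)).
Proof. by move=> n <- <-; apply: runs_cmov. Qed.

Lemma runs_csub_at W r q s v u : r != q -> s r = v -> s q = u ->
  runs W (csub r q) s (4 * v + 1) (upd (upd s r 0) q (u - v)).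
Proof. by move=> n <- <-; apply: runs_csub. Qed.

Lemma runs_ccopy_at W r q t s v u : r != q -> t != q -> r != t -> s t = 0 -> s r = v -> s q = u ->
  runs W (ccopy r q t) s (9 * v + 2) (upd s q (u + v)).
Proof. by move=> n1 n2 n3 h <- <-; apply: runs_ccopy. Qed.

Lemma upd_same s r v : upd s r v r = v.
Proof. by rewrite /upd eqxx. Qed.

Lemma upd_other s r v x : x != r -> upd s r v x = s x.
Proof. by rewrite /upd => /negbTE ->. Qed.

Definition regs7 (s : nat -> nat) R a0 a1 a2 a3 a4 a5 a6 : nat -> nat :=
  upd (upd (upd (upd (upd (upd (upd s R a0) R.+1 a1) R.+2 a2) R.+3 a3) R.+4 a4) R.+4.+1 a5) R.+4.+2 a6.

Ltac updlia := rewrite /regs7 /upd; repeat (case: eqP => ?; try (exfalso; lia)); try lia.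
Ltac updeqr := apply: functional_extensionality => ?; updlia.

Definition zero_from (s : nat -> nat) R := forall r, R <= r -> s r = 0.

Lemma regs7_zero s R a0 a1 a2 a3 a4 a5 a6 : zero_from s R ->
  zero_from (regs7 s R a0 a1 a2 a3 a4 a5 a6) R.+4.+3.
Proof. by move=> h r hr; updlia; apply: h; lia. Qed.

Lemma regs7_low s R a0 a1 a2 a3 a4 a5 a6 x : x < R -> regs7 s R a0 a1 a2 a3 a4 a5 a6 x = s x.
Proof. by move=> h; updlia. Qed.

Lemma map_regs7 s R a0 a1 a2 a3 a4 a5 a6 rs : all (fun r => r < R) rs ->
  map (regs7 s R a0 a1 a2 a3 a4 a5 a6) rs = map s rs.
Proof. by move=> /allP h; apply/eq_in_map => x /h hx; apply: regs7_low. Qed.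

(** The size measure counts the values of the variables as well as the word; the 2 puts it in the
    range where [polyb] applies. *)
Definition base (W e : seq nat) := size W + sumn e + 2.

(** The value is bounded along with the time because it becomes part of the environment of other
    terms. The exponent depends on the term only, not on the word, the environment or the
    registers. *)
Definition term_ok (t : term) (E : nat) : Prop :=
  forall W rs R s, all (fun r => r < R) rs -> zero_from s R ->
    let e := map s rs in
    ev W e t <= base W e ^ E /\
    runs W (tc rs R t) s (base W e ^ E) (upd s R (ev W e t)).

Lemma all_ltS rs R R' : R <= R' -> all (fun r => r < R) rs -> all (fun r => r < R') rs.
Proof. by move=> h; apply: sub_all => x hx; apply: leq_trans hx h. Qed.

Lemma sumn_take k (e : seq nat) : sumn (take k e) <= sumn e.
Proof. by rewrite -{2}(cat_take_drop k e) sumn_cat leq_addr. Qed.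

Lemma nth_sumn (e : seq nat) i : nth 0 e i <= sumn e.
Proof. by elim: e i => [|a e IH] [|i] //=; [rewrite leq_addr | apply: leq_trans (IH i) (leq_addl _ _)]. Qed.

Lemma runs_const W c s R : runs W (iter c (CSeq (CInc R)) CSkip) s c (upd s R (s R + c)).
Proof.
elim: c s => [|c IH] s; first by rewrite addn0 upd_id; apply: runs_skip.
apply: runs_eq (runs_seq (@runs_inc W s R) (IH _)) _ _; [lia | updeqr].
Qed.

Lemma term_okV i : exists E, term_ok (TV i) E.
Proof.
have [E HE] : polyb (fun b => 9 * b + 2).
  by apply: polyb_add (polyb_mul (polyb_const _) polyb_id) (polyb_const _).
exists E => W rs R s hrs hz e.
have hE := HE (base W e) ltac:(rewrite /base; lia).
have hi : ev W e (TV i) <= base W e.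
  by rewrite /=; apply: leq_trans (nth_sumn _ _) _; rewrite /base; lia.
split; first by apply: leq_trans hE; lia.
move: hi; rewrite /=; case: ltnP => h hi.
  have hR : nth 0 rs i < R by apply: (allP hrs); apply: mem_nth.
  move: hi; rewrite /e (nth_map 0) // => hi.
  have n1 : nth 0 rs i != R by rewrite neq_ltn hR.
  have n2 : R.+1 != R by rewrite gtn_eqF.
  have n3 : nth 0 rs i != R.+1 by rewrite neq_ltn ltnS ltnW.
  have z1 : s R.+1 = 0 by apply: hz; lia.
  apply: runs_eq (runs_ccopy W n1 n2 n3 z1) _ _; last by rewrite (hz R).
  by apply: leq_trans hE; rewrite leq_add2r leq_mul2l.
have -> : nth 0 e i = s R by rewrite (hz R) // nth_default // /e size_map.
by rewrite upd_id; apply: runs_le (runs_skip W s).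
Qed.

Lemma term_okK c : exists E, term_ok (TK c) E.
Proof.
have [E HE] := polyb_const c.
exists E => W rs R s hrs hz e.
have hE := HE (base W e) ltac:(rewrite /base; lia).
split => //=; apply: runs_eq (@runs_const W c s R) _ _ => //.
by rewrite hz.
Qed.

Lemma term_okIs a p E : term_ok p E -> exists E, term_ok (TIs a p) E.
Proof.
move=> ok.
have [E' HE] : polyb (fun b => 4 * b ^ E + 10).
  by apply: polyb_add (polyb_mul (polyb_const _) (polyb_exp _ polyb_id)) (polyb_const _).
exists E' => W rs R s hrs hz e.
have hE := HE (base W e) ltac:(rewrite /base; lia).
have [h1 h2] := ok W rs R.+1 s (all_ltS (leqnSn R) hrs) (fun r h => hz r (ltnW h)).
rewrite -/e in h1 h2; split; first by rewrite /=; apply: leq_trans hE; case: eqP => _; lia.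
rewrite /=; set v := ev W e p in h1 h2 *.
set s1 := upd s R.+1 v in h2.
have h3 := @runs_ifrd W R.+1 a (CInc R) CSkip s1 1 (upd s1 R (nth 0 W v == a)) _ _.
have hR1 : s1 R.+1 = v by rewrite /s1 /upd eqxx.
have hR : s1 R = 0 by rewrite /s1 /upd ltn_eqF // hz.
rewrite hR1 in h3.
have h4 := @runs_cclr W R.+1 (upd s1 R (nth 0 W v == a)).
have e4 : upd s1 R (nth 0 W v == a) R.+1 = v by rewrite /upd gtn_eqF.
rewrite e4 in h4.
apply: runs_eq (runs_seq h2 (runs_seq (h3 _ _) h4)) _ _.
- by move=> ->; rewrite eqxx; have := @runs_inc W s1 R; rewrite hR.
- move/eqP=> /negbTE ->.
  by apply: runs_eq (runs_skip W s1) _ _; rewrite // -[LHS](upd_id s1 R) hR.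
- by apply: leq_trans hE; lia.
- apply: functional_extensionality => x; rewrite /s1 /upd.
  by case: eqP => [->|//]; rewrite gtn_eqF // hz.
Qed.

Lemma map_upd_ge s R v rs : all (fun r => r < R) rs -> map (upd s R v) rs = map s rs.
Proof. by move=> /allP h; apply/eq_in_map => x /h hx; rewrite /upd ltn_eqF. Qed.

Lemma zero_upd s R v : zero_from s R -> zero_from (upd s R v) R.+1.
Proof. by move=> h r hr; rewrite /upd gtn_eqF // h // ltnW. Qed.

Lemma term_ok_pair a b E1 E2 W rs R s : term_ok a E1 -> term_ok b E2 ->
  all (fun r => r < R) rs -> zero_from s R -> let e := map s rs in let B := base W e in
  [/\ ev W e a <= B ^ E1, ev W e b <= B ^ E2 &
      runs W (CSeq (tc rs R a) (tc rs R.+1 b)) s (B ^ E1 + B ^ E2) (upd (upd s R (ev W e a)) R.+1 (ev W e b))].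
Proof.
move=> ok1 ok2 hrs hz e B.
have [h1 h2] := ok1 W rs R s hrs hz.
have [] := ok2 W rs R.+1 (upd s R (ev W e a)) (all_ltS (leqnSn R) hrs) (zero_upd _ hz).
by rewrite map_upd_ge // => h3 h4; split => //; apply: runs_seq h2 h4.
Qed.

Lemma runs_seqA W c1 c2 c3 s B s' :
  runs W (CSeq (CSeq c1 c2) c3) s B s' -> runs W (CSeq c1 (CSeq c2 c3)) s B s'.
Proof.
case=> t ht E; inversion E as [| | |? ? ? t1 ? t2 ? E12 E3| | | |]; subst.
inversion E12 as [| | |? ? ? t3 ? t4 ? E1 E2| | | |]; subst.
exists (t3 + (t4 + t2)); first by rewrite addnA.
by apply: ex_seq E1 (ex_seq E2 E3).
Qed.

Lemma term_okAdd a b E1 E2 : term_ok a E1 -> term_ok b E2 -> exists E, term_ok (TAdd a b) E.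
Proof.
move=> ok1 ok2.
have [E HE] : polyb (fun x => x ^ E1 + 5 * x ^ E2 + 1).
  apply: polyb_add (polyb_add (polyb_exp _ polyb_id) _) (polyb_const _).
  exact: polyb_mul (polyb_const _) (polyb_exp _ polyb_id).
exists E => W rs R s hrs hz e.
have hE := HE (base W e) ltac:(rewrite /base; lia).
have [h1 h2 h3] := term_ok_pair W ok1 ok2 hrs hz.
rewrite -/e in h1 h2 h3; split; first by apply: leq_trans hE => /=; lia.
have n1 : R.+1 != R by rewrite gtn_eqF.
have h4 := @runs_cmov_at W R.+1 R (upd (upd s R (ev W e a)) R.+1 (ev W e b)) (ev W e b) (ev W e a) n1 _ _.
have {}h4 := h4 (upd_same _ _ _) _.
apply: runs_seqA; apply: runs_eq (runs_seq h3 (h4 _)) _ _.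
- by rewrite upd_other ?upd_same // ltn_eqF.
- by apply: leq_trans hE; lia.
apply: functional_extensionality => x; rewrite /upd.
by case: eqP => [//|_]; case: eqP => [->|//]; rewrite hz.
Qed.

Lemma term_okSub a b E1 E2 : term_ok a E1 -> term_ok b E2 -> exists E, term_ok (TSub a b) E.
Proof.
move=> ok1 ok2.
have [E HE] : polyb (fun x => x ^ E1 + 5 * x ^ E2 + 1).
  apply: polyb_add (polyb_add (polyb_exp _ polyb_id) _) (polyb_const _).
  exact: polyb_mul (polyb_const _) (polyb_exp _ polyb_id).
exists E => W rs R s hrs hz e.
have hE := HE (base W e) ltac:(rewrite /base; lia).
have [h1 h2 h3] := term_ok_pair W ok1 ok2 hrs hz.
rewrite -/e in h1 h2 h3; split; first by apply: leq_trans hE => /=; lia.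
have n1 : R.+1 != R by rewrite gtn_eqF.
have h4 := @runs_csub_at W R.+1 R (upd (upd s R (ev W e a)) R.+1 (ev W e b)) (ev W e b) (ev W e a) n1 _ _.
have {}h4 := h4 (upd_same _ _ _) _.
apply: runs_seqA; apply: runs_eq (runs_seq h3 (h4 _)) _ _.
- by rewrite upd_other ?upd_same // ltn_eqF.
- by apply: leq_trans hE; lia.
apply: functional_extensionality => x; rewrite /upd.
by case: eqP => [//|_]; case: eqP => [->|//]; rewrite hz.
Qed.

Lemma term_okTake k a E : term_ok a E -> term_ok (TTake k a) E.
Proof.
move=> ok W rs R s hrs hz e.
have hrs' : all (fun r => r < R) (take k rs).
  by apply/allP => x /mem_take; apply: (allP hrs).
have hb : base W (map s (take k rs)) <= base W e.
  by rewrite /base leq_add2r leq_add2l map_take sumn_take.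
have [] := ok W (take k rs) R s hrs' hz; rewrite /= -map_take => h1 h2.
by split; [apply: leq_trans h1 (leq_expn2r _ _) | apply: runs_le h2; apply: leq_expn2r].
Qed.

(** The body runs in an environment enlarged by the value of a, so its bound is a power of
    [base + base ^ E1], again a power. *)
Lemma term_okLet a b E1 E2 : term_ok a E1 -> term_ok b E2 -> exists E, term_ok (TLet a b) E.
Proof.
move=> ok1 ok2.
have [E HE] : polyb (fun x => 4 * x ^ E1 + 5 * (x + x ^ E1) ^ E2 + 2).
  apply: polyb_add (polyb_add _ _) (polyb_const _).
    exact: polyb_mul (polyb_const _) (polyb_exp _ polyb_id).
  apply: polyb_mul (polyb_const _) (polyb_exp _ _).
  exact: polyb_add polyb_id (polyb_exp _ polyb_id).
exists E => W rs R s hrs hz e.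
have hE := HE (base W e) ltac:(rewrite /base; lia).
have [h1 h2] := ok1 W rs R s hrs hz; rewrite -/e in h1 h2.
have hrs' : all (fun r => r < R.+1) (R :: rs) by rewrite /= ltnSn; apply: all_ltS hrs.
have [] := ok2 W (R :: rs) R.+1 (upd s R (ev W e a)) hrs' (zero_upd _ hz).
have -> : map (upd s R (ev W e a)) (R :: rs) = ev W e a :: e.
  by rewrite /= map_upd_ge // {1}/upd eqxx.
have hb : base W (ev W e a :: e) <= base W e + base W e ^ E1 by rewrite {1 2}/base /=; lia.
move/(leq_expn2r E2): hb => hb.
move=> h3 h4; split; first by rewrite /=; apply: leq_trans hE; lia.
set v := ev W e a in h1 h2 h3 h4 hb *.
have {h4} h4 := runs_le hb h4; have {h3} h3 := leq_trans h3 hb.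
set u := ev W (v :: e) b in h3 h4 *.
have n1 : R.+1 != R by rewrite gtn_eqF.
have n2 : R != R.+1 by rewrite ltn_eqF.
have h5 := @runs_cclr_at W R (upd (upd s R v) R.+1 u) v _.
have h6 := @runs_cmov_at W R.+1 R (upd (upd (upd s R v) R.+1 u) R 0) u 0 n1 _ (upd_same _ _ _).
apply: runs_eq (runs_seq h2 (runs_seq h4 (runs_seq (h5 _) (h6 _)))) _ _.
- by rewrite upd_other // upd_same.
- by rewrite upd_other // upd_same.
- by apply: leq_trans hE; lia.
apply: functional_extensionality => x; rewrite /upd.
by case: eqP => [//|_]; case: eqP => [->|//]; rewrite hz.
Qed.

(** Register [R.+1] is a loop flag that is cleared when the counter R points at the first blank. *)
Lemma term_okLen : exists E, term_ok TLen E.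
Proof.
have [E HE] : polyb (fun x => 10 * x + 20).
  by apply: polyb_add (polyb_mul (polyb_const _) polyb_id) (polyb_const _).
exists E => W rs R s hrs hz e.
have hE := HE (base W e) ltac:(rewrite /base; lia).
have hL : find (pred1 0) W <= size W by apply: find_size.
have hB : size W <= base W e by rewrite /base; lia.
split; first by apply: leq_trans hE; apply: leq_trans (leq_trans hL hB) _; lia.
rewrite /=; set L := find _ _ in hL *.
set body := CIfRd _ _ _ _.
have nzW i : i < L -> nth 0 W i <> 0.
  by move=> h; apply/eqP; have := before_find 0 h => /= ->.
have zW : nth 0 W L = 0.
  case: (ltnP L (size W)) => h; last by rewrite nth_default.
  by apply/eqP; have := @nth_find _ 0 (pred1 0) W; rewrite has_find => /(_ h).
have step i : i <= L -> runs W body (upd (upd s R i) R.+1 1) 3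
    (if i == L then upd s R i else upd (upd s R i.+1) R.+1 1).
  move=> hi; apply: (@runs_ifrd W R 0 _ _ _ 1); rewrite {1}/upd ltn_eqF // {1}/upd eqxx => h.
    case: eqP => [_|ne]; last by case: (@nzW i); [lia|].
    apply: runs_eq (@runs_dec W _ R.+1) _ _ => //.
    apply: functional_extensionality => x; rewrite /upd eqxx.
    by case: eqP => [->|//]; rewrite gtn_eqF // hz.
  case: eqP => [e1|ne]; first by move: h; rewrite e1 zW.
  apply: runs_eq (@runs_inc W _ R) _ _ => //.
  apply: functional_extensionality => x; rewrite /upd.
  by repeat (case: eqP => ?; try (exfalso; lia)); try lia.
have loop n i : i + n = L -> runs W (CWhile R.+1 body) (upd (upd s R i) R.+1 1) (5 * n + 6) (upd s R L).
  elim: n i => [|n IH] i hi; have [t ht E1] := step i ltac:(lia).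
    exists (1 + t + 1 + 1); first lia.
    apply: ex_while1 E1 _; first by rewrite /upd eqxx.
    have -> : i = L by lia.
    by rewrite eqxx; apply: ex_while0; rewrite /upd gtn_eqF // hz.
  move: E1; have -> : (i == L) = false by lia.
  move=> E1; have [t2 ht2 E2] := IH i.+1 ltac:(lia).
  exists (1 + t + 1 + t2); first lia.
  by apply: ex_while1 E1 E2; rewrite /upd eqxx.
apply: runs_eq (runs_seq (@runs_inc W s R.+1) _) _ _; last 1 first.
- by [].
- have := loop L 0 (add0n L).
  have -> : upd (upd s R 0) R.+1 1 = upd s R.+1 (s R.+1).+1.
    rewrite (hz R.+1) //; congr upd.
    by rewrite -[RHS](upd_id s R) hz.
  exact.
- by apply: leq_trans hE; lia.
Qed.

Lemma term_okMul a b E1 E2 : term_ok a E1 -> term_ok b E2 -> exists E, term_ok (TMul a b) E.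
Proof.
move=> ok1 ok2.
have [E HE] : polyb (fun x => x ^ E1 + 4 * x ^ E2 + x ^ E1 * (9 * x ^ E2 + 5) + 2).
  apply: polyb_add (polyb_add (polyb_add (polyb_exp _ polyb_id) _) _) (polyb_const _).
    exact: polyb_mul (polyb_const _) (polyb_exp _ polyb_id).
  apply: polyb_mul (polyb_exp _ polyb_id) (polyb_add _ (polyb_const _)).
  exact: polyb_mul (polyb_const _) (polyb_exp _ polyb_id).
exists E => W rs R s hrs hz e.
have hE := HE (base W e) ltac:(rewrite /base; lia).
have hz' : zero_from s R.+1 by move=> r hr; apply: hz; lia.
have [h1 h2 h3] := term_ok_pair W ok1 ok2 (all_ltS (leqnSn R) hrs) hz'.
rewrite -/e in h1 h2 h3.
have hm : ev W e a * ev W e b <= base W e ^ E1 * base W e ^ E2 by apply: leq_mul.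
split; first by rewrite /=; apply: leq_trans hE; nia.
rewrite /=; set u := ev W e a in h1 h2 h3 hm *; set v := ev W e b in h1 h2 h3 hm *.
have n1 : R.+2 != R by apply/eqP; lia.
have n2 : R.+3 != R by apply/eqP; lia.
have n3 : R.+2 != R.+3 by apply/eqP; lia.
pose S i := upd (upd (upd s R (i * v)) R.+1 (u - i)) R.+2 v.
have S0 : upd (upd s R.+1 u) R.+2 v = S 0.
  by rewrite /S mul0n subn0 -[in LHS](upd_id s R) (hz R).
have hl := @runs_loop W R.+1 (CSeq (CDec R.+1) (ccopy R.+2 R R.+3)) u (1 + (9 * v + 2)) S _ _.
rewrite S0 in h3.
have h5 := @runs_cclr_at W R.+2 (S u) v (upd_same _ _ _).
apply: runs_seqA; apply: runs_eq (runs_seq h3 (runs_seq (hl _ _) h5)) _ _.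
- move=> i hi; rewrite /S; rewrite upd_other; last by apply/eqP; lia.
  exact: upd_same.
- move=> i hi.
  have hz3 : upd (S i) R.+1 (S i R.+1).-1 R.+3 = 0.
    by rewrite /S; do 4 (rewrite upd_other; last by apply/eqP; lia); apply: hz; lia.
  apply: runs_eq (runs_seq (@runs_dec W (S i) R.+1) (@runs_ccopy_at W _ _ _ _ v (i * v) n1 n2 n3 hz3 _ _)) _ _ => //.
  - by rewrite upd_other /S ?upd_same //; apply/eqP; lia.
  - rewrite /S; do 3 (rewrite upd_other; last by apply/eqP; lia).
    exact: upd_same.
  rewrite /S; apply: functional_extensionality => x; rewrite /upd.
  by repeat (case: eqP => ?; try (exfalso; lia)); try lia.
- apply: leq_trans hE; have : u * (9 * v + 5) <= base W e ^ E1 * (9 * base W e ^ E2 + 5).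
    by rewrite leq_mul // leq_add2r leq_mul2l h2.
  lia.
- rewrite /S subnn; apply: functional_extensionality => x; rewrite /upd.
  by repeat (case: eqP => ?; try (exfalso; lia)); rewrite // hz //; lia.
Qed.

Lemma iteri_min_le n B f : iteri n (fun i acc => minn B (f i acc)) 0 <= B.
Proof. by case: n => //= n; apply: geq_minl. Qed.

(** By clipping, every accumulator is at most the value of b, so all rounds run in environments of
    size at most [P]; the total is a number of rounds times one fixed power bound. Without the clip
    the bounds of the rounds would compose. *)
Lemma term_okRec n b st E1 E2 E3 : term_ok n E1 -> term_ok b E2 -> term_ok st E3 ->
  exists E, term_ok (TRec n b st) E.
Proof.
move=> ok1 ok2 ok3.
pose P x := x + x ^ E1 + x ^ E2.
(* A budget for one round: the step term, and transfers linear in its value and in the clip. *)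
pose Q x := 35 * x ^ E2 + 30 * P x ^ E3 + 30.
have pE E' : polyb (fun x => x ^ E') by apply: polyb_exp polyb_id.
have pP : polyb P by apply: polyb_add (polyb_add polyb_id (pE _)) (pE _).
have pQ : polyb Q.
  apply: polyb_add (polyb_add _ _) (polyb_const _).
    exact: polyb_mul (polyb_const _) (pE _).
  exact: polyb_mul (polyb_const _) (polyb_exp _ pP).
have [E HE] : polyb (fun x => x ^ E1 + 4 * x ^ E2 + x ^ E1 * (Q x + 2) + 3 * x ^ E1 + 10).
  apply: polyb_add (polyb_add (polyb_add (polyb_add (pE _) _) _) _) (polyb_const _).
  - exact: polyb_mul (polyb_const _) (pE _).
  - exact: polyb_mul (pE _) (polyb_add pQ (polyb_const _)).
  - exact: polyb_mul (polyb_const _) (pE _).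
exists E => W rs R s hrs hz e.
have hE := HE (base W e) ltac:(rewrite /base; lia).
have [] := ok1 W rs R.+1 s (all_ltS (leqnSn R) hrs) (fun r hr => hz r (ltnW hr)).
rewrite -/e; set N := ev W e n => h1 h2.
have hz3 : zero_from (upd s R.+1 N) R.+3.
  by move=> r hr; rewrite upd_other; [apply: hz; lia | apply/eqP; lia].
have hrs3 : all (fun r => r < R.+3) rs by apply: all_ltS hrs; lia.
have [] := ok2 W rs R.+3 _ hrs3 hz3.
rewrite map_upd_ge -/e; last by apply: all_ltS hrs.
set Bd := ev W e b => h3 h4.
set f := fun i acc => minn (ev W e b) (ev W [:: i, acc & e] st).
pose acc i := iteri i f 0.
have hacc i : acc i <= Bd by apply: iteri_min_le.
have hv : ev W e (TRec n b st) = acc N by [].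
split.
  rewrite hv; apply: leq_trans hE; apply: leq_trans (hacc _) _; lia.
rewrite hv; rewrite [tc _ _ _]/=; set body := CSeq (CDec R.+1) _.
pose U := regs7 s R.
pose S i := U (acc i) (N - i) i Bd 0 0 0.
have S0 : upd (upd s R.+1 N) R.+3 Bd = S 0.
  rewrite /S /U /acc /= subn0; apply: functional_extensionality => x; rewrite /regs7 /upd.
  by repeat (case: eqP => ?; try (exfalso; lia)); rewrite // hz //; lia.
rewrite S0 in h4.
have Ux a0 a1 a2 a3 a4 a5 a6 : [/\ U a0 a1 a2 a3 a4 a5 a6 R = a0, U a0 a1 a2 a3 a4 a5 a6 R.+1 = a1,
    U a0 a1 a2 a3 a4 a5 a6 R.+2 = a2, U a0 a1 a2 a3 a4 a5 a6 R.+3 = a3 &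
    [/\ U a0 a1 a2 a3 a4 a5 a6 R.+4 = a4, U a0 a1 a2 a3 a4 a5 a6 R.+4.+1 = a5 &
     U a0 a1 a2 a3 a4 a5 a6 R.+4.+2 = a6]].
  by rewrite /U; split; [updlia..|split; updlia].
have Uz a0 a1 a2 a3 a4 a5 a6 : U a0 a1 a2 a3 a4 a5 a6 R.+4.+3 = 0.
  by apply: (regs7_zero _ _ _ _ _ _ _ hz).
have hbody i : i < N -> runs W body (S i) (Q (base W e)) (S i.+1).
  move=> hi.
  pose S1 := U (acc i) (N - i.+1) i Bd 0 0 0.
  pose v := ev W [:: i, acc i & e] st.
  have c1 : runs W (CDec R.+1) (S i) 1 S1.
    apply: runs_eq (@runs_dec W (S i) R.+1) _ _ => //.
    by rewrite /S1 /S; have [_ -> _ _ _] := Ux (acc i) (N - i) i Bd 0 0 0; rewrite /U; updeqr.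
  have hzS : zero_from S1 R.+4.
    move=> r hr; rewrite /S1 /U; updlia; apply: hz; lia.
  have hrs4 : all (fun r => r < R.+4) [:: R.+2, R & rs].
    by rewrite /=; apply/and3P; split; [lia|lia|apply: all_ltS hrs; lia].
  have [] := ok3 W [:: R.+2, R & rs] R.+4 S1 hrs4 hzS.
  have -> : map S1 [:: R.+2, R & rs] = [:: i, acc i & e].
    have [u1 _ u2 _ _] := Ux (acc i) (N - i.+1) i Bd 0 0 0.
    by rewrite /= /S1 u1 u2 /U map_regs7.
  have hP : base W [:: i, acc i & e] <= P (base W e).
    by rewrite /P {1 2}/base /=; have := hacc i; lia.
  have hP3 := leq_expn2r E3 hP.
  rewrite -/v => v1 v2; have {v1} v1 := leq_trans v1 hP3; have {v2} v2 := runs_le hP3 v2.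
  have {v2} c2 : runs W (tc [:: R.+2, R & rs] R.+4 st) S1 (P (base W e) ^ E3)
      (U (acc i) (N - i.+1) i Bd v 0 0).
    by apply: runs_eq v2 _ _ => //; rewrite /S1 /U; updeqr.
  have c3 : runs W (cclr R) (U (acc i) (N - i.+1) i Bd v 0 0) (3 * acc i + 1)
      (U 0 (N - i.+1) i Bd v 0 0).
    have [g0 _ _ _ _] := Ux (acc i) (N - i.+1) i Bd v 0 0.
    by apply: runs_eq (runs_cclr_at W g0) _ _ => //; rewrite /U; updeqr.
  have c4 : runs W (ccopy R.+4 R.+4.+1 R.+4.+2) (U 0 (N - i.+1) i Bd v 0 0) (9 * v + 2)
      (U 0 (N - i.+1) i Bd v v 0).
    have [_ _ _ _ [g1 g2 g3]] := Ux 0 (N - i.+1) i Bd v 0 0.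
    apply: runs_eq (runs_ccopy_at W _ _ _ g3 g1 g2) _ _ => //; try (by apply/eqP; lia).
    by rewrite /U; updeqr.
  have c5 : runs W (ccopy R.+3 R.+4.+2 R.+4.+3) (U 0 (N - i.+1) i Bd v v 0) (9 * Bd + 2)
      (U 0 (N - i.+1) i Bd v v Bd).
    have [_ _ _ g1 [_ _ g3]] := Ux 0 (N - i.+1) i Bd v v 0.
    apply: runs_eq (runs_ccopy_at W _ _ _ (Uz _ _ _ _ _ _ _) g1 g3) _ _ => //; try (by apply/eqP; lia).
    by rewrite /U; updeqr.
  have c6 : runs W (csub R.+4.+2 R.+4.+1) (U 0 (N - i.+1) i Bd v v Bd) (4 * Bd + 1)
      (U 0 (N - i.+1) i Bd v (v - Bd) 0).
    have [_ _ _ _ [_ g2 g3]] := Ux 0 (N - i.+1) i Bd v v Bd.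
    apply: runs_eq (runs_csub_at W _ g3 g2) _ _ => //; try (by apply/eqP; lia).
    by rewrite /U; updeqr.
  have c7 : runs W (csub R.+4.+1 R.+4) (U 0 (N - i.+1) i Bd v (v - Bd) 0) (4 * (v - Bd) + 1)
      (U 0 (N - i.+1) i Bd (v - (v - Bd)) 0 0).
    have [_ _ _ _ [g1 g2 _]] := Ux 0 (N - i.+1) i Bd v (v - Bd) 0.
    apply: runs_eq (runs_csub_at W _ g2 g1) _ _ => //; try (by apply/eqP; lia).
    by rewrite /U; updeqr.
  (* Two truncated subtractions compute the minimum: [v - (v - Bd)]. *)
  have hacc' : acc i.+1 = v - (v - Bd) by rewrite /acc iteriS /f -/v -/Bd; lia.
  have c8 : runs W (cmov R.+4 R) (U 0 (N - i.+1) i Bd (v - (v - Bd)) 0 0) (4 * (v - (v - Bd)) + 1)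
      (U (acc i.+1) (N - i.+1) i Bd 0 0 0).
    have [g1 _ _ _ [g2 _ _]] := Ux 0 (N - i.+1) i Bd (v - (v - Bd)) 0 0.
    apply: runs_eq (runs_cmov_at W _ g2 g1) _ _ => //; try (by apply/eqP; lia).
    by rewrite hacc' /U; updeqr.
  have c9 : runs W (CInc R.+2) (U (acc i.+1) (N - i.+1) i Bd 0 0 0) 1 (S i.+1).
    apply: runs_eq (@runs_inc W _ R.+2) _ _ => //.
    by rewrite /S; have [_ _ -> _ _] := Ux (acc i.+1) (N - i.+1) i Bd 0 0 0; rewrite /U; updeqr.
  apply: runs_le (runs_seq c1 (runs_seq c2 (runs_seq c3 (runs_seq c4 (runs_seq c5 (runs_seq c6
     (runs_seq c7 (runs_seq c8 c9)))))))).
  by rewrite /Q; have := hacc i; lia.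
have hl := @runs_loop W R.+1 body N (Q (base W e)) S _ hbody.
have d1 : runs W (cclr R.+2) (S N) (3 * N + 1) (U (acc N) 0 0 Bd 0 0 0).
  have [_ _ g0 _ _] := Ux (acc N) 0 N Bd 0 0 0.
  by rewrite /S subnn; apply: runs_eq (runs_cclr_at W g0) _ _ => //; rewrite /U; updeqr.
have d2 : runs W (cclr R.+3) (U (acc N) 0 0 Bd 0 0 0) (3 * Bd + 1) (upd s R (acc N)).
  have [_ _ _ g0 _] := Ux (acc N) 0 0 Bd 0 0 0.
  apply: runs_eq (runs_cclr_at W g0) _ _ => //.
  rewrite /U; apply: functional_extensionality => x; rewrite /regs7 /upd.
  by repeat (case: eqP => ?; try (exfalso; lia)); rewrite // hz //; lia.
apply: runs_eq (runs_seq h2 (runs_seq h4 (runs_seq (hl _) (runs_seq d1 d2)))) _ _ => //.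
  by move=> i hi; rewrite /S; case: (Ux (acc i) (N - i) i Bd 0 0 0).
apply: leq_trans hE.
have : N * (Q (base W e) + 2) <= base W e ^ E1 * (Q (base W e) + 2) by rewrite leq_mul2r h1 orbT.
lia.
Qed.

Lemma term_ok_all t : exists E, term_ok t E.
Proof.
elim: t => [i|c|a p [E1 H1]||a [E1 H1] b [E2 H2]|a [E1 H1] b [E2 H2]|a [E1 H1] b [E2 H2]
  |a [E1 H1] b [E2 H2]|k a [E1 H1]|n [E1 H1] b [E2 H2] st [E3 H3]].
- exact: term_okV.
- exact: term_okK.
- exact: term_okIs H1.
- exact: term_okLen.
- exact: term_okAdd H1 H2.
- exact: term_okSub H1 H2.
- exact: term_okMul H1 H2.
- exact: term_okLet H1 H2.
- by exists E1; apply: term_okTake.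
- exact: term_okRec H1 H2 H3.
Qed.

(* The size bound on y and the running time share the constants c and e, so
   soundness is required for certificates of every length. *)
Theorem term_NP (t : term) (Lang : seq bool -> Prop) (E0 : nat) :
  (forall x y, ev (map sym_of_bit x ++ 3 :: map sym_of_bit y) [::] t != 0 -> Lang x) ->
  (forall x, Lang x -> exists2 y, size y <= (size x + 2) ^ E0 &
    ev (map sym_of_bit x ++ 3 :: map sym_of_bit y) [::] t != 0) ->
  in_NP Lang.
Proof.
move=> sound complete.
have [E ok] := term_ok_all t.
pose c := tc [::] 0 t.
(* Register 0 holds the value of the term; zero jumps to [IRej], anything else falls through to
   [IAcc]. *)
pose code := asm 0 c ++ [:: IJz 0 (csize c + 2); IAcc; IRej].
pose m := maxreg c.
have hregs pc : instr_reg (nth IRej code pc) < m.+1.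
  case: (ltnP pc (size code)) => h; last by rewrite nth_default.
  have : all (fun i => instr_reg i <= m) code by rewrite all_cat asm_regs.
  by move/(all_nthP IRej)/(_ _ h).
pose W x y := map sym_of_bit x ++ 3 :: map sym_of_bit y.
have W4 x y i : nth 0 (W x y) i < 4.
  have : all (fun a => a < 4) (W x y).
    by rewrite all_cat /= !all_map; apply/andP; split; apply/allP => -[].
  move/all_nthP => H; case: (ltnP i (size (W x y))) => h; first exact: H.
  by rewrite nth_default.
have run x y : exists2 T, T <= base (W x y) [::] ^ E + 1 &
    exists s, iter T (mstep (W x y) code) (0, fun=> 0) =
      (if ev (W x y) [::] t != 0 then csize c + 1 else csize c + 2, s).
  have [_ [t1 ht1 hx]] := ok (W x y) [::] 0 (fun=> 0) isT (fun _ _ => erefl).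
  have := asm_sound hx [::] [:: IJz 0 (csize c + 2); IAcc; IRej]; rewrite !cat0s add0n -/c -/code => hc.
  exists (t1.+1); first by rewrite addn1 ltnS.
  eexists; rewrite iterS hc /= nth_cat size_asm ltnn subnn /= {1}/upd eqxx.
  by case: eqP => _ //=; rewrite addn1.
pose M := ctm m code.
have simx x y : exists2 T, T <= (base (W x y) [::] ^ E + 1) * (2 * (base (W x y) [::] ^ E + 1) + 4) + 2 &
    forall f, (forall i, f i = nth 0 (W x y) i) ->
    (iter T (astep M) (0, f, 0)).1.1 = (if ev (W x y) [::] t != 0 then 1 else 2).
  have [T hT [s hs]] := run x y.
  have [|T' hT' hf] := sim_run (W4 x y) hregs (b := ev (W x y) [::] t != 0) hs.
    rewrite /code; case: ifP => _; rewrite nth_cat size_asm ifF; try lia.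
      by rewrite addKn.
    by rewrite addKn.
  by exists T' => //; apply: leq_trans hT' _; rewrite leq_add2r leq_mul // leq_add2r leq_mul2l.
(* A bound on [base] when the certificate has length at most [(n + 2) ^ E0]; the 3 is the separator
   and the 2 in [base]. *)
pose bx n := n + (n + 2) ^ E0 + 3.
pose tx n := (bx n ^ E + 1) * (2 * (bx n ^ E + 1) + 4) + 2.
have [F HF] : exists F, forall n, (n + 2) ^ E0 + tx n <= (n + 2) ^ F.
  have p2 : polyb (fun b => (b + b ^ E0 + 3) ^ E).
    apply: polyb_exp; apply: polyb_add (polyb_const _).
    exact: polyb_add polyb_id (polyb_exp _ polyb_id).
  have [F HF] : polyb (fun b => b ^ E0 + (((b + b ^ E0 + 3) ^ E + 1) *
      (2 * ((b + b ^ E0 + 3) ^ E + 1) + 4) + 2)).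
    apply: polyb_add (polyb_exp _ polyb_id) _.
    apply: polyb_add (polyb_const _); apply: polyb_mul.
      exact: polyb_add p2 (polyb_const _).
    apply: polyb_add (polyb_const _); apply: polyb_mul (polyb_const _) _.
    exact: polyb_add p2 (polyb_const _).
  exists F => n; apply: leq_trans (HF (n + 2) _); last by lia.
  have hb : bx n ^ E <= (n + 2 + (n + 2) ^ E0 + 3) ^ E by apply: leq_expn2r; rewrite /bx; lia.
  rewrite leq_add2l /tx leq_add2r leq_mul //; first by rewrite leq_add2r.
  by rewrite leq_add2r leq_mul2l leq_add2r.
(* This brings the bound to the shape [c * n ^ e + c]: for positive n one has [n + 2 <= 3 * n], and
   n = 0 is covered by the additive constant. *)
pose C := 3 ^ F.
have hC n : (n + 2) ^ F <= C * n ^ F + C.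
  case: n => [|n]; first by rewrite add0n; apply: leq_trans (leq_addl _ _); apply: leq_expn2r.
  by apply: leq_trans (leq_addr _ _); rewrite -expnMn; apply: leq_expn2r; lia.
exists M, C, F; split; first exact: ctm_wf.
move=> x; split.
  move=> /complete [y hy hev]; exists y.
  have h1 : size y <= (size x + 2) ^ F by have := HF (size x); lia.
  split; first exact: leq_trans h1 (hC _).
  have [T hT hf] := simx x y.
  have hb : base (W x y) [::] <= bx (size x).
    by rewrite /base /bx /W size_cat /= !size_map; lia.
  have h12 : let q := if ev (W x y) [::] t != 0 then 1 else 2 in (q == 1) || (q == 2) by case: ifP.
  have [_] := accepts_within_halt (fun=> erefl) (hf (nth 0 (W x y)) (fun=> erefl)) h12.
  apply; first by rewrite hev.
  apply: leq_trans (hC _); apply: leq_trans (HF _); apply: leq_trans hT _.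
  have hb' : base (W x y) [::] ^ E <= bx (size x) ^ E by apply: leq_expn2r.
  apply: leq_trans (leq_addl _ _); rewrite /tx leq_add2r leq_mul //; first by rewrite leq_add2r.
  by rewrite leq_add2r leq_mul2l leq_add2r.
(* The length of y is dropped: its run halts at some time, and acceptance at the given time forces
   that verdict. *)
case=> y [_ hacc]; apply: (sound x y).
have [T hT hf] := simx x y.
have h12 : let q := if ev (W x y) [::] t != 0 then 1 else 2 in (q == 1) || (q == 2) by case: ifP.
have [H _] := accepts_within_halt (fun=> erefl) (hf (nth 0 (W x y)) (fun=> erefl)) h12.
by have := H _ hacc; case: ifP => // /negbT.
Qed.

(** * Reification of functions into terms *)

Section EvLemmas.
Variables (W : seq nat).

(** In use the terms are existential variables and the right-hand side is given, so applying such a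
    lemma constructs the term. Truth values are the numbers 0 and 1. *)
Lemma ev_add e t1 t2 a b : ev W e t1 = a -> ev W e t2 = b -> ev W e (TAdd t1 t2) = a + b.
Proof. by move=> /= -> ->. Qed.
Lemma ev_sub e t1 t2 a b : ev W e t1 = a -> ev W e t2 = b -> ev W e (TSub t1 t2) = a - b.
Proof. by move=> /= -> ->. Qed.
Lemma ev_mul e t1 t2 a b : ev W e t1 = a -> ev W e t2 = b -> ev W e (TMul t1 t2) = a * b.
Proof. by move=> /= -> ->. Qed.
Lemma ev_succ e t a : ev W e t = a -> ev W e (TAdd (TK 1) t) = a.+1.
Proof. by move=> /= ->. Qed.
Lemma ev_pred e t a : ev W e t = a -> ev W e (TSub t (TK 1)) = a.-1.
Proof. by move=> /= ->; rewrite subn1. Qed.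

Lemma ev_leq e t1 t2 a b : ev W e t1 = a -> ev W e t2 = b ->
  ev W e (TSub (TK 1) (TSub t1 t2)) = (a <= b : bool).
Proof. by move=> /= -> ->; rewrite /leq; case: (a - b). Qed.
Lemma ev_negb e t (a : bool) : ev W e t = a -> ev W e (TSub (TK 1) t) = ~~ a.
Proof. by move=> /= ->; case: a. Qed.
Lemma ev_andb e t1 t2 (a b : bool) : ev W e t1 = a -> ev W e t2 = b ->
  ev W e (TMul t1 t2) = a && b.
Proof. by move=> /= -> ->; case: a; case: b. Qed.
Lemma ev_orb e t1 t2 (a b : bool) : ev W e t1 = a -> ev W e t2 = b ->
  ev W e (TSub (TK 1) (TMul (TSub (TK 1) t1) (TSub (TK 1) t2))) = a || b.
Proof. by move=> /= -> ->; case: a; case: b. Qed.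
Lemma ev_implb e t1 t2 (a b : bool) : ev W e t1 = a -> ev W e t2 = b ->
  ev W e (TSub (TK 1) (TMul t1 (TSub (TK 1) t2))) = (a ==> b).
Proof. by move=> /= -> ->; case: a; case: b. Qed.
Lemma ev_eqn e t1 t2 (a b : nat) : ev W e t1 = a -> ev W e t2 = b ->
  ev W e (TMul (TSub (TK 1) (TSub t1 t2)) (TSub (TK 1) (TSub t2 t1))) = (a == b).
Proof. by move=> h1 h2; rewrite eqn_leq; apply: ev_andb; apply: ev_leq. Qed.
Lemma ev_if e t t1 t2 (c : bool) a b : ev W e t = c -> ev W e t1 = a -> ev W e t2 = b ->
  ev W e (TAdd (TMul t t1) (TMul (TSub (TK 1) t) t2)) = if c then a else b.
Proof. by move=> /= -> -> ->; case: c; rewrite /= ?mul1n ?mul0n ?addn0. Qed.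
Lemma ev_ifb e t t1 t2 (c a b : bool) : ev W e t = c -> ev W e t1 = a -> ev W e t2 = b ->
  ev W e (TAdd (TMul t t1) (TMul (TSub (TK 1) t) t2)) = (if c then a else b : bool).
Proof. by move=> h h1 h2; rewrite (ev_if h h1 h2); case: c {h}. Qed.

Lemma ev_rec e tn tb ts n b (f : nat -> nat -> nat) :
  ev W e tn = n -> ev W e tb = b -> (forall i acc, ev W [:: i, acc & e] ts = f i acc) ->
  ev W e (TRec tn tb ts) = iteri n (fun i acc => minn b (f i acc)) 0.
Proof. by move=> /= -> -> h; elim: n => //= n ->; rewrite h. Qed.

(** A bounded existential is a sum clipped at 1. *)
Lemma ev_has e tn tp n (P : nat -> bool) :
  ev W e tn = n -> (forall i acc, ev W [:: i, acc & e] tp = P i) ->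
  ev W e (TRec tn (TK 1) (TAdd (TV 1) tp)) = has P (iota 0 n).
Proof.
move=> /= -> h; elim: n => // n IH.
rewrite iteriS IH h -[n.+1]addn1 iotaD has_cat /= add0n orbF.
by case: (has _ _); case: (P n).
Qed.

Lemma ev_all e tn tp n (P : nat -> bool) :
  ev W e tn = n -> (forall i acc, ev W [:: i, acc & e] tp = P i) ->
  ev W e (TSub (TK 1) (TRec tn (TK 1) (TAdd (TV 1) (TSub (TK 1) tp)))) = all P (iota 0 n).
Proof.
move=> h1 h2; rewrite -[all _ _]negbK -has_predC; apply: ev_negb.
by apply: ev_has => // i acc; apply: ev_negb.
Qed.
End EvLemmas.

Section Rep.
Variables (T : Type) (c : T -> nat).
Implicit Type W : seq nat.
(** Representability is a class so that a call of an already compiled function is resolved by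
    instance search. Nested [TLet] pushes the arguments one by one, hence the last argument comes
    first in the environment. *)
Class rep0 (f : seq nat -> T) := Rep0 { t0 : term; _ : forall W, ev W [::] t0 = c (f W) }.
Class rep1 (f : seq nat -> nat -> T) := Rep1 { t1 : term;
  _ : forall W a, ev W [:: a] t1 = c (f W a) }.
Class rep2 (f : seq nat -> nat -> nat -> T) := Rep2 { t2 : term;
  _ : forall W a b, ev W [:: b; a] t2 = c (f W a b) }.
Class rep3 (f : seq nat -> nat -> nat -> nat -> T) := Rep3 { t3 : term;
  _ : forall W a b d, ev W [:: d; b; a] t3 = c (f W a b d) }.
Class rep4 (f : seq nat -> nat -> nat -> nat -> nat -> T) := Rep4 { t4 : term;
  _ : forall W a b d g, ev W [:: g; d; b; a] t4 = c (f W a b d g) }.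

Lemma ev_call0 f (H : rep0 f) W e : ev W e (TTake 0 t0) = c (f W).
Proof. by case: H => t h /=; rewrite take0 h. Qed.
Lemma ev_call1 f (H : rep1 f) W e u1 a : ev W e u1 = a ->
  ev W e (TLet u1 (TTake 1 t1)) = c (f W a).
Proof. by case: H => t h /= ->; rewrite take0 h. Qed.
Lemma ev_call2 f (H : rep2 f) W e u1 u2 a b : ev W e u1 = a -> ev W (a :: e) u2 = b ->
  ev W e (TLet u1 (TLet u2 (TTake 2 t2))) = c (f W a b).
Proof. by case: H => t h /= -> ->; rewrite take0 h. Qed.
Lemma ev_call3 f (H : rep3 f) W e u1 u2 u3 a b d : ev W e u1 = a -> ev W (a :: e) u2 = b ->
  ev W [:: b, a & e] u3 = d ->
  ev W e (TLet u1 (TLet u2 (TLet u3 (TTake 3 t3)))) = c (f W a b d).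
Proof. by case: H => t h /= -> -> ->; rewrite take0 h. Qed.
Lemma ev_call4 f (H : rep4 f) W e u1 u2 u3 u4 a b d g : ev W e u1 = a -> ev W (a :: e) u2 = b ->
  ev W [:: b, a & e] u3 = d -> ev W [:: d, b, a & e] u4 = g ->
  ev W e (TLet u1 (TLet u2 (TLet u3 (TLet u4 (TTake 4 t4))))) = c (f W a b d g).
Proof. by case: H => t h /= -> -> -> ->; rewrite take0 h. Qed.
End Rep.

Notation repn0 := (rep0 id). Notation repb0 := (rep0 nat_of_bool).
Notation repn1 := (rep1 id). Notation repb1 := (rep1 nat_of_bool).
Notation repn2 := (rep2 id). Notation repb2 := (rep2 nat_of_bool).
Notation repn3 := (rep3 id). Notation repb3 := (rep3 nat_of_bool).
Notation repn4 := (rep4 id). Notation repb4 := (rep4 nat_of_bool).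

(** The call lemmas at [id] and at [nat_of_bool], in the forms that a syntactic match on the
    right-hand side can select. *)
Lemma ev_calln0 f (H : repn0 f) W e :
  ev W e (TTake 0 (t0 (f := f))) = f W .
Proof. exact: ev_call0. Qed.

Lemma ev_calln1 f (H : repn1 f) W e u1 a : ev W e u1 = a ->
  ev W e (TLet u1 (TTake 1 (t1 (f := f)))) = f W a.
Proof. exact: ev_call1. Qed.

Lemma ev_calln2 f (H : repn2 f) W e u1 u2 a b : ev W e u1 = a -> ev W (a :: e) u2 = b ->
  ev W e (TLet u1 (TLet u2 (TTake 2 (t2 (f := f))))) = f W a b.
Proof. exact: ev_call2. Qed.

Lemma ev_calln3 f (H : repn3 f) W e u1 u2 u3 a b d : ev W e u1 = a -> ev W (a :: e) u2 = b -> ev W (b :: a :: e) u3 = d ->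
  ev W e (TLet u1 (TLet u2 (TLet u3 (TTake 3 (t3 (f := f)))))) = f W a b d.
Proof. exact: ev_call3. Qed.

Lemma ev_calln4 f (H : repn4 f) W e u1 u2 u3 u4 a b d g : ev W e u1 = a -> ev W (a :: e) u2 = b -> ev W (b :: a :: e) u3 = d -> ev W (d :: b :: a :: e) u4 = g ->
  ev W e (TLet u1 (TLet u2 (TLet u3 (TLet u4 (TTake 4 (t4 (f := f))))))) = f W a b d g.
Proof. exact: ev_call4. Qed.

Lemma ev_callb0 f (H : repb0 f) W e :
  ev W e (TTake 0 (t0 (f := f))) = f W .
Proof. exact: ev_call0. Qed.

Lemma ev_callb1 f (H : repb1 f) W e u1 a : ev W e u1 = a ->
  ev W e (TLet u1 (TTake 1 (t1 (f := f)))) = f W a.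
Proof. exact: ev_call1. Qed.

Lemma ev_callb2 f (H : repb2 f) W e u1 u2 a b : ev W e u1 = a -> ev W (a :: e) u2 = b ->
  ev W e (TLet u1 (TLet u2 (TTake 2 (t2 (f := f))))) = f W a b.
Proof. exact: ev_call2. Qed.

Lemma ev_callb3 f (H : repb3 f) W e u1 u2 u3 a b d : ev W e u1 = a -> ev W (a :: e) u2 = b -> ev W (b :: a :: e) u3 = d ->
  ev W e (TLet u1 (TLet u2 (TLet u3 (TTake 3 (t3 (f := f)))))) = f W a b d.
Proof. exact: ev_call3. Qed.

Lemma ev_callb4 f (H : repb4 f) W e u1 u2 u3 u4 a b d g : ev W e u1 = a -> ev W (a :: e) u2 = b -> ev W (b :: a :: e) u3 = d -> ev W (d :: b :: a :: e) u4 = g ->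
  ev W e (TLet u1 (TLet u2 (TLet u3 (TLet u4 (TTake 4 (t4 (f := f))))))) = f W a b d g.
Proof. exact: ev_call4. Qed.

Definition sym (W : seq nat) (a p : nat) : bool := nth 0 W p == a.
Definition tlen (W : seq nat) : nat := find (pred1 0) W.

Lemma ev_sym W e a t p : ev W e t = p -> ev W e (TIs a t) = sym W a p.
Proof. by move=> /= ->. Qed.
Lemma ev_tlen W e : ev W e TLen = tlen W.
Proof. by []. Qed.

Ltac isnum n := lazymatch n with O => idtac | S ?m => isnum m end.
Ltac idx x e := lazymatch e with
  | x :: _ => constr:(O)
  | _ :: ?e' => let k := idx x e' in constr:(S k) end.

(** A variable that is not in the environment, such as the bound k, is a constant of the term and
    becomes [TK]. *)
Ltac reify :=
  cbv beta;
  lazymatch goal with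
  | |- ev ?W ?e _ = ?r =>
    lazymatch r with
    | nat_of_bool (andb _ _) => apply: ev_andb; reify
    | nat_of_bool (orb _ _) => apply: ev_orb; reify
    | nat_of_bool (negb _) => apply: ev_negb; reify
    | nat_of_bool (implb _ _) => apply: ev_implb; reify
    | nat_of_bool (leq _ _) => apply: ev_leq; reify
    | nat_of_bool (eq_op _ _) => apply: ev_eqn; reify
    | nat_of_bool (if _ then _ else _) => apply: ev_ifb; reify
    | nat_of_bool (has _ (iota 0 _)) => apply: ev_has; [reify | intros; reify]
    | nat_of_bool (all _ (iota 0 _)) => apply: ev_all; [reify | intros; reify]
    | nat_of_bool (sym _ _ _) => apply: ev_sym; reify
    | tlen _ => apply: ev_tlen
    | addn _ _ => apply: ev_add; reify
    | subn _ _ => apply: ev_sub; reify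
    | muln _ _ => apply: ev_mul; reify
    | predn _ => apply: ev_pred; reify
    | (if _ then _ else _) => apply: ev_if; reify
    | iteri _ _ 0 => apply: ev_rec; [reify | reify | intros; reify]
    | nat_of_bool (?f W ?a1 ?a2 ?a3 ?a4) => refine (ev_callb4 (f := f) _ _ _ _ _); reify
    | nat_of_bool (?f W ?a1 ?a2 ?a3) => refine (ev_callb3 (f := f) _ _ _ _); reify
    | nat_of_bool (?f W ?a1 ?a2) => refine (ev_callb2 (f := f) _ _ _); reify
    | nat_of_bool (?f W ?a1) => refine (ev_callb1 (f := f) _ _); reify
    | nat_of_bool (?f W) => refine (ev_callb0 (f := f) _ _ _)
    | ?f W ?a1 ?a2 ?a3 ?a4 => refine (ev_calln4 (f := f) _ _ _ _ _); reify
    | ?f W ?a1 ?a2 ?a3 => refine (ev_calln3 (f := f) _ _ _ _); reify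
    | ?f W ?a1 ?a2 => refine (ev_calln2 (f := f) _ _ _); reify
    | ?f W ?a1 => refine (ev_calln1 (f := f) _ _); reify
    | ?f W => refine (ev_calln0 (f := f) _ _ _)
    | _ => first
       [ isnum r; exact (erefl : ev W e (TK r) = r)
       | lazymatch r with S _ => apply: ev_succ; reify end
       | is_var r; first [ let k := idx r e in exact (erefl : ev W e (TV k) = r)
                         | exact (erefl : ev W e (TK r) = r) ] ]
    end
  end.

(** A search is a loop of [tlen] rounds in which nothing changes once the search has stopped. The
    clip is never active, since the count grows by at most one per round. *)
Definition run W p := iteri (tlen W)
  (fun _ acc => minn (tlen W) (if sym W 2 (p + acc) then acc.+1 else acc)) 0.
#[global] Instance rep_run : repn1 run.
Proof. eexists; intros; unfold run; reify. Qed.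

Definition lenx W := iteri (tlen W)
  (fun _ acc => minn (tlen W) (if sym W 3 acc then acc else acc.+1)) 0.
#[global] Instance rep_lenx : repn0 lenx.
Proof. eexists; intros; unfold lenx; reify. Qed.

(** The offset of entry i in the certificate; an entry is a run of ones closed by a zero, hence the
    [+ 1]. *)
Definition zstart W i := iteri i
  (fun _ acc => minn (tlen W) (acc + run W ((lenx W).+1 + acc) + 1)) 0.
#[global] Instance rep_zstart : repn1 zstart.
Proof. eexists; intros; unfold zstart; reify. Qed.

(** * The verifier *)

Definition zz W i := run W ((lenx W).+1 + zstart W i).
#[global] Instance rep_zz : repn1 zz.
Proof. eexists; intros; unfold zz; reify. Qed.

(* The certificate is read as a four-dimensional array of naturals: time,
   field, block, cell. *)
Definition adim W := lenx W + 12.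
#[global] Instance rep_adim : repn0 adim.
Proof. eexists; intros; unfold adim; reify. Qed.

Definition z4 W t f j q := zz W (((t * adim W + f) * adim W + j) * adim W + q).
#[global] Instance rep_z4 : repn4 z4.
Proof. eexists; intros; unfold z4; reify. Qed.

(** Fields 0 to 6 describe the play at time t; fields 7 to 11 are read at time 0 only and hold the
    data of the level and of its parsing. *)
Definition nbl W t := z4 W t 0 0 0.
#[global] Instance rep_nbl : repn1 nbl.
Proof. eexists; intros; unfold nbl; reify. Qed.
(* 0 for a gray block, otherwise the position in x of a code of the colour. *)
Definition knd W t j := z4 W t 1 j 0.
#[global] Instance rep_knd : repn2 knd.
Proof. eexists; intros; unfold knd; reify. Qed.
Definition len W t j := z4 W t 2 j 0.
#[global] Instance rep_len : repn2 len.
Proof. eexists; intros; unfold len; reify. Qed.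
Definition cx W t j q := z4 W t 3 j q.
#[global] Instance rep_cx : repn3 cx.
Proof. eexists; intros; unfold cx; reify. Qed.
Definition cy W t j q := z4 W t 4 j q.
#[global] Instance rep_cy : repn3 cy.
Proof. eexists; intros; unfold cy; reify. Qed.
Definition phs W t := z4 W t 5 0 0.
#[global] Instance rep_phs : repn1 phs.
Proof. eexists; intros; unfold phs; reify. Qed.
Definition rk W t j := z4 W t 6 j 0.
#[global] Instance rep_rk : repn2 rk.
Proof. eexists; intros; unfold rk; reify. Qed.
Definition zw W := z4 W 0 7 0 0.
#[global] Instance rep_zw : repn0 zw.
Proof. eexists; intros; unfold zw; reify. Qed.
Definition zh W := z4 W 0 7 1 0.
#[global] Instance rep_zh : repn0 zh.
Proof. eexists; intros; unfold zh; reify. Qed.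
Definition znw W := z4 W 0 7 2 0.
#[global] Instance rep_znw : repn0 znw.
Proof. eexists; intros; unfold znw; reify. Qed.
Definition ztime W := z4 W 0 7 3 0.
#[global] Instance rep_ztime : repn0 ztime.
Proof. eexists; intros; unfold ztime; reify. Qed.
Definition wx W q := z4 W 0 8 0 q.
#[global] Instance rep_wx : repn1 wx.
Proof. eexists; intros; unfold wx; reify. Qed.
Definition wy W q := z4 W 0 8 1 q.
#[global] Instance rep_wy : repn1 wy.
Proof. eexists; intros; unfold wy; reify. Qed.
(** [pw], [pb] and [pc] are the claimed positions of walls, blocks and cells of blocks in the input.
    With all of them guessed, parsing is a local check between consecutive positions. *)
Definition pw W q := z4 W 0 8 2 q.
#[global] Instance rep_pw : repn1 pw.
Proof. eexists; intros; unfold pw; reify. Qed.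
Definition pb W j := z4 W 0 9 j 0.
#[global] Instance rep_pb : repn1 pb.
Proof. eexists; intros; unfold pb; reify. Qed.
Definition pc W j q := z4 W 0 10 j q.
#[global] Instance rep_pc : repn2 pc.
Proof. eexists; intros; unfold pc; reify. Qed.
Definition crk W j q := z4 W 0 11 j q.
#[global] Instance rep_crk : repn2 crk.
Proof. eexists; intros; unfold crk; reify. Qed.

(** * Checks that the input is the code of the claimed level *)

Definition npairs W p := iteri (tlen W)
  (fun _ acc => minn (tlen W) (if sym W 2 (p + 2 * acc) then acc.+1 else acc)) 0.
#[global] Instance rep_npairs : repn1 npairs.
Proof. eexists; intros; unfold npairs; reify. Qed.

(** Codes list the least significant bit first, so Horner's rule runs backwards through the pairs.
    The clip is needed because a code may denote an exponentially large number. *)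
Definition horner W p m B := iteri m
  (fun i acc => minn B (2 * acc + sym W 2 (p + 2 * (m - i.+1) + 1))) 0.
#[global] Instance rep_horner : repn3 horner.
Proof. eexists; intros; unfold horner; reify. Qed.

(** The last conjunct asks the most significant bit to be 1: the input must equal [enc_level L]
    literally, and [bin] yields no leading zeros. *)
Definition codeat W p p' : bool :=
  [&& sym W 1 (p + 2 * npairs W p), sym W 1 (p + 2 * npairs W p + 1),
      p' == p + 2 * npairs W p + 2, p' <= lenx W &
      (npairs W p == 0) || sym W 2 (p + 2 * npairs W p - 1)].
#[global] Instance rep_codeat : repb2 codeat.
Proof. eexists; intros; unfold codeat; reify. Qed.

(** Clipping at [n.+1] still distinguishes n from every other value. *)
Definition natat W p n p' : bool := codeat W p p' && (horner W p (npairs W p) n.+1 == n).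
#[global] Instance rep_natat : repb3 natat.
Proof. eexists; intros; unfold natat; reify. Qed.

Definition cellat W p a b p' : bool :=
  has (fun p0 => natat W p a p0 && natat W p0 b p') (iota 0 (lenx W).+1).
#[global] Instance rep_cellat : repb4 cellat.
Proof. eexists; intros; unfold cellat; reify. Qed.

Definition samecol W p p' : bool := (npairs W p == npairs W p') &&
  all (fun i => nat_of_bool (sym W 2 (p + 2 * i + 1)) == sym W 2 (p' + 2 * i + 1))
      (iota 0 (npairs W p)).
#[global] Instance rep_samecol : repb2 samecol.
Proof. eexists; intros; unfold samecol; reify. Qed.

(** The name of a colour may point into another block, so blocks of one colour can share a name; it
    suffices that a canonical code with the same bits stands there. Names of colours are nonzero
    because 0 means gray. *)
Definition kindcode W j p' : bool :=
  [&& sym W 1 (pb W j), knd W 0 j == 0 & p' == (pb W j).+1] ||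
  [&& sym W 2 (pb W j), 0 < knd W 0 j, samecol W (knd W 0 j) (pb W j).+1,
      codeat W (pb W j).+1 p' & has (fun p => codeat W (knd W 0 j) p) (iota 0 (lenx W).+1)].
#[global] Instance rep_kindcode : repb2 kindcode.
Proof. eexists; intros; unfold kindcode; reify. Qed.

Definition blockat W j : bool :=
  has (fun p' => kindcode W j p' && natat W p' (len W 0 j) (pc W j 0)) (iota 0 (lenx W).+1) &&
  (all (fun q => cellat W (pc W j q) (cx W 0 j q) (cy W 0 j q) (pc W j q.+1)) (iota 0 (len W 0 j)) &&
   (pc W j (len W 0 j) == pb W j.+1)).
#[global] Instance rep_blockat : repb1 blockat.
Proof. eexists; intros; unfold blockat; reify. Qed.

Definition parseb W : bool :=
  [&& all (fun q => sym W 2 q) (iota 0 (zw W)), sym W 1 (zw W),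
      all (fun q => sym W 2 ((zw W).+1 + q)) (iota 0 (zh W)), sym W 1 ((zw W).+1 + zh W),
      natat W ((zw W).+1 + zh W).+1 (znw W) (pw W 0),
      all (fun q => cellat W (pw W q) (wx W q) (wy W q) (pw W q.+1)) (iota 0 (znw W)),
      natat W (pw W (znw W)) (nbl W 0) (pb W 0),
      all (fun j => blockat W j) (iota 0 (nbl W 0)) &
      pb W (nbl W 0) == lenx W].
#[global] Instance rep_parseb : repb0 parseb.
Proof. eexists; intros; unfold parseb; reify. Qed.

(** * Checks that the level is well formed *)

Definition incell W t j a b : bool :=
  has (fun q => (cx W t j q == a) && (cy W t j q == b)) (iota 0 (len W t j)).
#[global] Instance rep_incell : repb4 incell.
Proof. eexists; intros; unfold incell; reify. Qed.

Definition inwall W a b : bool :=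
  has (fun q => (wx W q == a) && (wy W q == b)) (iota 0 (znw W)).
#[global] Instance rep_inwall : repb2 inwall.
Proof. eexists; intros; unfold inwall; reify. Qed.

(* W is only present because representable functions take the tape first. *)
Definition adjb (W : seq nat) a b c d : bool :=
  ((a == c) && ((b == d.+1) || (d == b.+1))) || ((b == d) && ((a == c.+1) || (c == a.+1))).
#[global] Instance rep_adjb : repb4 adjb.
Proof. eexists; intros; unfold adjb; reify. Qed.

Definition boundb W : bool :=
  all (fun q => (wx W q < zw W) && (wy W q < zh W)) (iota 0 (znw W)) &&
  all (fun j => all (fun q => (cx W 0 j q < zw W) && (cy W 0 j q < zh W)) (iota 0 (len W 0 j)))
      (iota 0 (nbl W 0)).
#[global] Instance rep_boundb : repb0 boundb.
Proof. eexists; intros; unfold boundb; reify. Qed.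

Definition uniqb W : bool :=
  [&& all (fun q => all (fun q' => ~~ ((wx W q == wx W q') && (wy W q == wy W q'))) (iota 0 q))
       (iota 0 (znw W)),
      all (fun j => all (fun q => ~~ inwall W (cx W 0 j q) (cy W 0 j q)) (iota 0 (len W 0 j)))
       (iota 0 (nbl W 0)) &
      all (fun j => all (fun q => all (fun j' => all (fun q' =>
          ((cx W 0 j q == cx W 0 j' q') && (cy W 0 j q == cy W 0 j' q')) ==>
          ((j == j') && (q == q')))
        (iota 0 (len W 0 j'))) (iota 0 (nbl W 0))) (iota 0 (len W 0 j))) (iota 0 (nbl W 0))].
#[global] Instance rep_uniqb : repb0 uniqb.
Proof. eexists; intros; unfold uniqb; reify. Qed.

(** The ranks describe a spanning tree rooted at cell 0: every other cell has a neighbour of smaller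
    rank, and no path has to be stored. *)
Definition connb W : bool :=
  all (fun j => (0 < len W 0 j) && all (fun q => (q == 0) ||
      has (fun q' => (crk W j q' < crk W j q) &&
            adjb W (cx W 0 j q') (cy W 0 j q') (cx W 0 j q) (cy W 0 j q))
        (iota 0 (len W 0 j))) (iota 0 (len W 0 j)))
    (iota 0 (nbl W 0)).
#[global] Instance rep_connb : repb0 connb.
Proof. eexists; intros; unfold connb; reify. Qed.

(** * Checks for the single steps of a play *)

Definition touchany W t j a b : bool :=
  has (fun q => adjb W a b (cx W t j q) (cy W t j q)) (iota 0 (len W t j)).
#[global] Instance rep_touchany : repb4 touchany.
Proof. eexists; intros; unfold touchany; reify. Qed.

Definition touchb W t i j : bool :=
  [&& i < j, j < nbl W t, 0 < knd W t i, 0 < knd W t j, samecol W (knd W t i) (knd W t j) &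
      has (fun q => touchany W t j (cx W t i q) (cy W t i q)) (iota 0 (len W t i))].
#[global] Instance rep_touchb : repb3 touchb.
Proof. eexists; intros; unfold touchb; reify. Qed.

Definition stableb W t : bool :=
  all (fun i => all (fun j => ~~ touchb W t i j) (iota 0 (nbl W t))) (iota 0 (nbl W t)).
#[global] Instance rep_stableb : repb1 stableb.
Proof. eexists; intros; unfold stableb; reify. Qed.

Definition eqblk W t i u j : bool :=
  [&& knd W t i == knd W u j, len W t i == len W u j &
      all (fun q => (cx W t i q == cx W u j q) && (cy W t i q == cy W u j q)) (iota 0 (len W t i))].
#[global] Instance rep_eqblk : repb4 eqblk.
Proof. eexists; intros; unfold eqblk; reify. Qed.

Definition mergedblk W t i j : bool :=
  [&& knd W t.+1 i == knd W t i, len W t.+1 i == len W t i + len W t j,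
      all (fun q => (cx W t.+1 i q == cx W t i q) && (cy W t.+1 i q == cy W t i q))
        (iota 0 (len W t i)) &
      all (fun q => (cx W t.+1 i (len W t i + q) == cx W t j q) &&
                    (cy W t.+1 i (len W t i + q) == cy W t j q)) (iota 0 (len W t j))].
#[global] Instance rep_mergedblk : repb3 mergedblk.
Proof. eexists; intros; unfold mergedblk; reify. Qed.

(** The shift [l + (j <= l)] accounts for the deletion of block j from the list. *)
Definition mergeb W t : bool :=
  has (fun i => has (fun j => [&& touchb W t i j, nbl W t == (nbl W t.+1).+1 &
      all (fun l => if l == i then mergedblk W t i j
                    else eqblk W t (l + (j <= l)) t.+1 l) (iota 0 (nbl W t.+1))])
    (iota 0 (nbl W t))) (iota 0 (nbl W t)).
#[global] Instance rep_mergeb : repb1 mergeb.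
Proof. eexists; intros; unfold mergeb; reify. Qed.

(* r certifies that its support is the closure of B under E: a derivation of a
   member only uses members of smaller rank. *)
Definition closb (n : nat) (r : nat -> nat) (B : nat -> bool) (E : nat -> nat -> bool) : bool :=
  all (fun j => [&& B j ==> (0 < r j),
      all (fun i => ((0 < r i) && E i j) ==> (0 < r j)) (iota 0 n) &
      (0 < r j) ==> (B j || has (fun i => [&& 0 < r i, r i < r j & E i j]) (iota 0 n))])
    (iota 0 n).

Definition floorb W t j : bool :=
  has (fun q => (cy W t j q == 0) || inwall W (cx W t j q) (cy W t j q).-1) (iota 0 (len W t j)).
#[global] Instance rep_floorb : repb2 floorb.
Proof. eexists; intros; unfold floorb; reify. Qed.

Definition onb W t i j : bool :=
  has (fun q => (0 < cy W t j q) && incell W t i (cx W t j q) (cy W t j q).-1) (iota 0 (len W t j)).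
#[global] Instance rep_onb : repb3 onb.
Proof. eexists; intros; unfold onb; reify. Qed.

Definition suppb W t : bool :=
  closb (nbl W t) (fun j => rk W t j) (fun j => floorb W t j) (fun i j => onb W t i j).
#[global] Instance rep_suppb : repb1 suppb.
Proof. eexists; intros; unfold suppb, closb; reify. Qed.

Definition dropblk W t j : bool :=
  [&& knd W t.+1 j == knd W t j, len W t.+1 j == len W t j &
      all (fun q => (cx W t.+1 j q == cx W t j q) && (cy W t.+1 j q == (cy W t j q).-1))
        (iota 0 (len W t j))].
#[global] Instance rep_dropblk : repb2 dropblk.
Proof. eexists; intros; unfold dropblk; reify. Qed.

Definition fallb W t : bool :=
  [&& stableb W t, suppb W t, has (fun j => rk W t j == 0) (iota 0 (nbl W t)),
      nbl W t.+1 == nbl W t &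
      all (fun j => if rk W t j == 0 then dropblk W t j else eqblk W t j t.+1 j)
        (iota 0 (nbl W t))].
#[global] Instance rep_fallb : repb1 fallb.
Proof. eexists; intros; unfold fallb; reify. Qed.

(** The passage from settling to the player's turn is a step of its own, so the configuration is
    repeated at the next time. *)
Definition doneb W t : bool :=
  [&& stableb W t, suppb W t, all (fun j => 0 < rk W t j) (iota 0 (nbl W t)),
      nbl W t.+1 == nbl W t & all (fun j => eqblk W t j t.+1 j) (iota 0 (nbl W t))].
#[global] Instance rep_doneb : repb1 doneb.
Proof. eexists; intros; unfold doneb; reify. Qed.

(* Directions: 1 is right, any other number is left. *)
Definition shiftx (W : seq nat) d a := if d == 1 then a.+1 else a.-1.
#[global] Instance rep_shiftx : repn2 shiftx.
Proof. eexists; intros; unfold shiftx; reify. Qed.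

Definition dragb W d t i j : bool :=
  ~~ (i == j) && has (fun q =>
    (((0 < cx W t i q) || (d == 1)) && incell W t j (shiftx W d (cx W t i q)) (cy W t i q)) ||
    incell W t j (cx W t i q) (cy W t i q).+1) (iota 0 (len W t i)).
#[global] Instance rep_dragb : repb4 dragb.
Proof. eexists; intros; unfold dragb; reify. Qed.

Definition canb W d a b : bool :=
  [&& (0 < a) || (d == 1), shiftx W d a < zw W, b < zh W & ~~ inwall W (shiftx W d a) b].
#[global] Instance rep_canb : repb3 canb.
Proof. eexists; intros; unfold canb; reify. Qed.

Definition shiftblk W d t j : bool :=
  [&& knd W t.+1 j == knd W t j, len W t.+1 j == len W t j &
      all (fun q => [&& canb W d (cx W t j q) (cy W t j q),
           cx W t.+1 j q == shiftx W d (cx W t j q) & cy W t.+1 j q == cy W t j q])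
        (iota 0 (len W t j))].
#[global] Instance rep_shiftblk : repb3 shiftblk.
Proof. eexists; intros; unfold shiftblk; reify. Qed.

Definition movesb W d i0 t : bool :=
  [&& 0 < knd W t i0,
      closb (nbl W t) (fun j => rk W t j) (fun j => j == i0) (fun i j => dragb W d t i j),
      nbl W t.+1 == nbl W t &
      all (fun j => if 0 < rk W t j then shiftblk W d t j else eqblk W t j t.+1 j)
        (iota 0 (nbl W t))].
#[global] Instance rep_movesb : repb3 movesb.
Proof. eexists; intros; unfold movesb, closb; reify. Qed.

Definition moveb W t : bool :=
  has (fun i0 => movesb W 0 i0 t || movesb W 1 i0 t) (iota 0 (nbl W t)).
#[global] Instance rep_moveb : repb1 moveb.
Proof. eexists; intros; unfold moveb; reify. Qed.

(** Phase 0 means that the configuration is still settling; otherwise the player is to move. *)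
Definition stepb W t : bool :=
  if phs W t == 0 then
    ((phs W t.+1 == 0) && (mergeb W t || fallb W t)) || ((phs W t.+1 == 1) && doneb W t)
  else (phs W t.+1 == 0) && moveb W t.
#[global] Instance rep_stepb : repb1 stepb.
Proof. eexists; intros; unfold stepb; reify. Qed.

Definition solvedb W t : bool :=
  all (fun i => all (fun j =>
    [&& 0 < knd W t i, 0 < knd W t j & samecol W (knd W t i) (knd W t j)] ==> (i == j))
    (iota 0 (nbl W t))) (iota 0 (nbl W t)).
#[global] Instance rep_solvedb : repb1 solvedb.
Proof. eexists; intros; unfold solvedb; reify. Qed.

Definition verify k W : bool :=
  [&& parseb W, boundb W, uniqb W, connb W &
      [&& nbl W 0 <= k, phs W 0 == 0, phs W (ztime W) == 1, solvedb W (ztime W) &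
          all (fun t => stepb W t) (iota 0 (ztime W))]].

Lemma verify_term k : exists t, forall W, ev W [::] t = verify k W.
Proof. eexists; intros; unfold verify; reify. Qed.

(** * Words, arrays and codes on the tape *)

Section Walk.
Variables (L : nat) (P : nat -> bool).
Let walk n := iteri n (fun _ acc => minn L (if P acc then acc.+1 else acc)) 0.

Lemma walk_all n i : i < walk n -> P i.
Proof.
elim: n => //= n; rewrite -/(walk n); case: ifP => h IH hi; last by apply: IH; lia.
by case: (ltngtP i (walk n)) => [|h2|->] //; lia.
Qed.

(** The stopping index m lies below the clip and within the number of rounds, so the loop reaches it
    and stays there. *)
Lemma walk_stop n m : m <= L -> m <= n -> (forall i, i < m -> P i) -> ~~ P m -> walk n = m.
Proof.
move=> hL hn hP hm.
have H j : walk j = minn j m.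
  elim: j => [|j IH] /=; first by rewrite min0n.
  rewrite -/(walk j) IH; case: (ltnP j m) => h.
    by rewrite hP; lia.
  by rewrite (negbTE hm); lia.
by rewrite H; lia.
Qed.
End Walk.

Definition word (x y : seq bool) := map sym_of_bit x ++ 3 :: map sym_of_bit y.

Lemma size_word x y : size (word x y) = size x + (size y).+1.
Proof. by rewrite size_cat /= !size_map. Qed.

Lemma nth_word x y i : nth 0 (word x y) i =
  if i < size x then sym_of_bit (nth false x i) else
  if i == size x then 3 else if i - (size x).+1 < size y then sym_of_bit (nth false y (i - (size x).+1))
  else 0.
Proof.
rewrite nth_cat size_map; case: ltnP => h; first by rewrite (nth_map false).
case: eqP => [->|ne]; first by rewrite subnn.
have -> : i - size x = (i - (size x).+1).+1 by lia.
rewrite /=; case: ltnP => h2; first by rewrite (nth_map false).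
by rewrite nth_default // size_map.
Qed.

Lemma tlen_word x y : tlen (word x y) = size (word x y).
Proof.
rewrite /tlen; apply/eqP; rewrite eqn_leq find_size leqNgt -has_find.
apply/hasPn => a; rewrite mem_cat inE /= => /or3P [/mapP [b _ ->]|/eqP ->|/mapP [b _ ->]] //;
by case: b.
Qed.

Lemma lenx_word x y : lenx (word x y) = size x.
Proof.
have E acc : (if sym (word x y) 3 acc then acc else acc.+1)
    = (if ~~ sym (word x y) 3 acc then acc.+1 else acc) :> nat by case: ifP.
rewrite /lenx (_ : (fun _ acc : nat => _) = (fun _ acc => minn (tlen (word x y))
   (if ~~ sym (word x y) 3 acc then acc.+1 else acc))); last first.
  by apply: functional_extensionality => i; apply: functional_extensionality => acc; rewrite E.
apply: (@walk_stop _ (fun acc => ~~ sym (word x y) 3 acc)).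
- by rewrite tlen_word size_word leq_addr.
- by rewrite tlen_word size_word leq_addr.
- by move=> i hi; rewrite /sym nth_word hi; case: (nth _ _ _).
- by rewrite negbK /sym nth_word ltnn eqxx.
Qed.

Lemma sym2_word x y i : i < size x -> sym (word x y) 2 i = nth false x i.
Proof. by move=> h; rewrite /sym nth_word h; case: (nth _ _ _). Qed.

Lemma sym1_word x y i : i < size x -> sym (word x y) 1 i = ~~ nth false x i.
Proof. by move=> h; rewrite /sym nth_word h; case: (nth _ _ _). Qed.

Lemma sym3_word x y a : a < 3 -> sym (word x y) a (size x) = false.
Proof. by rewrite /sym nth_word ltnn eqxx; case: a => [|[|[|]]]. Qed.

Lemma run_word x y p n : p + n < size (word x y) ->
  (forall i, i < n -> sym (word x y) 2 (p + i)) -> ~~ sym (word x y) 2 (p + n) ->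
  run (word x y) p = n.
Proof.
move=> h h1 h2; rewrite /run; apply: (@walk_stop _ (fun acc => sym (word x y) 2 (p + acc))) => //;
by rewrite tlen_word; lia.
Qed.

Definition enc_array (z : seq nat) : seq bool := flatten [seq nseq n true ++ [:: false] | n <- z].

Lemma size_enc_array z : size (enc_array z) = sumn [seq n.+1 | n <- z].
Proof.
by elim: z => //= n z IH; rewrite !size_cat size_nseq /= -IH addn1.
Qed.

Lemma run_array x z i : i < size z ->
  run (word x (enc_array z)) ((size x).+1 + sumn [seq n.+1 | n <- take i z]) = nth 0 z i.
Proof.
move=> hi; set a := sumn _; set n := nth 0 z i.
have ez : z = take i z ++ n :: drop i.+1 z by rewrite -drop_nth // cat_take_drop.
have ey : enc_array z = enc_array (take i z) ++ nseq n true ++ false :: enc_array (drop i.+1 z).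
  by rewrite [in LHS]ez /enc_array map_cat flatten_cat /= -catA.
have sa : size (enc_array (take i z)) = a by rewrite size_enc_array.
have sy : size (enc_array z) = a + (n + (size (enc_array (drop i.+1 z))).+1).
  by rewrite ey !size_cat size_nseq sa.
have yn j : j <= n -> nth false (enc_array z) (a + j) = (j < n).
  move=> hj; rewrite ey nth_cat sa ifF; last by lia.
  rewrite addKn nth_cat size_nseq nth_nseq; case: ltnP => // h.
  by have -> : j - n = 0 by lia.
have sn j : j <= n -> sym (word x (enc_array z)) 2 ((size x).+1 + a + j) = (j < n).
  move=> hj; rewrite /sym nth_word ifF; last by lia.
  rewrite ifF; last by lia.
  have -> : (size x).+1 + a + j - (size x).+1 = a + j by lia.
  rewrite ifT; last by lia.
  by rewrite yn //; case: (j < n).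
apply: run_word.
- by rewrite size_word; lia.
- by move=> j hj; rewrite sn // ltnW.
- by rewrite sn // ltnn.
Qed.

Lemma zz_array x z i : i < size z -> zz (word x (enc_array z)) i = nth 0 z i.
Proof.
move=> hi.
have H j : j <= size z -> zstart (word x (enc_array z)) j = sumn [seq n.+1 | n <- take j z].
  elim: j => [|j IH] hj; first by rewrite take0.
  rewrite /zstart iteriS -/(zstart _ j) IH ?(ltnW hj) // lenx_word run_array //.
  rewrite (take_nth 0) // map_rcons sumn_rcons.
  have : sumn [seq n.+1 | n <- take j.+1 z] <= size (enc_array z).
    by rewrite size_enc_array map_take sumn_take.
  rewrite (take_nth 0) // map_rcons sumn_rcons tlen_word size_word; lia.
by rewrite /zz H ?(ltnW hi) // lenx_word run_array.
Qed.

(** Any table can be stored in mixed radix; cutting its entries at V bounds the length of the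
    certificate while keeping every entry that is at most V. In unary an entry costs at most [V.+1]
    bits. *)
Lemma array_word x (G : nat -> nat -> nat -> nat -> nat) T V :
  exists2 y, size y <= T * (size x + 12) ^ 3 * V.+1 &
    forall t f j q, t < T -> f < size x + 12 -> j < size x + 12 -> q < size x + 12 ->
      G t f j q <= V -> z4 (word x y) t f j q = G t f j q.
Proof.
set A := size x + 12.
pose g i := minn V (G (i %/ A %/ A %/ A) (i %/ A %/ A %% A) (i %/ A %% A) (i %% A)).
exists (enc_array (mkseq g (T * A ^ 3))).
  rewrite size_enc_array -map_comp; set s := iota _ _.
  have : forall s, sumn [seq (g i).+1 | i <- s] <= size s * V.+1.
    by elim=> //= i s' IH; rewrite mulSn leq_add // ltnS geq_minl.
  by move/(_ s); rewrite size_iota.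
move=> t f j q ht hf hj hq hV.
have hA : 0 < A by rewrite /A addnS.
have hlt : ((t * A + f) * A + j) * A + q < T * A ^ 3.
  have -> : A ^ 3 = A * A * A by rewrite !expnS expn0 muln1 mulnA.
  have h1 : t * A + f < T * A.
    by apply: (@leq_trans (t.+1 * A)); [rewrite mulSn addnC ltn_add2r|rewrite leq_mul2r ht orbT].
  have h2 : (t * A + f) * A + j < T * A * A.
    by apply: (@leq_trans ((t * A + f).+1 * A)); [rewrite mulSn addnC ltn_add2r|rewrite leq_mul2r h1 orbT].
  rewrite !mulnA; apply: (@leq_trans (((t * A + f) * A + j).+1 * A)).
    by rewrite mulSn addnC ltn_add2r.
  by rewrite leq_mul2r h2 orbT.
rewrite /z4 /adim lenx_word -/A zz_array ?size_mkseq // nth_mkseq // /g.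
have dv u v : v < A -> (u * A + v) %/ A = u by move=> h; rewrite divnMDl // divn_small // addn0.
have md u v : v < A -> (u * A + v) %% A = v by move=> h; rewrite modnMDl modn_small.
rewrite !dv // !md //.
exact/minn_idPr.
Qed.

(** * Binary codes *)

Definition valb (bs : seq bool) : nat := foldr (fun (b : bool) v => b + 2 * v) 0 bs.

Lemma bin_rec n : 0 < n -> bin n = odd n :: bin n./2.
Proof.
have H f : forall m f', m <= f -> m <= f' -> bin_fuel f m = bin_fuel f' m.
  elim: f => [|f IH] [|m] [|f'] //= h1 h2; congr cons.
  by apply: IH; rewrite leq_uphalf_double -addnn; lia.
case: n => // n _; rewrite /bin /=; congr cons; apply: H => //.
by rewrite leq_uphalf_double -addnn; lia.
Qed.

Lemma valb_bin n : valb (bin n) = n.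
Proof.
elim/ltn_ind: n => -[|n] IH //; rewrite bin_rec //= IH /=.
  by rewrite -[RHS]odd_double_half /= mul2n.
by rewrite uphalf_half; lia.
Qed.

Lemma last_bin b n : last b (bin n) = if n == 0 then b else true.
Proof.
elim/ltn_ind: n b => -[|n] IH b //; rewrite bin_rec //=.
rewrite IH; last by rewrite uphalf_half; lia.
by case: eqP => // h; have -> : n = 0 by move: h; rewrite uphalf_half; lia.
Qed.

(** The default [true] admits the empty string, the code of 0; otherwise the top bit must be 1. *)
Lemma bin_valb bs : last true bs -> bin (valb bs) = bs.
Proof.
elim: bs => //= b bs IH h.
have hv : last b bs = true -> b + 2 * valb bs > 0.
  elim: bs {IH h} b => [|c bs IH] b /=; first by move=> ->.
  by move=> /IH; lia.
rewrite bin_rec; last by rewrite hv.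
have -> : odd (b + 2 * valb bs) = b by rewrite oddD oddM /= addbF oddb.
have -> : (b + 2 * valb bs)./2 = valb bs by rewrite mul2n half_bit_double.
by rewrite IH //; case: (bs) h => //.
Qed.

Definition bits W p m : seq bool := mkseq (fun i => sym W 2 (p + 2 * i + 1)) m.

(** Clipping early does no harm: v and its clipped value give the same result after doubling, adding
    a bit and clipping again. *)
Lemma horner_bits W p m B : horner W p m B = minn B (valb (bits W p m)).
Proof.
rewrite /horner.
have H j : j <= m -> iteri j (fun i acc => minn B (2 * acc + sym W 2 (p + 2 * (m - i.+1) + 1))) 0
   = minn B (valb (drop (m - j) (bits W p m))).
  elim: j => [|j IH] hj.
    by rewrite subn0 drop_oversize ?size_mkseq //= minn0.
  have -> : drop (m - j.+1) (bits W p m) = nth false (bits W p m) (m - j.+1) :: drop (m - j) (bits W p m).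
    by rewrite (drop_nth false) ?size_mkseq; [congr (_ :: drop _ _)|]; lia.
  rewrite iteriS IH /=; last by lia.
  rewrite nth_mkseq; last by lia.
  case: (sym _ _ _) => /=; lia.
by rewrite H // subnn drop0.
Qed.

Lemma size_enc_nat n : size (enc_nat n) = 2 * size (bin n) + 2.
Proof.
rewrite /enc_nat size_cat /=; congr addn.
by elim: (bin n) => //= b s ->; lia.
Qed.

(** The layout of [enc_nat] for an arbitrary bit string, as it is read off the tape. *)
Definition enc_bits bs := flatten [seq [:: true; b] | b <- bs] ++ [:: false; false].

Lemma nth_enc_bits bs i : i < size bs ->
  nth false (enc_bits bs) (2 * i) = true /\ nth false (enc_bits bs) (2 * i + 1) = nth false bs i.
Proof.
elim: bs i => // b bs IH [|i] hi //.
have -> : 2 * i.+1 = (2 * i).+2 by lia.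
have [h1 h2] := IH i hi; split; first exact: h1.
by rewrite addSn addSn; exact: h2.
Qed.

Lemma nth_enc_end bs : nth false (enc_bits bs) (2 * size bs) = false /\
  nth false (enc_bits bs) (2 * size bs + 1) = false.
Proof.
elim: bs => // b bs [h1 h2].
have -> : 2 * (size (b :: bs)) = (2 * size bs).+2 by rewrite /=; lia.
split; first exact: h1.
by rewrite addSn addSn; exact: h2.
Qed.

Lemma size_enc_bits bs : size (enc_bits bs) = 2 * size bs + 2.
Proof. by rewrite size_cat /=; congr addn; elim: bs => //= b s ->; lia. Qed.

(** The conclusion speaks of prefixes of x, so that the parsing of consecutive tokens composes by
    concatenation. *)
Lemma codeat_sound x y p p' : let W := word x y in codeat W p p' ->
  [/\ p <= p' <= size x, bin (valb (bits W p (npairs W p))) = bits W p (npairs W p) &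
    take p' x = take p x ++ enc_nat (valb (bits W p (npairs W p)))].
Proof.
move=> W; rewrite /codeat; set m := npairs W p => /and5P [s1 s2 /eqP -> hp' hl].
move: hp'; rewrite lenx_word => hp'.
have hbin : bin (valb (bits W p m)) = bits W p m.
  apply: bin_valb; rewrite -(nth_last true) size_mkseq.
  case/orP: hl => [/eqP ->|hl]; first by [].
  case: (posnP m) => h0; first by rewrite h0.
  rewrite nth_mkseq; last by lia.
  by have -> : p + 2 * m.-1 + 1 = p + 2 * m - 1 by lia.
split => //; first by lia.
rewrite /enc_nat hbin -/(enc_bits _).
apply: (@eq_from_nth _ false); first by rewrite size_cat size_enc_bits size_mkseq !size_take_min; lia.
move=> i; rewrite size_take_min => hi; rewrite nth_take; last by lia.
rewrite nth_cat size_take_min (_ : minn p (size x) = p); last by lia.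
case: ltnP => hpi; first by rewrite nth_take.
have hm : size (bits W p m) = m by rewrite size_mkseq.
have hsym j : p + j < size x -> nth false x (p + j) = sym W 2 (p + j) by move=> h; rewrite sym2_word.
set j := i - p; have ei : i = p + j by rewrite /j; lia.
rewrite ei.
have hj : j < 2 * m + 2 by rewrite /j; lia.
(* Even offsets hold the continuation marks and odd offsets the bits; the last two offsets are the
   terminator. *)
case: (ltnP j (2 * m)) => hjm.
  have [h1 h2] := @nth_enc_bits (bits W p m) j./2 ltac:(rewrite hm; lia).
  case ho : (odd j).
    have -> : j = 2 * j./2 + 1 by rewrite -[LHS]odd_double_half ho -mul2n addnC.
    rewrite h2 nth_mkseq ?addnA; last by lia.
    by rewrite sym2_word //; lia.
  have -> : j = 2 * j./2 by rewrite -[LHS]odd_double_half ho -mul2n.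
  rewrite h1 hsym; last by lia.
  by apply: (@walk_all (tlen W) (fun i => sym W 2 (p + 2 * i)) (tlen W)); rewrite -/(npairs W p) -/m; lia.
have [h1 h2] := nth_enc_end (bits W p m); rewrite hm in h1 h2.
have hneg a : sym W 1 a -> a < size x -> nth false x a = false.
  by move=> h hx; move: h; rewrite sym1_word // => /negbTE.
have [->|->] : j = 2 * m \/ j = 2 * m + 1 by lia.
  by rewrite h1 hneg //; lia.
by rewrite h2 addnA hneg //; lia.
Qed.

Lemma natat_sound x y p n p' : natat (word x y) p n p' ->
  p <= p' <= size x /\ take p' x = take p x ++ enc_nat n.
Proof.
case/andP => /codeat_sound [h1 _ h2] /eqP; rewrite horner_bits => h3; split=> //.
by rewrite h2; congr (_ ++ enc_nat _); lia.
Qed.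

Lemma code_complete x y p n post : drop p x = enc_nat n ++ post -> let W := word x y in
  [/\ npairs W p = size (bin n), bits W p (npairs W p) = bin n & codeat W p (p + size (enc_nat n))].
Proof.
move=> hx W; set m := size (bin n).
have hsz : size x = p + (2 * m + 2 + size post).
  have := congr1 size hx; rewrite size_drop size_cat size_enc_nat -/m; lia.
have hn j : j < 2 * m + 2 -> nth false x (p + j) = nth false (enc_bits (bin n)) j.
  by move=> hj; rewrite -nth_drop hx nth_cat size_enc_nat -/m hj.
have hev i : i < m -> sym W 2 (p + 2 * i) /\ sym W 2 (p + 2 * i + 1) = nth false (bin n) i.
  move=> hi; have [h1 h2] := nth_enc_bits hi; rewrite !sym2_word; try lia.
  by rewrite -addnA !hn ?h1 ?h2 //; lia.
have [e1 e2] := nth_enc_end (bin n); rewrite -/m in e1 e2.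
have hp : npairs W p = m.
  rewrite /npairs; apply: (@walk_stop _ (fun i => sym W 2 (p + 2 * i))).
  - by rewrite tlen_word size_word; lia.
  - by rewrite tlen_word size_word; lia.
  - by move=> i /hev [].
  - by rewrite sym2_word ?hn ?e1 //; lia.
have hb : bits W p m = bin n.
  apply: (@eq_from_nth _ false); first by rewrite size_mkseq.
  by move=> i; rewrite size_mkseq => hi; rewrite nth_mkseq //; case: (hev i hi).
rewrite hp; split => //; rewrite /codeat hp size_enc_nat -/m lenx_word addnA eqxx.
apply/and5P; split => //.
- by rewrite sym1_word ?hn ?e1 //; lia.
- by rewrite -addnA sym1_word ?hn ?e2 //; lia.
- by lia.
- case: (posnP m) => h0; first by rewrite h0.
  apply/orP; right; have [_] := hev m.-1 ltac:(lia).
  have -> : p + 2 * m.-1 + 1 = p + 2 * m - 1 by lia.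
  move=> ->; rewrite nth_last -/m (_ : last false (bin n) = true) // last_bin.
  by case: eqP h0 => // e; rewrite /m e.
Qed.

Lemma nat_complete x y p n post : drop p x = enc_nat n ++ post ->
  natat (word x y) p n (p + size (enc_nat n)).
Proof.
move=> h; have [h1 h2 h3] := code_complete y h.
rewrite /natat h3 horner_bits h2 valb_bin; apply/eqP; lia.
Qed.

(** Canonical codes are determined by their values, so comparing bits is comparing numbers, however
    large. *)
Lemma samecolE W p p' : bin (valb (bits W p (npairs W p))) = bits W p (npairs W p) ->
  bin (valb (bits W p' (npairs W p'))) = bits W p' (npairs W p') ->
  samecol W p p' = (valb (bits W p (npairs W p)) == valb (bits W p' (npairs W p'))).
Proof.
move=> h1 h2; apply/idP/eqP.
  case/andP=> /eqP hn /allP h; rewrite -hn; congr valb.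
  apply/eq_in_map => i; rewrite mem_iota => hi.
  have := h i; rewrite mem_iota => /(_ hi) /eqP.
  by case: (sym _ _ _); case: (sym _ _ _).
move=> e; have := h1; rewrite e h2 => {}e.
have hn : npairs W p = npairs W p' by rewrite -[LHS](size_mkseq (fun i => sym W 2 (p + 2 * i + 1))) -[RHS](size_mkseq (fun i => sym W 2 (p' + 2 * i + 1))) -/(bits _ _ _) -e.
apply/andP; split; first by rewrite hn.
apply/allP => i; rewrite mem_iota /= => hi; apply/eqP; congr nat_of_bool.
have := congr1 (fun s => nth false s i) e.
by rewrite !nth_mkseq // -?hn.
Qed.

(** * Closures and the game graph *)

(** [supported] and [moved] are both closures of this form with decidable base and edges, so
    certification and decidability are treated once. *)
Inductive clo (n : nat) (B : nat -> bool) (E : nat -> nat -> bool) : nat -> Prop :=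
| clo_base j : j < n -> B j -> clo n B E j
| clo_step i j : clo n B E i -> j < n -> E i j -> clo n B E j.

Lemma clo_lt n B E j : clo n B E j -> j < n.
Proof. by case. Qed.

(** Closedness of the support gives one direction, by induction on derivations; the other is
    induction on the rank. *)
Lemma closb_sound n r B E : closb n r B E -> forall j, j < n -> clo n B E j <-> 0 < r j.
Proof.
move=> /allP H.
have {}H j : j < n -> [/\ B j -> 0 < r j, forall i, i < n -> 0 < r i -> E i j -> 0 < r j &
   0 < r j -> B j \/ exists i, [/\ i < n, 0 < r i, r i < r j & E i j]].
  move=> hj; have := H j; rewrite mem_iota => /(_ hj) /and3P [/implyP h1 /allP h2 /implyP h3].
  split=> //; first by move=> i hi h4 h5; have := h2 i; rewrite mem_iota h4 h5 => /(_ hi).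
  case/h3/orP => [|/hasP [i]]; first by left.
  by rewrite mem_iota => hi /and3P [a b c]; right; exists i.
move=> j hj; split.
  elim=> {j hj} [j hj|i j hi IH hj]; have [h1 h2 _] := H j hj => //.
  by apply: h2 => //; apply: clo_lt hi.
elim/ltn_ind: {j} (r j) {-2}j (erefl (r j)) hj => m IH j em hj h0.
have [_ _ /(_ h0) [hB|[i [hi h1 h2 h3]]]] := H j hj; first exact: clo_base.
by apply: clo_step h3 => //; apply: (IH (r i)) => //; rewrite -em.
Qed.

(** The rank is the stage at which an element enters the iteration of the monotone operator [F]
    towards its least fixed point; n stages suffice on n elements. *)
Lemma closb_complete n B E : exists r, (forall j, r j <= n) /\ closb n r B E.
Proof.
pose F (X : {set 'I_n}) : {set 'I_n} := [set j : 'I_n | B j || [exists i in X, E i j]].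
have F_mono : {homo F : X Y / X \subset Y}.
  move=> X Y /subsetP h; apply/subsetP => j; rewrite !inE => /orP [->//|/existsP [i /andP [hi hE]]].
  by apply/orP; right; apply/existsP; exists i; rewrite h.
pose r j := if insub j is Some o then fix_order F (o : 'I_n) else 0.
have rE j (hj : j < n) : r j = fix_order F (Ordinal hj) by rewrite /r insubT.
have inF (j : 'I_n) : (j \in fixset F) = B j || [exists i in fixset F, E i j].
  by rewrite -[in LHS](fixsetK F_mono) inE.
exists r; split.
  move=> j; rewrite /r; case: insubP => // o _ _.
  by apply: leq_trans (fix_order_le_max _ _) _; rewrite card_ord.
apply/allP => j; rewrite mem_iota /= add0n => hj; rewrite (rE _ hj); set o := Ordinal hj.
rewrite fix_order_gt0; apply/and3P; split.
- by apply/implyP => h; rewrite inF h.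
- apply/allP => i; rewrite mem_iota /= add0n => hi; rewrite (rE _ hi) fix_order_gt0.
  apply/implyP => /andP [h1 h2]; rewrite inF; apply/orP; right.
  by apply/existsP; exists (Ordinal hi); rewrite h1.
- apply/implyP => ho; have h1 := ho; rewrite -(in_iter_fix_orderE F) in h1.
  have h0 := ho; rewrite -(fix_order_gt0 F) in h0; move: h1.
  (* An element entering at stage [m.+1] has its premise present at stage m, so the premise has rank
     at most m. *)
  case em : (fix_order F o) h0 => [|m] // _; rewrite iterS inE.
  case/orP => [->//|/existsP [i /andP [h1 h2]]]; apply/orP; right.
  apply/hasP; exists (i : nat); first by rewrite mem_iota /=.
  have hi := ltn_ord i; rewrite (rE _ hi) (_ : Ordinal hi = i); last by apply: val_inj.
  have h3 := fix_order_small F_mono h1.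
  rewrite ltnS h3 h2 fix_order_gt0 !andbT.
  exact: (subsetP (iter_sub_fix F_mono m)).
Qed.

Lemma eq_closb n r r' B B' E E' : (forall j, j < n -> r j = r' j) -> (forall j, j < n -> B j = B' j) ->
  (forall i j, i < n -> j < n -> E i j = E' i j) -> closb n r B E = closb n r' B' E'.
Proof.
move=> hr hB hE; apply: eq_in_all => j; rewrite mem_iota /= add0n => hj.
rewrite hr // hB //; congr [&& _, _ & _].
  by apply: eq_in_all => i; rewrite mem_iota /= add0n => hi; rewrite hr // hE.
congr (_ ==> (_ || _)); apply: eq_in_has => i; rewrite mem_iota /= add0n => hi.
by rewrite hr // hE.
Qed.

Section ConfigChecks.
Variables (w h : nat) (walls : seq cell) (c : config).

Definition floorc j : bool :=
  has (fun p : cell => (p.2 == 0) || ((p.1, p.2.-1) \in walls)) (cells_of c j).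
Definition onc i j : bool :=
  has (fun p : cell => (0 < p.2) && ((p.1, p.2.-1) \in cells_of c i)) (cells_of c j).
Definition dragc (d : bool) i j : bool :=
  ~~ (i == j) && has (fun p : cell =>
    (((0 < p.1) || d) && (shift d p \in cells_of c j)) || (above p \in cells_of c j)) (cells_of c i).
Definition touchc i j : bool :=
  [&& i < j, j < size c, kind_of c i != None, kind_of c i == kind_of c j &
     has (fun p => has (adj4 p) (cells_of c j)) (cells_of c i)].

Lemma supported_clo j : supported walls c j <-> clo (size c) floorc onc j.
Proof.
split; elim=> {j}.
- move=> j p hj hp hb; apply: clo_base => //; apply/hasP; exists p => //.
  by case: hb => [->//|h0]; apply/orP; right.
- move=> j j' p _ IH hj hp h0 hb; apply: clo_step IH hj _; apply/hasP; exists p => //.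
  by rewrite h0.
- move=> j hj /hasP [p hp hb]; apply: (supp_base hj hp).
  by case/orP: hb => [/eqP|]; [left|right].
- move=> i j _ IH hj /hasP [p hp /andP [h0 hb]]; exact: (supp_on IH hj hp h0 hb).
Qed.

Lemma dragcP d i j : reflect (drags c d i j) (dragc d i j).
Proof.
apply: (iffP andP) => [[hne /hasP [p hp hb]]|[hne [p [hp hb]]]]; split => //.
  exists p; split => //; case/orP: hb => [/andP [h1 h2]|]; [left|right] => //.
apply/hasP; exists p => //; by case: hb => [[-> ->]|->] //; rewrite orbT.
Qed.

Lemma moved_clo d i0 j : i0 < size c ->
  moved c d i0 j <-> clo (size c) (fun j => j == i0) (dragc d) j.
Proof.
move=> hi0; split; elim=> {j}.
- exact: clo_base.
- by move=> i j _ IH hj /dragcP hd; apply: clo_step IH hj hd.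
- by move=> j _ /eqP ->; apply: moved_base.
- by move=> i j _ IH hj /dragcP hd; apply: moved_step IH hj hd.
Qed.

Lemma touchcP i j : reflect (touching_same c i j) (touchc i j).
Proof.
apply: (iffP and5P) => [[h1 h2 h3 /eqP h4 /hasP [p hp /hasP [q hq hpq]]]|].
  split => //; last by exists p, q.
  by case e : (kind_of c i) h3 => [col|] // _; exists col; rewrite -h4 e.
case=> h1 h2 [col [e1 e2]] [p [q [hp hq hpq]]]; split; rewrite ?e1 ?e2 //.
by apply/hasP; exists p => //; apply/hasP; exists q.
Qed.

Lemma can_shift_free d p : can_shift w h walls d p =
  [&& (0 < p.1) || d, (shift d p).1 < w, p.2 < h & shift d p \notin walls].
Proof. by rewrite /can_shift /free_for_fixed /shift; case: d; rewrite /= ?orbT ?orbF /= -?andbA. Qed.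
End ConfigChecks.

Definition gstate := (bool * config)%type.

(* The boolean is false while the configuration is still settling. *)
Inductive jstep (w h : nat) (walls : seq cell) : gstate -> gstate -> Prop :=
| js_merge c c' : merge1 c c' -> jstep w h walls (false, c) (false, c')
| js_fall c c' : merge_stable c -> fall1 walls c c' -> jstep w h walls (false, c) (false, c')
| js_done c : merge_stable c -> all_supported walls c -> jstep w h walls (false, c) (true, c)
| js_move c c' : move1 w h walls c c' -> jstep w h walls (true, c) (false, c').

Inductive jreach (w h : nat) (walls : seq cell) : nat -> gstate -> gstate -> Prop :=
| jr0 s : jreach w h walls 0 s s
| jrS n s1 s2 s3 : jstep w h walls s1 s2 -> jreach w h walls n s2 s3 -> jreach w h walls n.+1 s1 s3.

Section Reach.
Variables (w h : nat) (walls : seq cell).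

Lemma jreach_trans n m s1 s2 s3 : jreach w h walls n s1 s2 -> jreach w h walls m s2 s3 ->
  jreach w h walls (n + m) s1 s3.
Proof. by elim=> // {}n a b c hs _ IH /IH; apply: jrS. Qed.

Lemma settle_jreach c c' : settle walls c c' -> exists n, jreach w h walls n (false, c) (true, c').
Proof.
elim=> {c c'} [c c' c'' hm _ [n IH]|c c' c'' hs hf _ [n IH]|c hs ha].
- by exists n.+1; apply: jrS IH; apply: js_merge.
- by exists n.+1; apply: jrS IH; apply: js_fall.
- by exists 1; apply: jrS (jr0 _ _ _ _); apply: js_done.
Qed.

Lemma game_jreach c c' : game_reach w h walls c c' -> exists n, jreach w h walls n (true, c) (true, c').
Proof.
elim=> {c c'} [c|c c1 c2 [c' [hm /settle_jreach [n hn]]] _ [m hm']]; first by exists 0; apply: jr0.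
by exists (n + m).+1; apply: jrS (js_move hm) _; apply: jreach_trans hn hm'.
Qed.

(** Read from the end, each edge is a constructor of [settle] or of [game_reach]. Ending in the
    player's turn matters: only then is the last settling complete. *)
Lemma jreach_game n s s' : jreach w h walls n s s' -> s'.1 ->
  if s.1 then game_reach w h walls s.2 s'.2
  else exists c0, settle walls s.2 c0 /\ game_reach w h walls c0 s'.2.
Proof.
elim=> {n s s'} [s ->|n s1 s2 s3 hs _ IH hs3]; first exact: reach_refl.
have {IH} := IH hs3; case: hs => {s1 s2} [c c' hm|c c' hst hf|c hst ha|c c' hm] /=.
- by move=> [c0 [h1 h2]]; exists c0; split => //; apply: settle_merge h1.
- by move=> [c0 [h1 h2]]; exists c0; split => //; apply: settle_fall h1.
- by move=> h1; exists c; split => //; apply: settle_done.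
- by move=> [c0 [h1 h2]]; apply: reach_step h2; exists c'.
Qed.
End Reach.

Lemma solvableE L : solvable L <-> exists n c,
  jreach (lw L) (lh L) (lwalls L) n (false, lblocks L) (true, c) /\ solved c.
Proof.
split.
  move=> [c0 [c [/(@settle_jreach (lw L) (lh L)) [n hn] /game_jreach [m hm] hs]]].
  by exists (n + m), c; split => //; apply: jreach_trans hn hm.
move=> [n [c [/jreach_game /(_ isT) /= [c0 [h1 h2]] hs]]].
by exists c0, c.
Qed.

(** * Checked steps are game steps *)

Definition pairseq (f g : nat -> nat) n : seq cell := mkseq (fun q => (f q, g q)) n.

Lemma mem_pairseq f g n a b :
  ((a, b) \in pairseq f g n) = has (fun q => (f q == a) && (g q == b)) (iota 0 n).
Proof.
apply/mapP/hasP => [[q hq [-> ->]]|[q hq /andP [/eqP <- /eqP <-]]]; exists q => //.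
by rewrite !eqxx.
Qed.

Lemma has_pairseq P f g n : has P (pairseq f g n) = has (fun q => P (f q, g q)) (iota 0 n).
Proof. by rewrite /pairseq /mkseq has_map. Qed.

Lemma all_pairseq P f g n : all P (pairseq f g n) = all (fun q => P (f q, g q)) (iota 0 n).
Proof. by rewrite /pairseq /mkseq all_map. Qed.

Lemma eq_pairseq f g f' g' n : (forall q, q < n -> f q = f' q /\ g q = g' q) ->
  pairseq f g n = pairseq f' g' n.
Proof. by move=> h; apply/eq_in_map => q; rewrite mem_iota /= => /h [-> ->]. Qed.

Lemma all_iotaP (P : nat -> bool) n : reflect (forall i, i < n -> P i) (all P (iota 0 n)).
Proof.
apply: (iffP allP) => h i hi; first by apply: h; rewrite mem_iota.
by apply: h; move: hi; rewrite mem_iota.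
Qed.

Lemma has_iotaP (P : nat -> bool) n : reflect (exists2 i, i < n & P i) (has P (iota 0 n)).
Proof.
apply: (iffP hasP) => [[i hi hP]|[i hi hP]]; exists i => //; last by rewrite mem_iota.
by move: hi; rewrite mem_iota.
Qed.

Notation dflt := (@None nat, @nil cell) (only parsing).

Section StepChecks.
Variable W : seq nat.

Definition kval p := valb (bits W p (npairs W p)).
Definition kd p : option nat := if p is 0 then None else Some (kval p).
(** The invariant under which [samecol] decides equality of the denoted kinds. *)
Definition kcan p := p = 0 \/ bin (kval p) = bits W p (npairs W p).

Definition conf t : config :=
  mkseq (fun j => (kd (knd W t j), pairseq (cx W t j) (cy W t j) (len W t j))) (nbl W t).
Definition wcells : seq cell := pairseq (wx W) (wy W) (znw W).

Lemma size_conf t : size (conf t) = nbl W t.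
Proof. exact: size_mkseq. Qed.

Lemma nth_conf t j : j < nbl W t -> nth dflt (conf t) j =
  (kd (knd W t j), pairseq (cx W t j) (cy W t j) (len W t j)).
Proof. by move=> h; rewrite nth_mkseq. Qed.

Lemma cells_conf t j : j < nbl W t -> cells_of (conf t) j = pairseq (cx W t j) (cy W t j) (len W t j).
Proof. by move=> h; rewrite /cells_of nth_conf. Qed.

Lemma kind_conf t j : j < nbl W t -> kind_of (conf t) j = kd (knd W t j).
Proof. by move=> h; rewrite /kind_of nth_conf. Qed.

Lemma incellE t j a b : j < nbl W t -> incell W t j a b = ((a, b) \in cells_of (conf t) j).
Proof. by move=> h; rewrite cells_conf // mem_pairseq. Qed.

Lemma inwallE a b : inwall W a b = ((a, b) \in wcells).
Proof. by rewrite mem_pairseq. Qed.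

Lemma floorbE t j : j < nbl W t -> floorb W t j = floorc wcells (conf t) j.
Proof.
move=> h; rewrite /floorc cells_conf // has_pairseq; apply: eq_has => q.
by rewrite inwallE.
Qed.

Lemma onbE t i j : i < nbl W t -> j < nbl W t -> onb W t i j = onc (conf t) i j.
Proof.
move=> hi hj; rewrite /onc [cells_of _ j]cells_conf // has_pairseq; apply: eq_has => q.
by rewrite incellE.
Qed.

Lemma shiftE (d : bool) a b : shift d (a, b) = (shiftx W d a, b).
Proof. by case: d. Qed.

Lemma dragbE (d : bool) t i j : i < nbl W t -> j < nbl W t ->
  dragb W d t i j = dragc (conf t) d i j.
Proof.
move=> hi hj; rewrite /dragb /dragc [cells_of _ i]cells_conf // has_pairseq.
congr (_ && _); apply: eq_has => q /=.
by rewrite shiftE !incellE //; case: d.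
Qed.

Lemma canbE (d : bool) a b : canb W d a b = can_shift (zw W) (zh W) wcells d (a, b).
Proof. by rewrite can_shift_free /canb shiftE inwallE; case: d. Qed.

Lemma touchanyE t j a b : j < nbl W t -> touchany W t j a b = has (adj4 (a, b)) (cells_of (conf t) j).
Proof. by move=> h; rewrite cells_conf // has_pairseq. Qed.

Lemma kd_eq p p' : kcan p -> kcan p' -> (kd p != None) && (kd p == kd p') =
  [&& 0 < p, 0 < p' & samecol W p p'].
Proof.
case: p => [|p]; case: p' => [|p'] // [//|h1] [//|h2].
by rewrite samecolE.
Qed.

Lemma touchbE t i j : (forall l, l < nbl W t -> kcan (knd W t l)) ->
  touchb W t i j = touchc (conf t) i j.
Proof.
move=> hc; rewrite /touchb /touchc size_conf; case: ltnP => //= hij.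
case hj : (j < nbl W t) => //=; have hi := ltn_trans hij hj.
rewrite !kind_conf // [RHS]andbA kd_eq; [|exact: hc|exact: hc].
rewrite -!andbA; do 4 congr (_ && _).
rewrite [cells_of _ i]cells_conf // has_pairseq; apply: eq_in_has => q _.
by rewrite touchanyE.
Qed.

Lemma stableb_conf t : (forall l, l < nbl W t -> kcan (knd W t l)) ->
  stableb W t <-> merge_stable (conf t).
Proof.
move=> hc; split.
  move=> /all_iotaP h i j /touchcP ht.
  have /and5P [h1 h2 _ _ _] := ht; rewrite size_conf in h2.
  have /all_iotaP /(_ j h2) := h i (ltn_trans h1 h2).
  by rewrite touchbE // ht.
move=> h; apply/all_iotaP => i hi; apply/all_iotaP => j hj.
by rewrite touchbE //; apply/touchcP.
Qed.

Lemma suppbE t : suppb W t = closb (nbl W t) (rk W t) (floorc wcells (conf t)) (onc (conf t)).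
Proof. by apply: eq_closb => // [j hj|i j hi hj]; rewrite ?floorbE ?onbE. Qed.

Lemma suppb_conf t j : suppb W t -> j < nbl W t -> supported wcells (conf t) j <-> 0 < rk W t j.
Proof.
rewrite suppbE => h hj; split.
  by move/supported_clo; rewrite size_conf => /(closb_sound h hj).
by move/(closb_sound h hj) => hc; apply/supported_clo; rewrite size_conf.
Qed.

Lemma eqblk_conf t i u j : eqblk W t i u j -> i < nbl W t -> j < nbl W u ->
  nth dflt (conf t) i = nth dflt (conf u) j.
Proof.
move=> /and3P [/eqP hk /eqP hl /all_iotaP h] hi hj; rewrite !nth_conf // hk hl; congr pair.
by apply: eq_pairseq => q; rewrite -hl => /h /andP [/eqP -> /eqP ->].
Qed.

Lemma size_drop_nth j (s : config) : j < size s -> size (Defs.drop_nth j s) = (size s).-1.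
Proof. by move=> h; rewrite /Defs.drop_nth size_cat size_takel ?size_drop; lia. Qed.

Lemma nth_drop_nth j (s : config) l : j < size s ->
  nth dflt (Defs.drop_nth j s) l = nth dflt s (l + (j <= l)).
Proof.
move=> h; rewrite /Defs.drop_nth nth_cat size_takel ?(ltnW h) //.
case: ltnP => hl; first by rewrite nth_take // addn0.
by rewrite nth_drop; congr nth; lia.
Qed.

Lemma mergedblk_conf t i j : mergedblk W t i j -> i < nbl W t -> j < nbl W t -> i < nbl W t.+1 ->
  nth dflt (conf t.+1) i =
  (kind_of (conf t) i, cells_of (conf t) i ++ cells_of (conf t) j).
Proof.
move=> /and4P [/eqP hk /eqP hl /all_iotaP h1 /all_iotaP h2] hi hj hi'.
rewrite nth_conf // kind_conf // hk hl !cells_conf //; congr pair.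
rewrite /pairseq /mkseq iotaD map_cat add0n; congr cat.
  by apply/eq_in_map => q; rewrite mem_iota /= => /h1 /andP [/eqP -> /eqP ->].
rewrite -{1}[len W t i]addn0 iotaDl -map_comp.
by apply/eq_in_map => q; rewrite mem_iota /= => /h2 /andP [/eqP -> /eqP ->].
Qed.

Lemma mergeb_conf t : (forall l, l < nbl W t -> kcan (knd W t l)) -> mergeb W t ->
  merge1 (conf t) (conf t.+1).
Proof.
move=> hc /has_iotaP [i hi /has_iotaP [j hj /and3P [ht /eqP hn /all_iotaP h]]].
rewrite touchbE // in ht; have /and5P [hij _ _ _ _] := ht.
exists i, j; split; first exact/touchcP.
have hs : size (set_nth dflt (conf t) i (kind_of (conf t) i, cells_of (conf t) i ++ cells_of (conf t) j))
    = nbl W t by rewrite size_set_nth size_conf; lia.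
apply: (@eq_from_nth block dflt); first by rewrite size_drop_nth hs // size_conf hn.
rewrite size_conf => l hl; rewrite nth_drop_nth ?hs // nth_set_nth /=.
have := h l hl; case: eqP => [->|ne] hb.
  rewrite leqNgt hij addn0 eqxx; apply: mergedblk_conf => //; lia.
rewrite ifF; last by apply/eqP; lia.
by symmetry; apply: eqblk_conf hb _ _ => //; lia.
Qed.

Lemma dropblk_conf t j : dropblk W t j -> j < nbl W t -> j < nbl W t.+1 ->
  nth dflt (conf t.+1) j = (kind_of (conf t) j, map below (cells_of (conf t) j)).
Proof.
move=> /and3P [/eqP hk /eqP hl /all_iotaP h] hj hj'.
rewrite nth_conf // kind_conf // cells_conf // hk hl /pairseq /mkseq -map_comp; congr pair.
by apply/eq_in_map => q; rewrite mem_iota /= => /h /andP [/eqP -> /eqP ->].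
Qed.

Lemma fallb_conf t : (forall l, l < nbl W t -> kcan (knd W t l)) -> fallb W t ->
  merge_stable (conf t) /\ fall1 wcells (conf t) (conf t.+1).
Proof.
move=> hc /and5P [/(stableb_conf hc) hs hsup /has_iotaP [j hj /eqP hr] /eqP hn /all_iotaP h].
split => //; split; first by exists j; rewrite size_conf (suppb_conf hsup) // hr.
split; first by rewrite !size_conf.
move=> l; rewrite size_conf => hl; have := h l hl; rewrite (suppb_conf hsup) //.
case: eqP => [->|ne] hb; split => // hl'.
- by apply: dropblk_conf => //; rewrite hn.
- by symmetry; apply: eqblk_conf hb _ _ => //; rewrite hn.
- by case: hl'; lia.
Qed.

Lemma doneb_conf t : (forall l, l < nbl W t -> kcan (knd W t l)) -> doneb W t ->
  [/\ merge_stable (conf t), all_supported wcells (conf t) & conf t.+1 = conf t].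
Proof.
move=> hc /and5P [/(stableb_conf hc) hs hsup /all_iotaP hr /eqP hn /all_iotaP h]; split => //.
  by move=> j; rewrite size_conf => hj; rewrite (suppb_conf hsup) //; apply: hr.
apply: (@eq_from_nth block dflt); first by rewrite !size_conf.
rewrite size_conf => l hl; symmetry; apply: eqblk_conf => //; last by rewrite -hn.
by apply: h; rewrite -hn.
Qed.

Lemma shiftblk_conf (d : bool) t j : shiftblk W d t j -> j < nbl W t -> j < nbl W t.+1 ->
  all (can_shift (zw W) (zh W) wcells d) (cells_of (conf t) j) /\
  nth dflt (conf t.+1) j = (kind_of (conf t) j, map (shift d) (cells_of (conf t) j)).
Proof.
move=> /and3P [/eqP hk /eqP hl /all_iotaP h] hj hj'; split.
  rewrite cells_conf // all_pairseq; apply/all_iotaP => q /h /and3P [].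
  by rewrite canbE.
rewrite nth_conf // kind_conf // cells_conf // hk hl /pairseq /mkseq -map_comp; congr pair.
by apply/eq_in_map => q; rewrite mem_iota /= => /h /and3P [_ /eqP -> /eqP ->]; rewrite shiftE.
Qed.

Lemma movesb_closb (d : bool) i0 t :
  closb (nbl W t) (fun j => rk W t j) (fun j => j == i0) (fun i j => dragb W d t i j) =
  closb (nbl W t) (rk W t) (fun j => j == i0) (dragc (conf t) d).
Proof. by apply: eq_closb => // i l h1 h2; rewrite dragbE. Qed.

Lemma movesb_conf (d : bool) t i0 : movesb W d i0 t -> i0 < nbl W t ->
  move1 (zw W) (zh W) wcells (conf t) (conf t.+1).
Proof.
move=> /and4P [hk hcl /eqP hn /all_iotaP h] hi.
have hm j : j < nbl W t -> moved (conf t) d i0 j <-> 0 < rk W t j.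
  move=> hj; rewrite moved_clo size_conf //.
  by apply: closb_sound hj; rewrite -movesb_closb.
have mlt j : moved (conf t) d i0 j -> j < nbl W t.
  by case=> [|i l _]; rewrite -?size_conf ?size_conf.
exists i0, d, (kval (knd W t i0)); rewrite !size_conf; split => //.
- by rewrite kind_conf //; case: (knd W t i0) hk.
- move=> j hj; have hjl := mlt j hj; have := h j hjl; rewrite ((hm j hjl).1 hj) => hb.
  have hj' : j < nbl W t.+1 by rewrite hn.
  by have [] := shiftblk_conf hb hjl hj'.
- move=> j hj; have := h j hj; rewrite hm //.
  case: posnP => h0 hb; split => // _.
    by symmetry; apply: eqblk_conf => //; rewrite hn.
  have hj' : j < nbl W t.+1 by rewrite hn.
  by have [] := shiftblk_conf hb hj hj'.
Qed.

Lemma stepb_conf t : (forall l, l < nbl W t -> kcan (knd W t l)) -> stepb W t ->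
  jstep (zw W) (zh W) wcells (phs W t != 0, conf t) (phs W t.+1 != 0, conf t.+1).
Proof.
move=> hc; rewrite /stepb; case: eqP => _ /=.
  case/orP=> /andP [/eqP -> /=].
    case/orP; first by move/(mergeb_conf hc); apply: js_merge.
    by move/(fallb_conf hc) => [h1 h2]; apply: js_fall.
  by move/(doneb_conf hc) => [h1 h2 ->]; apply: js_done.
move=> /andP [/eqP -> /= /has_iotaP [i hi hm]]; apply: js_move.
by case/orP: hm => [/(@movesb_conf false)|/(@movesb_conf true)]; apply.
Qed.

(** Every check copies the kinds from one time to the next, so canonicity, once parsed at time 0,
    never has to be checked again. *)
Lemma stepb_can t : (forall l, l < nbl W t -> kcan (knd W t l)) -> stepb W t ->
  forall l, l < nbl W t.+1 -> kcan (knd W t.+1 l).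
Proof.
have eb t' i u j : eqblk W t' i u j -> kcan (knd W t' i) -> kcan (knd W u j).
  by case/and3P => /eqP ->.
move=> hc; rewrite /stepb; case: eqP => _ /=.
  case/orP=> /andP [_].
    case/orP.
      move=> /has_iotaP [i hi /has_iotaP [j hj /and3P [/and3P [hij _ _] /eqP hn /all_iotaP h]]] l hl.
      have := h l hl; case: eqP => [-> /and4P [/eqP -> _ _ _]|ne]; first exact: hc.
      by move=> hb; apply: eb hb _; apply: hc; lia.
    move=> /and5P [_ _ _ /eqP hn /all_iotaP h] l; rewrite hn => hl; have := h l hl.
    case: eqP => [_ /and3P [/eqP -> _ _]|_ hb]; first exact: hc.
    by apply: eb hb _; apply: hc.
  move=> /and5P [_ _ _ /eqP hn /all_iotaP h] l; rewrite hn => hl; have := h l hl.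
  by move=> hb; apply: eb hb _; apply: hc.
move=> /andP [_ /has_iotaP [i hi]].
have hmv d : movesb W d i t -> forall l, l < nbl W t.+1 -> kcan (knd W t.+1 l).
  move=> /and4P [_ _ /eqP hn /all_iotaP h] l; rewrite hn => hl; have := h l hl.
  case: posnP => [_ hb|_ /and3P [/eqP -> _ _]]; last exact: hc.
  by apply: eb hb _; apply: hc.
by case/orP; apply: hmv.
Qed.

Lemma solvedb_conf t : (forall l, l < nbl W t -> kcan (knd W t l)) ->
  solvedb W t <-> solved (conf t).
Proof.
move=> hc; split.
  move=> /all_iotaP h i j col; rewrite size_conf => hi hj.
  have /all_iotaP /(_ j hj) /implyP := h i hi.
  rewrite -kd_eq; [|exact: hc|exact: hc].
  by rewrite !kind_conf // => h1 e1 e2; apply/eqP; apply: h1; rewrite e1 e2 eqxx.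
move=> h; apply/all_iotaP => i hi; apply/all_iotaP => j hj; apply/implyP.
rewrite -kd_eq; [|exact: hc|exact: hc].
move=> /andP []; case e1 : (kd _) => [col|] // _ /eqP e2; apply/eqP.
by apply: (h i j col); rewrite ?size_conf // kind_conf.
Qed.

Lemma trace_sound n t : (forall l, l < nbl W t -> kcan (knd W t l)) ->
  (forall u, t <= u < t + n -> stepb W u) ->
  jreach (zw W) (zh W) wcells n (phs W t != 0, conf t) (phs W (t + n) != 0, conf (t + n)) /\
  (forall l, l < nbl W (t + n) -> kcan (knd W (t + n) l)).
Proof.
elim: n t => [|n IH] t hc hs; first by rewrite addn0; split => //; apply: jr0.
have h0 : stepb W t by apply: hs; lia.
have [|h1 h2] := IH t.+1 (stepb_can hc h0).
  by move=> u hu; apply: hs; lia.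
by rewrite addnS -addSn; split => //; apply: jrS (stepb_conf hc h0) h1.
Qed.
End StepChecks.

(** * Game steps pass the checks *)

Section Represent.
Variables (W : seq nat) (kid : option nat -> nat).

Definition repblk t i (b : block) : Prop :=
  [/\ knd W t i = kid b.1, len W t i = size b.2 &
    forall q, q < size b.2 -> (cx W t i q, cy W t i q) = nth (0, 0) b.2 q].

Definition repstate t (s : gstate) : Prop :=
  [/\ nbl W t = size s.2, phs W t = s.1 & forall j, j < size s.2 -> repblk t j (nth dflt s.2 j)].

(** [kid] assigns numeric names to kinds; a good name denotes its kind and is canonical. *)
Definition kgood (k : option nat) : Prop := kd W (kid k) = k /\ kcan W (kid k).

Lemma repblk_cells t i b : repblk t i b -> pairseq (cx W t i) (cy W t i) (len W t i) = b.2.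
Proof.
case=> _ hl hq; rewrite hl; apply: (@eq_from_nth _ (0, 0)); first by rewrite size_mkseq.
by move=> q; rewrite size_mkseq => hlt; rewrite nth_mkseq // hq.
Qed.

Lemma repstate_conf t s : repstate t s -> (forall j, j < size s.2 -> kgood (kind_of s.2 j)) ->
  conf W t = s.2.
Proof.
case=> hn _ hb hk; apply: (@eq_from_nth block dflt); first by rewrite size_conf.
rewrite size_conf => j hj; rewrite nth_conf //; rewrite hn in hj.
have h1 := hb j hj; rewrite (repblk_cells h1); have [-> _ _] := h1.
by have [e _] := hk j hj; rewrite [X in (X, _)]e /kind_of; case: (nth _ _ _).
Qed.

Lemma repstate_can t s : repstate t s -> (forall j, j < size s.2 -> kgood (kind_of s.2 j)) ->
  forall l, l < nbl W t -> kcan W (knd W t l).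
Proof.
by case=> -> _ hb hk l hl; have [-> _ _] := hb l hl; have [_] := hk l hl.
Qed.

Lemma repblk_xy t i b q : repblk t i b -> q < size b.2 ->
  cx W t i q = (nth (0, 0) b.2 q).1 /\ cy W t i q = (nth (0, 0) b.2 q).2.
Proof. by case=> _ _ h /h <-. Qed.

Lemma repblk_eq t i u j b : repblk t i b -> repblk u j b -> eqblk W t i u j.
Proof.
move=> r1 r2; have [k1 l1 _] := r1; have [k2 l2 _] := r2.
rewrite /eqblk k1 k2 l1 l2 !eqxx /=; apply/all_iotaP => q hq.
by have [-> ->] := repblk_xy r1 hq; have [-> ->] := repblk_xy r2 hq; rewrite !eqxx.
Qed.

Lemma repblk_drop t j b : repblk t j b -> repblk t.+1 j (b.1, map below b.2) -> dropblk W t j.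
Proof.
move=> r1 r2; have [k1 l1 _] := r1; have [k2 l2 _] := r2.
rewrite /dropblk k1 k2 l1 l2 size_map !eqxx /=; apply/all_iotaP => q hq.
have hq' : q < size (b.1, map below b.2).2 by rewrite size_map.
have [-> ->] := repblk_xy r1 hq; have [-> ->] := repblk_xy r2 hq'.
by rewrite /= (nth_map (0, 0)) // !eqxx.
Qed.

Lemma repblk_shift (d : bool) t j b : repblk t j b -> repblk t.+1 j (b.1, map (shift d) b.2) ->
  all (can_shift (zw W) (zh W) (wcells W) d) b.2 -> shiftblk W d t j.
Proof.
move=> r1 r2 hc; have [k1 l1 _] := r1; have [k2 l2 _] := r2.
rewrite /shiftblk k1 k2 l1 l2 size_map !eqxx /=; apply/all_iotaP => q hq.
have hq' : q < size (b.1, map (shift d) b.2).2 by rewrite size_map.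
have [e1 e2] := repblk_xy r1 hq; have [-> ->] := repblk_xy r2 hq'.
rewrite canbE e1 e2 /= (nth_map (0, 0)) // -surjective_pairing.
rewrite (all_nthP (0, 0) hc) //=; case: (nth (0, 0) b.2 q) => a c.
by rewrite (shiftE W) !eqxx.
Qed.

Lemma repblk_merge t i j b1 b2 : repblk t i b1 -> repblk t j b2 ->
  repblk t.+1 i (b1.1, b1.2 ++ b2.2) -> mergedblk W t i j.
Proof.
move=> r1 r2 r3; have [k1 l1 _] := r1; have [k2 l2 _] := r2; have [k3 l3 _] := r3.
rewrite /mergedblk k1 k3 l1 l2 l3 size_cat !eqxx /=; apply/andP; split; apply/all_iotaP => q hq.
  have [-> ->] := repblk_xy r1 hq.
  have [|-> ->] := repblk_xy r3 (q := q); first by rewrite size_cat; lia.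
  by rewrite nth_cat hq !eqxx.
have [-> ->] := repblk_xy r2 hq.
have [|-> ->] := repblk_xy r3 (q := size b1.2 + q); first by rewrite size_cat; lia.
rewrite nth_cat ltnNge leq_addr /=.
by rewrite addKn !eqxx.
Qed.
End Represent.

Lemma nth_set_other (c : config) i j b : i < size c -> j != i -> nth dflt (set_nth dflt c i b) j = nth dflt c j.
Proof. by move=> h hne; rewrite nth_set_nth /= (negbTE hne). Qed.

Lemma block_eta (c : config) j : nth dflt c j = (kind_of c j, cells_of c j).
Proof. exact: surjective_pairing. Qed.

(** The ranks are chosen before the tape W, since the certificate on the tape is built from them;
    their bound enters the bound on its entries. *)
Lemma step_complete w h walls s s' : jstep w h walls s s' ->
  exists r, (forall j, r j <= size s.2) /\
    forall W kid t, zw W = w -> zh W = h -> wcells W = walls ->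
    repstate W kid t s -> repstate W kid t.+1 s' ->
    (forall j, j < size s.2 -> kgood W kid (kind_of s.2 j)) ->
    (forall j, j < size s.2 -> rk W t j = r j) -> stepb W t.
Proof.
case=> {s s'} [c c' [i [j [ht ->]]]|c c' hst [[j0 [hj0 hns]] [hsz hf]]|c hst ha|
  c c' [i0 [d [col [hi0 hcol hcan hsz hm]]]]] /=.
(* A merge is checked without ranks. *)
- exists (fun=> 0); split => // W kid t hw hh hwl rs rs' hk hr.
  have hc := repstate_conf rs hk; have hcan := repstate_can rs hk.
  have [hn hp hb] := rs; have [hn' hp' hb'] := rs'.
  rewrite /stepb hp hp' /=; apply/orP; left; apply/orP; left.
  have /touchcP hti := ht; have /and5P [hij hj _ _ _] := hti.
  have hi := ltn_trans hij hj.
  have hs : size (set_nth dflt c i (kind_of c i, cells_of c i ++ cells_of c j)) = size c.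
    by rewrite size_set_nth; apply/maxn_idPr.
  rewrite /= size_drop_nth hs // in hn'.
  apply/has_iotaP; exists i; first by rewrite hn.
  apply/has_iotaP; exists j; first by rewrite hn.
  rewrite touchbE // hc hti hn' hn prednK ?eqxx /=; last by lia.
  apply/all_iotaP => l hl.
  have := hb' l; rewrite size_drop_nth hs // => /(_ hl); rewrite nth_drop_nth ?hs //.
  case: eqP => [->|ne].
    rewrite leqNgt hij addn0 nth_set_nth /= eqxx => h3.
    by apply: (repblk_merge (hb i hi) (hb j hj) h3).
  rewrite nth_set_other //; last by apply/eqP; lia.
  by apply: repblk_eq; apply: hb => /=; lia.
- have [r [hr hcl]] := closb_complete (size c) (floorc walls c) (onc c).
  exists r; split => // W kid t hw hh hwl rs rs' hk hrk.
  have hc := repstate_conf rs hk; have hcan := repstate_can rs hk.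
  have [hn hp hb] := rs; have [hn' hp' hb'] := rs'.
  have hsup : suppb W t.
    by rewrite suppbE hwl hc hn (eq_closb hrk (fun _ _ => erefl) (fun _ _ _ _ => erefl)).
  have hsc j : j < size c -> supported walls c j <-> 0 < rk W t j.
    by move=> hj; have := suppb_conf hsup (j := j); rewrite hn hc hwl; apply.
  rewrite /stepb hp hp' /=; apply/orP; left; apply/orP; right.
  apply/and5P; split => //.
  + by apply/stableb_conf => //; rewrite hc.
  + apply/has_iotaP; exists j0; first by rewrite hn.
    by rewrite -leqn0 leqNgt; apply/negP => /(hsc j0 hj0).
  + by rewrite hn hn' hsz.
  apply/all_iotaP => l; rewrite hn => hl; have [h1 h2] := hf l hl.
  have hl' : l < size c' by rewrite hsz.
  have rl := hb l hl; have rl' := hb' l hl'.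
  case: eqP => h0.
    have hn0 : ~ supported walls c l by move/(hsc l hl); rewrite h0.
    by move: rl'; rewrite /= (h2 hn0); apply: repblk_drop.
  have hn0 : supported walls c l by apply/(hsc l hl); lia.
  by move: rl'; rewrite /= (h1 hn0); apply: repblk_eq.
- have [r [hr hcl]] := closb_complete (size c) (floorc walls c) (onc c).
  exists r; split => // W kid t hw hh hwl rs rs' hk hrk.
  have hc := repstate_conf rs hk; have hcan := repstate_can rs hk.
  have [hn hp hb] := rs; have [hn' hp' hb'] := rs'.
  have hsup : suppb W t.
    by rewrite suppbE hwl hc hn (eq_closb hrk (fun _ _ => erefl) (fun _ _ _ _ => erefl)).
  have hsc j : j < size c -> supported walls c j <-> 0 < rk W t j.
    by move=> hj; have := suppb_conf hsup (j := j); rewrite hn hc hwl; apply.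
  rewrite /stepb hp hp' /=; apply/and5P; split => //.
  + by apply/stableb_conf => //; rewrite hc.
  + by apply/all_iotaP => j; rewrite hn => hj; apply/hsc => //; apply: ha.
  + by rewrite hn hn'.
  apply/all_iotaP => l; rewrite hn => hl.
  exact: repblk_eq (hb l hl) (hb' l hl).
- have [r [hr hcl]] := closb_complete (size c) (fun j => j == i0) (dragc c d).
  exists r; split => // W kid t hw hh hwl rs rs' hk hrk.
  have hc := repstate_conf rs hk.
  have [hn hp hb] := rs; have [hn' hp' hb'] := rs'.
  rewrite /stepb hp hp' /=; apply/has_iotaP; exists i0; first by rewrite hn.
  suff : movesb W d i0 t by case: (d) => ->; rewrite ?orbT.
  have hsc j : j < size c -> moved c d i0 j <-> 0 < rk W t j.
    move=> hj; rewrite hrk //; split; first by move/(moved_clo d j hi0)/(closb_sound hcl hj).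
    by move/(closb_sound hcl hj)/(moved_clo d j hi0).
  apply/and4P; split.
  + have [-> _ _] := hb i0 hi0; have [e _] := hk i0 hi0; move: e.
    by rewrite hcol /kind_of /= => e; move: hcol; rewrite /kind_of => ->; case: (kid _) e.
  + by rewrite movesb_closb hc hn (eq_closb hrk (fun _ _ => erefl) (fun _ _ _ _ => erefl)).
  + by rewrite hn hn' hsz.
  apply/all_iotaP => l; rewrite hn => hl; have [h1 h2] := hm l hl.
  have hl' : l < size c' by rewrite hsz.
  have rl := hb l hl; have rl' := hb' l hl'.
  case: posnP => h0.
    have hn0 : ~ moved c d i0 l by move/(hsc l hl); rewrite h0.
    by move: rl'; rewrite /= (h2 hn0); apply: repblk_eq.
  have hn0 : moved c d i0 l by apply/(hsc l hl).
  move: rl'; rewrite /= (h1 hn0) => rl'.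
  apply: (@repblk_shift W kid d t l (nth dflt c l)) => //.
  by rewrite hw hh hwl; apply: hcan.
Qed.

(** * Short traces *)

(** A rank function decides the closure, so blocks can be split into supported and unsupported
    constructively. *)
Lemma clo_dec n B E j : clo n B E j \/ ~ clo n B E j.
Proof.
have [r [_ hr]] := closb_complete n B E.
case: (ltnP j n) => hj; last by right => /clo_lt; rewrite ltnNge hj.
case: (posnP (r j)) => h; [right|left]; last by apply/(closb_sound hr hj).
by move/(closb_sound hr hj); rewrite h.
Qed.

Lemma supported_dec walls c j : supported walls c j \/ ~ supported walls c j.
Proof.
by case: (clo_dec (size c) (floorc walls c) (onc c) j) => h; [left|right]; rewrite supported_clo.
Qed.

Lemma moved_dec c d i0 j : i0 < size c -> moved c d i0 j \/ ~ moved c d i0 j.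
Proof.
move=> h; case: (clo_dec (size c) (fun j => j == i0) (dragc c d) j) => hc; [left|right];
by rewrite (moved_clo d j h).
Qed.

(* Equality of all coordinate differences, stated without subtraction. *)
Definition rigid (a b : seq cell) : Prop := size a = size b /\
  forall p q, p < size a -> q < size a ->
    (nth (0, 0) a p).1 + (nth (0, 0) b q).1 = (nth (0, 0) a q).1 + (nth (0, 0) b p).1 /\
    (nth (0, 0) a p).2 + (nth (0, 0) b q).2 = (nth (0, 0) a q).2 + (nth (0, 0) b p).2.

Lemma rigid_refl a : rigid a a.
Proof. by split => // p q _ _; split; rewrite addnC. Qed.

Lemma rigid_trans b a c : rigid a b -> rigid b c -> rigid a c.
Proof.
move=> [s1 h1] [s2 h2]; split; first by rewrite s1.
move=> p q hp hq; have [e1 e2] := h1 p q hp hq.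
by rewrite s1 in hp hq; have [e3 e4] := h2 p q hp hq; split; lia.
Qed.

Lemma rigid_eq a b : rigid a b -> nth (0, 0) a 0 = nth (0, 0) b 0 -> a = b.
Proof.
move=> [s h] e; apply: (@eq_from_nth _ (0, 0)) => // p hp.
have [] := h p 0 hp (leq_ltn_trans (leq0n p) hp).
rewrite e; case: (nth (0, 0) a p) => x y; case: (nth (0, 0) b p) => x' y' /= e1 e2.
by congr (_, _); lia.
Qed.

(** Positive heights are needed because the truncated predecessor would flatten a shape at the
    floor; an unsupported block has no cell there. *)
Lemma rigid_below (a : seq cell) : (forall p : cell, p \in a -> 0 < p.2) -> rigid a (map below a).
Proof.
move=> h; split; first by rewrite size_map.
move=> p q hp hq; rewrite !(nth_map (0, 0)) // /below /=.
have := h _ (mem_nth (0, 0) hp); have := h _ (mem_nth (0, 0) hq).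
by case: (nth (0, 0) a p) => a1 a2; case: (nth (0, 0) a q) => b1 b2 /=; lia.
Qed.

Lemma rigid_shift d (a : seq cell) : (forall p : cell, p \in a -> (0 < p.1) || d) -> rigid a (map (shift d) a).
Proof.
move=> h; split; first by rewrite size_map.
move=> p q hp hq; rewrite !(nth_map (0, 0)) // /shift.
have := h _ (mem_nth (0, 0) hp); have := h _ (mem_nth (0, 0) hq).
by case: (nth (0, 0) a p) => a1 a2; case: (nth (0, 0) a q) => b1 b2; case: d {h} => /=; lia.
Qed.

Lemma unsupported_gt0 walls c j (p : cell) : j < size c -> ~ supported walls c j -> p \in cells_of c j -> 0 < p.2.
Proof.
by move=> hj hn hp; rewrite lt0n; apply/eqP => e; apply: hn; apply: (supp_base hj hp); left.
Qed.

(** * Invariants of a play *)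

Definition ncells (c : config) := sumn [seq size b.2 | b <- c].

Lemma sumn_map_drop_nth (f : block -> nat) j (s : config) : j < size s ->
  sumn (map f (Defs.drop_nth j s)) + f (nth dflt s j) = sumn (map f s).
Proof.
move=> h; rewrite /Defs.drop_nth map_cat sumn_cat.
rewrite -[in RHS](cat_take_drop j s) (drop_nth dflt h) map_cat sumn_cat /=.
by rewrite -addnA [X in _ + X]addnC.
Qed.

Lemma sumn_map_set_nth (f : block -> nat) i (s : config) b : i < size s ->
  sumn (map f (set_nth dflt s i b)) + f (nth dflt s i) = sumn (map f s) + f b.
Proof. by elim: s i => //= a s IH [|i] hi /=; [lia | have := IH i hi; lia]. Qed.

Lemma ncells_ge c j : size (cells_of c j) <= ncells c.
Proof.
rewrite /cells_of /ncells; elim: c j => [|b c IH] [|j] //=; first exact: leq_addr.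
by apply: leq_trans (IH j) (leq_addl _ _).
Qed.

Section StepInvariants.
Variables (w h : nat) (walls : seq cell).

Definition inb (c : config) : Prop := forall j (p : cell), p \in cells_of c j -> p.1 < w /\ p.2 < h.

(** A relation that composes along a play. Its last clause is conditional on equal numbers of
    blocks, which rules out a merge in between. *)
Definition follows (c c' : config) : Prop :=
  [/\ size c' <= size c, inb c -> inb c', ncells c' = ncells c,
      forall j, j < size c' -> exists2 i, i < size c & kind_of c' j = kind_of c i &
      size c' = size c -> forall j, j < size c ->
        kind_of c' j = kind_of c j /\ rigid (cells_of c j) (cells_of c' j)].

Lemma follows_same c c' : size c' = size c ->
  (forall j, j < size c -> [/\ kind_of c' j = kind_of c j, rigid (cells_of c j) (cells_of c' j) &
     inb c -> forall p : cell, p \in cells_of c' j -> p.1 < w /\ p.2 < h]) -> follows c c'.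
Proof.
move=> hs H; split; first by rewrite hs.
- move=> hb j p; case: (ltnP j (size c)) => hj; last by rewrite /cells_of nth_default ?hs.
  by have [_ _ h3] := H j hj; apply: h3.
- rewrite /ncells; congr sumn; apply: (@eq_from_nth _ 0); first by rewrite !size_map.
  move=> j; rewrite size_map hs => hj; rewrite !(nth_map dflt) ?hs //.
  by have [_ [e _] _] := H j hj; rewrite -/(cells_of c j) -/(cells_of c' j) e.
- by move=> j; rewrite hs => hj; exists j => //; have [] := H j hj.
- by move=> _ j hj; have [] := H j hj.
Qed.

Lemma jstep_follows s s' : jstep w h walls s s' -> follows s.2 s'.2.
Proof.
case=> {s s'} [c c' [i [j [[hij hj _ _] ->]]]|c c' _ [_ [hs hf]]|c _ _|
  c c' [i0 [d [col [hi0 _ hcan hs hm]]]]] /=.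
- have hi := ltn_trans hij hj.
  set b := (kind_of c i, _).
  have hsz : size (set_nth dflt c i b) = size c by rewrite size_set_nth; apply/maxn_idPr.
  have hn l : nth dflt (Defs.drop_nth j (set_nth dflt c i b)) l =
      if l + (j <= l) == i then b else nth dflt c (l + (j <= l)).
    by rewrite nth_drop_nth ?hsz // nth_set_nth /=; case: ifP.
  have hd : size (Defs.drop_nth j (set_nth dflt c i b)) = (size c).-1 by rewrite size_drop_nth hsz.
  (* A merge lowers the number of blocks, so the clause for equal numbers is vacuous. *)
  split; rewrite ?hd; try lia.
  + move=> hb l p; rewrite /cells_of hn; case: eqP => [_|_]; last exact: hb.
    by rewrite mem_cat => /orP []; apply: hb.
  + have h1 := @sumn_map_drop_nth (fun b : block => size b.2) j (set_nth dflt c i b).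
    have h2 := @sumn_map_set_nth (fun b : block => size b.2) i c b hi.
    rewrite hsz in h1; have {}h1 := h1 hj; rewrite nth_set_other // in h1; last by apply/eqP; lia.
    have e : size b.2 = size (nth dflt c i).2 + size (nth dflt c j).2 by rewrite /b size_cat.
    rewrite /ncells; apply/eqP; rewrite -(eqn_add2r (size (nth dflt c j).2)) h1.
    by rewrite -(eqn_add2r (size (nth dflt c i).2)) h2 e -addnA [X in _ + X]addnC.
  + move=> l hl; rewrite /kind_of hn; case: eqP => [_|_]; first by exists i.
    by exists (l + (j <= l)) => //; lia.
- apply: follows_same => // j hj; have [h1 h2] := hf j hj.
  case: (supported_dec walls c j) => hsup.
    rewrite /kind_of /cells_of h1 //; split => //; first exact: rigid_refl.
    by move=> hb p; apply: hb.
  rewrite {1 2}/kind_of /cells_of h2 //; split => //=.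
    by apply: rigid_below => p; apply: unsupported_gt0 hsup.
  by move=> hb p /mapP [q /hb [h3 h4] ->] /=; split => //; lia.
- apply: follows_same => // j hj; split => //; first exact: rigid_refl.
  by move=> hb p; apply: hb.
- apply: follows_same => // j hj; have [h1 h2] := hm j hj.
  case: (moved_dec d j hi0) => hmv; last first.
    rewrite /kind_of /cells_of h2 //; split => //; first exact: rigid_refl.
    by move=> hb p; apply: hb.
  have hc p : p \in cells_of c j -> can_shift w h walls d p.
    by move=> hp; apply: (allP (hcan j hmv)).
  rewrite {1 2}/kind_of /cells_of h1 //; split => //=.
    by apply: rigid_shift => p /hc; rewrite can_shift_free => /and4P [].
  move=> hb p /mapP [q /hc hq ->]; move: hq; rewrite can_shift_free => /and4P [_ h3 h4 _].
  by split => //; case: (d).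
Qed.

Definition trace (n : nat) (f : nat -> gstate) : Prop := forall t, t < n -> jstep w h walls (f t) (f t.+1).

Lemma jreach_trace n s s' : jreach w h walls n s s' -> exists f, [/\ trace n f, f 0 = s & f n = s'].
Proof.
elim=> {n s s'} [s|n s1 s2 s3 hs _ [f [hf h0 hn]]]; first by exists (fun=> s).
exists (fun t => if t is u.+1 then f u else s1); split => //.
by case=> [|t] ht; [rewrite h0 | apply: hf].
Qed.

Lemma trace_jreach n f : trace n f -> jreach w h walls n (f 0) (f n).
Proof.
elim: n f => [|n IH] f hf; first exact: jr0.
apply: jrS (hf 0 isT) _; apply: (IH (fun t => f t.+1)) => t ht; exact: hf.
Qed.

(** The number of blocks never grows, so equal numbers at both ends force equality throughout, and
    rigid motions compose. *)
Lemma trace_follows n f i d : trace n f -> i + d <= n -> follows (f i).2 (f (i + d)).2.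
Proof.
move=> hf; elim: d => [|d IH] hd.
  rewrite addn0; apply: follows_same => // j hj; split => //; first exact: rigid_refl.
  by move=> hb p; apply: hb.
have [a1 a2 a3 a4 a5] := IH ltac:(lia).
rewrite addnS; have [b1 b2 b3 b4 b5] := jstep_follows (hf (i + d) ltac:(lia)).
split; first exact: leq_trans b1 a1.
- by move=> h1; apply/b2/a2.
- by rewrite b3.
- by move=> j /b4 [l /a4 [m hm e2] e1]; exists m => //; rewrite e1.
- move=> e j hj; have e1 : size (f (i + d)).2 = size (f i).2 by lia.
  have [k1 r1] := a5 e1 j hj; have hj1 : j < size (f (i + d)).2 by rewrite e1.
  have [k2 r2] := b5 (etrans e (esym e1)) j hj1.
  by split; [rewrite k2 | apply: rigid_trans r2].
Qed.

(* Blocks only translate between merges, so on a trace a configuration is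
   determined by its number of blocks and their positions. *)
Lemma trace_short N m n s s' : w <= N -> h <= N -> inb s.2 -> size s.2 <= m ->
  jreach w h walls n s s' ->
  exists2 n', n' <= 2 * m.+1 * (N.+1 ^ 2) ^ m & jreach w h walls n' s s'.
Proof.
move=> hw hh hb hm; elim/ltn_ind: n => n IH hr.
case: (leqP n (2 * m.+1 * (N.+1 ^ 2) ^ m)) => hn; first by exists n.
have [f [hf h0 hfn]] := jreach_trace hr.
(* Keys consist of the phase, the number of blocks and the first cell of each block; their number is
   the bound of the lemma. *)
pose K := (bool * 'I_m.+1 * {ffun 'I_m -> 'I_N.+1 * 'I_N.+1})%type.
pose pos (c : config) (j : nat) := nth (0, 0) (cells_of c j) 0.
pose key (t : 'I_n.+1) : K := ((f t).1, inord (size (f t).2),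
   [ffun j : 'I_m => (inord (pos (f t).2 j).1, inord (pos (f t).2 j).2)]).
have hcard : #|{: K}| = 2 * m.+1 * (N.+1 ^ 2) ^ m.
  by rewrite !card_prod card_ffun card_prod card_bool !card_ord mulnn.
(* Pigeonhole: there are [n.+1] times and fewer keys. *)
have hni : ~~ injectiveb key.
  apply/negP => /injectiveP /leq_card; rewrite card_ord hcard; lia.
have {hni} [i [j [hij hkey]]] : exists i j : 'I_n.+1, i < j /\ key i = key j.
  case/injectivePn: hni => i [j hne e]; case: (ltngtP i j) => h1.
  - by exists i, j.
  - by exists j, i.
  - by move: hne; rewrite (val_inj h1) eqxx.
have hj := ltn_ord j; rewrite ltnS in hj.
have hi : i <= n by lia.
have fi := trace_follows (i := 0) (d := i) hf hi; rewrite add0n h0 in fi.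
have fj := trace_follows (i := 0) (d := j) hf hj; rewrite add0n h0 in fj.
have fij := trace_follows (i := i) (d := j - i) hf ltac:(lia).
rewrite subnKC in fij; last by lia.
case: fi => si bi _ _ _; case: fj => sj bj _ _ _; case: fij => _ _ _ _ rij.
case: hkey => e1 e2 e3.
have esz : size (f j).2 = size (f i).2.
  have := congr1 (@nat_of_ord _) e2; rewrite !inordK //; lia.
have eqc : f i = f j.
  rewrite [f i]surjective_pairing [f j]surjective_pairing e1; congr pair.
  apply: (@eq_from_nth block dflt) => // l hl.
  have [hk hrg] := rij esz l hl.
  rewrite !block_eta hk; congr pair; apply: rigid_eq hrg _.
  (* Rigid blocks with the same first cell coincide, so the key gives equality of the blocks. *)
  have hlm : l < m by lia.
  have := congr1 (fun g : {ffun 'I_m -> 'I_N.+1 * 'I_N.+1} => g (Ordinal hlm)) e3.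
  rewrite !ffunE /= => -[] /(congr1 (@nat_of_ord _)) q1 /(congr1 (@nat_of_ord _)) q2; move: q1 q2.
  have hp c : inb c -> (pos c l).1 <= N /\ (pos c l).2 <= N.
    move=> hc; rewrite /pos; case e : (cells_of c l) => [|p ps] //=.
    by have := hc l p; rewrite e inE eqxx => /(_ isT); lia.
  have [p1 p2] := hp _ (bi hb); have [p3 p4] := hp _ (bj hb).
  rewrite !inordK // => q1 q2.
  by rewrite -/(pos _ _) -/(pos (f j).2 _) [LHS]surjective_pairing [RHS]surjective_pairing q1 q2.
(* The part of the trace between the two equal states is cut out. *)
apply: (IH (i + (n - j))); first by lia.
have r1 : jreach w h walls i s (f i).
  rewrite -h0; apply: trace_jreach => t ht; apply: hf; lia.
apply: jreach_trans r1 _; rewrite eqc -hfn.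
have := @trace_jreach (n - j) (fun t => f (j + t)); rewrite addn0 subnKC //; apply.
by move=> t ht; rewrite addnS; apply: hf; lia.
Qed.
End StepInvariants.

(** * Soundness *)

Definition levelw W : level := Level (zw W) (zh W) (wcells W) (conf W 0).

Lemma all_flatten (T : Type) (P : pred T) ss : all P (flatten ss) = all (all P) ss.
Proof. by elim: ss => //= s ss IH; rewrite all_cat IH. Qed.

Lemma boundbE W : boundb W =
  all (fun p : cell => (p.1 < zw W) && (p.2 < zh W)) (all_cells (levelw W)).
Proof.
rewrite /boundb /all_cells all_cat /= all_pairseq; congr (_ && _).
rewrite all_flatten /conf /mkseq -map_comp all_map; apply: eq_all => j /=.
by rewrite all_pairseq.
Qed.

Lemma uniq_mapP (T1 T2 : eqType) (f : T1 -> T2) s : uniq s ->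
  uniq (map f s) <-> {in s &, injective f}.
Proof.
move=> us; split; last by move=> h; rewrite map_inj_in_uniq.
elim: s us => //= a s IH /andP [ha us] /andP [hfa ufs] x y.
rewrite !inE => /orP [/eqP ->|hx] /orP [/eqP ->|hy] // e; last exact: IH.
  by case/mapP: hfa; exists y.
by case/mapP: hfa; exists x.
Qed.

Lemma uniqbP W : uniqb W <-> uniq (all_cells (levelw W)).
Proof.
(* The cells of all blocks are indexed by pairs of a block and a cell number, so that distinctness
   becomes injectivity on these pairs. *)
pose dom := [seq (j, q) | j <- iota 0 (nbl W 0), q <- iota 0 (len W 0 j)].
pose g (jq : nat * nat) : cell := (cx W 0 jq.1 jq.2, cy W 0 jq.1 jq.2).
have domP j q : ((j, q) \in dom) = (j < nbl W 0) && (q < len W 0 j).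
  apply/allpairsPdep/andP => [[j' [q' [h1 h2 [-> ->]]]]|[h1 h2]].
    by move: h1 h2; rewrite !mem_iota.
  by exists j, q; rewrite !mem_iota.
have udom : uniq dom.
  apply: allpairs_uniq_dep; first exact: iota_uniq.
    by move=> j _; apply: iota_uniq.
  by move=> [a b] [c d] _ _ /= [-> ->].
have -> : all_cells (levelw W) = wcells W ++ map g dom.
  rewrite /all_cells /=; congr cat; rewrite /dom map_flatten -map_comp.
  rewrite /conf /mkseq -map_comp; congr flatten; apply: eq_map => j /=.
  by rewrite -map_comp.
have hw : all (fun q => all (fun q' => ~~ ((wx W q == wx W q') && (wy W q == wy W q'))) (iota 0 q))
    (iota 0 (znw W)) <-> uniq (wcells W).
  rewrite /wcells /pairseq /mkseq uniq_mapP ?iota_uniq //; split.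
    move=> /all_iotaP h q q'; rewrite !mem_iota /= => hq hq' [e1 e2].
    case: (ltngtP q q') => // hlt; [have /all_iotaP /(_ q hlt) := h q' hq'|have /all_iotaP /(_ q' hlt) := h q hq];
      by rewrite e1 e2 !eqxx.
  move=> h; apply/all_iotaP => q hq; apply/all_iotaP => q' hq'.
  apply/negP => /andP [/eqP e1 /eqP e2].
  have := h q q'; rewrite !mem_iota /= e1 e2 hq (ltn_trans hq' hq) => /(_ isT isT erefl).
  by move=> e; rewrite e ltnn in hq'.
rewrite cat_uniq /uniqb; split.
  move=> /and3P [/hw -> /all_iotaP h1 /all_iotaP h2] /=; apply/andP; split.
    apply/hasPn => p /mapP [[j q]]; rewrite domP => /andP [hj hq] ->.
    by have /all_iotaP /(_ q hq) := h1 j hj; rewrite inwallE.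
  apply/(uniq_mapP g udom) => [[j q] [j' q']]; rewrite !domP => /andP [hj hq] /andP [hj' hq'] [e1 e2].
  have /all_iotaP /(_ q hq) /all_iotaP /(_ j' hj') /all_iotaP /(_ q' hq') := h2 j hj.
  by rewrite e1 e2 !eqxx => /andP [/eqP -> /eqP ->].
move=> /and3P [h1 /hasPn h2 /(uniq_mapP g udom) h3]; apply/and3P; split; first exact/hw.
  apply/all_iotaP => j hj; apply/all_iotaP => q hq; rewrite inwallE.
  by apply: h2; apply/mapP; exists (j, q); rewrite ?domP ?hj.
apply/all_iotaP => j hj; apply/all_iotaP => q hq; apply/all_iotaP => j' hj'; apply/all_iotaP => q' hq'.
apply/implyP => /andP [/eqP e1 /eqP e2].
have := h3 (j, q) (j', q'); rewrite !domP hj hj' hq hq' /g /= e1 e2 => /(_ isT isT erefl) [-> ->].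
by rewrite !eqxx.
Qed.

Lemma adj4C p q : adj4 p q = adj4 q p.
Proof.
by rewrite /adj4 [p.1 == q.1]eq_sym [p.2 == q.2]eq_sym; congr (_ && _ || _ && _); rewrite orbC.
Qed.

(** Induction on the rank joins every cell to cell 0 by paths in both directions; any two cells are
    then connected through cell 0. *)
Lemma connb_sound W j : connb W -> j < nbl W 0 ->
  cells_of (conf W 0) j != [::] /\ connected_cells (cells_of (conf W 0) j).
Proof.
move=> /all_iotaP h hj; have /andP [h0 /all_iotaP {}h] := h j hj.
rewrite cells_conf //; set s := pairseq _ _ _.
have hs : size s = len W 0 j by rewrite size_mkseq.
split; first by rewrite -size_eq0 hs -lt0n.
pose g q : cell := (cx W 0 j q, cy W 0 j q).
pose R a b := exists p : seq cell, [/\ path adj4 a p, last a p = b & all (mem s) p].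
have Rt a b c : R a b -> R b c -> R a c.
  move=> [p [h1 h2 h3]] [q [h4 h5 h6]]; exists (p ++ q).
  by rewrite cat_path last_cat all_cat h1 h2 h3 h4 h5 h6.
have R1 a b : adj4 a b -> b \in s -> R a b by move=> ha hb; exists [:: b]; rewrite /= ha hb.
have gs q : q < len W 0 j -> g q \in s by move=> hq; apply/mapP; exists q; rewrite ?mem_iota.
have H q : q < len W 0 j -> R (g 0) (g q) /\ R (g q) (g 0).
  elim/ltn_ind: {q}(crk W j q) {-2}q (erefl (crk W j q)) => m IH q em hq.
  case: (posnP q) => [->|q0]; first by split; exists [::].
  have := h q hq; rewrite gtn_eqF //= => /has_iotaP [q' hq' /andP [hr ha]].
  have [|r1 r2] := IH (crk W j q') _ q' erefl hq'; first by rewrite -em.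
  have had : adj4 (g q') (g q) by exact: ha.
  by split; [apply: Rt r1 (R1 _ _ had (gs q hq)) | apply: Rt (R1 _ _ _ (gs q' hq')) r2; rewrite adj4C].
move=> a b /mapP [q]; rewrite mem_iota => hq -> /mapP [q']; rewrite mem_iota => hq' ->.
by apply: Rt (H q hq).2 (H q' hq').1.
Qed.

Lemma wf_sound W : boundb W -> uniqb W -> connb W -> wf_level (levelw W).
Proof.
move=> hb hu hc; split; first by rewrite -boundbE.
  exact/uniqbP.
move=> b /(nthP dflt) [j]; rewrite size_conf => hj <-.
exact: connb_sound hc hj.
Qed.

(** * A checked input is the code of the level *)

Section ParseSound.
Variables (x y : seq bool).
Let W := word x y.

Lemma unary_sound p n : p <= size x -> all (fun q => sym W 2 (p + q)) (iota 0 n) -> sym W 1 (p + n) ->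
  p + n < size x /\ take (p + n).+1 x = take p x ++ enc_unary n.
Proof.
move=> hp /all_iotaP h2 h1.
(* The separator is neither bit, so the run cannot leave the input. *)
have hlt : p + n < size x.
  rewrite ltnNge; apply/negP => hle; case: (leqP n (size x - p)) => hn.
    by move: h1; rewrite (_ : p + n = size x) ?sym3_word //; lia.
  by have := h2 _ hn; rewrite subnKC // sym3_word.
split => //; apply: (@eq_from_nth _ false).
  by rewrite size_cat /enc_unary size_cat size_nseq /= !size_take_min; lia.
move=> i; rewrite size_take_min => hi; rewrite nth_take; last by lia.
rewrite nth_cat size_take_min (_ : minn p (size x) = p); last by lia.
case: ltnP => hpi; first by rewrite nth_take.
rewrite /enc_unary nth_cat size_nseq nth_nseq; case: ltnP => hin.
  have := h2 _ hin; rewrite subnKC // sym2_word //; lia.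
have ei : i = p + n by lia.
rewrite ei addKn subnn /=; apply/negbTE; move: h1; rewrite sym1_word //; lia.
Qed.

Lemma cellat_sound p a b p' : cellat W p a b p' ->
  p <= p' <= size x /\ take p' x = take p x ++ enc_cell (a, b).
Proof.
move=> /has_iotaP [p0 _ /andP [/natat_sound [h1 e1] /natat_sound [h2 e2]]].
by split; [lia | rewrite e2 e1 -catA].
Qed.

Lemma cells_sound (P f g : nat -> nat) n : (forall q, q < n -> cellat W (P q) (f q) (g q) (P q.+1)) ->
  take (P n) x = take (P 0) x ++ flatten (map enc_cell (pairseq f g n)).
Proof.
elim: n => [|n IH] h; first by rewrite cats0.
have [_ ->] := cellat_sound (h n (ltnSn n)).
rewrite IH; last by move=> q hq; apply: h; lia.
by rewrite /pairseq /mkseq -[n.+1]addn1 iotaD !map_cat flatten_cat /= cats0 -catA.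
Qed.

Lemma kindcode_sound j p' : kindcode W j p' -> p' <= size x ->
  kcan W (knd W 0 j) /\ take p' x = take (pb W j) x ++ enc_kind (kd W (knd W 0 j)).
Proof.
have h1 (b : bool) : pb W j < size x -> sym W (if b then 2 else 1) (pb W j) ->
    take (pb W j).+1 x = take (pb W j) x ++ [:: b].
  move=> hlt hb; rewrite (take_nth false) // -cats1; congr (_ ++ [:: _]).
  by case: b hb; [rewrite sym2_word|rewrite sym1_word // => /negbTE].
case/orP => [/and3P [hs /eqP -> /eqP ->] hp|/and5P [hs hk hsame hcode /has_iotaP [p'' _ hcode']] _].
  by split; [left | rewrite (h1 false)].
have [h2 h3 ->] := codeat_sound hcode; have [_ h4 _] := codeat_sound hcode'.
rewrite (h1 true) //; last by lia.
split; first by right.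
move: hsame; rewrite samecolE // => /eqP <-.
by rewrite -catA; case: (knd W 0 j) hk.
Qed.

Lemma blockat_sound j : blockat W j -> j < nbl W 0 ->
  kcan W (knd W 0 j) /\ take (pb W j.+1) x = take (pb W j) x ++ enc_block (nth dflt (conf W 0) j).
Proof.
move=> /andP [/has_iotaP [p' hp' /andP [hk hn]] /andP [/all_iotaP hc /eqP he]] hj.
rewrite ltnS lenx_word in hp'.
have [h1 h2] := kindcode_sound hk hp'; split => //.
rewrite -he (cells_sound hc); have [_ ->] := natat_sound hn; rewrite h2 nth_conf //.
by rewrite /enc_block /enc_list /= size_mkseq -!catA.
Qed.

Lemma parse_sound : parseb W -> enc_level (levelw W) = x /\ forall l, l < nbl W 0 -> kcan W (knd W 0 l).
Proof.
rewrite /parseb => /andP [h1 /and5P [h2 h3 h4 h5 /and4P [/all_iotaP h6 h7 /all_iotaP h8 /eqP h9]]].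
split; last by move=> l hl; have [] := blockat_sound (h8 l hl) hl.
have [hw ew] := @unary_sound 0 (zw W) (leq0n _) h1 h2.
have [hh eh] := unary_sound hw h3 h4.
have [_ en] := natat_sound h5; have [_ eb] := natat_sound h7.
have hbl n : n <= nbl W 0 -> take (pb W n) x = take (pb W 0) x ++ flatten (map enc_block (take n (conf W 0))).
  elim: n => [|n IH] hn; first by rewrite take0 cats0.
  have [_ ->] := blockat_sound (h8 n hn) hn; rewrite IH ?(ltnW hn) //.
  by rewrite (take_nth dflt) ?size_conf // map_rcons flatten_rcons -catA.
have := hbl _ (leqnn _); rewrite h9 lenx_word take_size => ->.
rewrite eb (cells_sound h6) en eh ew take0 /enc_level /enc_list /= size_mkseq size_conf.
by rewrite take_oversize ?size_conf // -!catA.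
Qed.
End ParseSound.

Lemma verify_sound k x y : verify k (word x y) -> JellyK k x.
Proof.
move=> /and5P [hp hb hu hc /and5P [hk /eqP h0 /eqP h1 hs /all_iotaP hst]].
have [ex hcan] := parse_sound hp.
exists (levelw (word x y)); split => //; first exact: wf_sound.
  by rewrite size_conf.
have [|hr hcanT] := trace_sound (n := ztime (word x y)) hcan.
  by move=> u /andP [_ hu']; apply: hst; rewrite add0n in hu'.
rewrite add0n in hr hcanT.
apply/solvableE; exists (ztime (word x y)), (conf (word x y) (ztime (word x y))).
rewrite h0 h1 in hr; split => //.
exact/(solvedb_conf hcanT).
Qed.

(** * Completeness *)

(** Choice over an initial segment follows by induction; it collects the ranks of all steps into one
    function. *)
Lemma fin_choice (T : Type) (d : T) n (P : nat -> T -> Prop) : (forall i, i < n -> exists r, P i r) ->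
  exists R, forall i, i < n -> P i (R i).
Proof.
elim: n => [|n IH] h; first by exists (fun=> d).
have [R hR] := IH (fun i hi => h i (ltnW hi)).
have [r hr] := h n (ltnSn n).
exists (fun i => if i == n then r else R i) => i hi.
by case: eqP => [->|ne] //; apply: hR; lia.
Qed.

Lemma flatten_split (T : Type) (f : T -> seq bool) d s j : j < size s ->
  flatten (map f s) = flatten (map f (take j s)) ++ f (nth d s j) ++ flatten (map f (drop j.+1 s)).
Proof.
by move=> h; rewrite -[in LHS](cat_take_drop j s) (drop_nth d h) map_cat flatten_cat.
Qed.

Lemma size_flatten_take (T : Type) (f : T -> seq bool) d s j : j < size s ->
  size (flatten (map f (take j.+1 s))) = size (flatten (map f (take j s))) + size (f (nth d s j)).
Proof. by move=> h; rewrite (take_nth d) // map_rcons flatten_rcons size_cat. Qed.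

Lemma size_flatten_ge (T : Type) (f : T -> seq bool) c s : (forall a, c <= size (f a)) ->
  c * size s <= size (flatten (map f s)).
Proof. by move=> h; elim: s => [|a s IH] /=; [rewrite muln0 | rewrite size_cat; have := h a; lia]. Qed.

(** The rank is that of the closure of cell 0 under adjacency, which is everything by connectedness.
    Distinctness lets a cell stand for its index. *)
Lemma connected_rank (s : seq cell) : uniq s -> connected_cells s ->
  exists r, (forall q, r q <= size s) /\ forall q, q < size s -> q = 0 \/
    exists2 q', q' < size s & r q' < r q /\ adj4 (nth (0, 0) s q') (nth (0, 0) s q).
Proof.
move=> us hc; pose E i j := adj4 (nth (0, 0) s i) (nth (0, 0) s j).
have [r [hr hcl]] := closb_complete (size s) (fun q => q == 0) E.
exists r; split => // q hq.
have s0 : 0 < size s by apply: leq_ltn_trans hq.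
have H p i : i < size s -> clo (size s) (fun q => q == 0) E i -> path adj4 (nth (0, 0) s i) p ->
   all (mem s) p -> forall l, l < size s -> nth (0, 0) s l = last (nth (0, 0) s i) p ->
   clo (size s) (fun q => q == 0) E l.
  elim: p i => [|a p IH] i hi ci /=.
    by move=> _ _ l hl /eqP; rewrite nth_uniq // => /eqP ->.
  move=> /andP [ha hp] /andP [hs hall] l hl hlast.
  have hia : index a s < size s by rewrite index_mem.
  have en : nth (0, 0) s (index a s) = a by rewrite nth_index.
  apply: (IH (index a s)); rewrite ?en //.
  by apply: clo_step ci hia _; rewrite /E en.
have [p [h1 h2 h3]] := hc _ _ (mem_nth (0, 0) s0) (mem_nth (0, 0) hq).
have /(closb_sound hcl hq) h0 : clo (size s) (fun q => q == 0) E q.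
  by apply: (H p 0) => //; apply: clo_base.
have := hcl; move=> /all_iotaP /(_ q hq) /and3P [_ _ /implyP /(_ h0) /orP [/eqP ->|]]; first by left.
by move=> /has_iotaP [i hi /and3P [_ h4 h5]]; right; exists i.
Qed.

(** * Tokens pass the checks at their true positions *)

Section ParseComplete.
Variables (x y : seq bool).
Let W := word x y.

Lemma nat_complete_at p n p' A C : x = A ++ enc_nat n ++ C -> p = size A ->
  p' = p + size (enc_nat n) -> natat W p n p'.
Proof.
move=> ex -> ->; apply: (@nat_complete x y (size A) n C).
by rewrite ex drop_size_cat.
Qed.

Lemma cell_complete p a b p' A C : x = A ++ enc_cell (a, b) ++ C -> p = size A ->
  p' = p + size (enc_cell (a, b)) -> cellat W p a b p'.
Proof.
rewrite /enc_cell /= => ex -> ->; apply/has_iotaP; exists (size A + size (enc_nat a)).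
  by rewrite lenx_word ex !size_cat; lia.
apply/andP; split.
  by apply: (@nat_complete_at _ _ _ A (enc_nat b ++ C)) => //; rewrite ex -catA.
apply: (@nat_complete_at _ _ _ (A ++ enc_nat a) C); rewrite ?size_cat //; last by lia.
by rewrite ex -!catA.
Qed.

Lemma cells_complete (P f g : nat -> nat) (s : seq cell) A C :
  x = A ++ flatten (map enc_cell s) ++ C ->
  (forall q, q <= size s -> P q = size A + size (flatten (map enc_cell (take q s)))) ->
  (forall q, q < size s -> (f q, g q) = nth (0, 0) s q) ->
  forall q, q < size s -> cellat W (P q) (f q) (g q) (P q.+1).
Proof.
move=> ex hP hfg q hq.
have es := flatten_split enc_cell (0, 0) hq.
apply: (@cell_complete _ _ _ _ (A ++ flatten (map enc_cell (take q s)))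
   (flatten (map enc_cell (drop q.+1 s)) ++ C)).
- by rewrite hfg // ex es -!catA.
- by rewrite size_cat; apply: hP; apply: ltnW.
- by rewrite !hP ?(ltnW hq) // (size_flatten_take _ (0, 0)) // hfg // addnA.
Qed.

Lemma unary_complete p n A C : x = A ++ enc_unary n ++ C -> p = size A ->
  all (fun q => sym W 2 (p + q)) (iota 0 n) /\ sym W 1 (p + n).
Proof.
move=> ex ->; have hs : size A + n < size x.
  by rewrite ex /enc_unary !size_cat size_nseq /=; lia.
have hn j : nth false x (size A + j) = nth false (enc_unary n ++ C) j.
  by rewrite ex nth_cat ltnNge leq_addr /= addKn.
split; last by rewrite sym1_word // hn /enc_unary -catA nth_cat size_nseq ltnn subnn.
apply/all_iotaP => q hq; rewrite sym2_word; last by lia.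
by rewrite hn /enc_unary -catA nth_cat size_nseq hq nth_nseq hq.
Qed.
End ParseComplete.

Section Complete.
Variables (L : level) (k : nat).
Hypothesis wfL : wf_level L.
Hypothesis kL : size (lblocks L) <= k.
Let x := enc_level L.
Let N := size x.
Let walls := lwalls L.
Let blocks := lblocks L.

(** Prefixes of the input, and from them the true token positions that the certificate will
    claim. *)
Let pre_w := enc_unary (lw L) ++ enc_unary (lh L) ++ enc_nat (size walls).
Let pre_b := pre_w ++ flatten (map enc_cell walls) ++ enc_nat (size blocks).
Let pwpos q := size pre_w + size (flatten (map enc_cell (take q walls))).
Let pbpos j := size pre_b + size (flatten (map enc_block (take j blocks))).
Let blk j : block := nth dflt blocks j.
Let pcpos j q := pbpos j + size (enc_kind (blk j).1) + size (enc_nat (size (blk j).2)) +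
  size (flatten (map enc_cell (take q (blk j).2))).
(** A colour is named by its code in the first block that carries it; the successor skips the
    leading [true] of [enc_kind]. *)
Let kid (c : option nat) := if c is None then 0 else (pbpos (find (fun b : block => b.1 == c) blocks)).+1.

Lemma xE : x = pre_b ++ flatten (map enc_block blocks).
Proof. by rewrite /x /enc_level /enc_list /pre_b /pre_w -!catA. Qed.

Lemma xE_block j : j < size blocks -> x = (pre_b ++ flatten (map enc_block (take j blocks))) ++
  enc_block (blk j) ++ flatten (map enc_block (drop j.+1 blocks)).
Proof. by move=> hj; rewrite xE (flatten_split _ dflt hj) -!catA. Qed.

Lemma pbposS j : j < size blocks -> pbpos j.+1 = pbpos j + size (enc_block (blk j)).
Proof. by move=> hj; rewrite /pbpos (size_flatten_take _ dflt) // addnA. Qed.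

Lemma pbpos_le j : pbpos j <= N.
Proof.
rewrite /pbpos /N xE size_cat leq_add2l.
rewrite -{2}(cat_take_drop j blocks) map_cat flatten_cat size_cat; exact: leq_addr.
Qed.

Lemma pwpos_le q : pwpos q <= N.
Proof.
rewrite /pwpos /N xE /pre_b !size_cat.
have : size (flatten (map enc_cell (take q walls))) <= size (flatten (map enc_cell walls)).
  by rewrite -{2}(cat_take_drop q walls) map_cat flatten_cat size_cat; exact: leq_addr.
lia.
Qed.

Lemma pcpos_end j : pcpos j (size (blk j).2) = pbpos j + size (enc_block (blk j)).
Proof. by rewrite /pcpos take_size /enc_block /enc_list !size_cat !addnA. Qed.

Lemma pcpos_le j q : j < size blocks -> pcpos j q <= N.
Proof.
move=> hj; apply: leq_trans (pbpos_le j.+1); rewrite pbposS // -pcpos_end.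
rewrite /pcpos leq_add2l take_size.
by rewrite -{2}(cat_take_drop q (blk j).2) map_cat flatten_cat size_cat; exact: leq_addr.
Qed.

Lemma dims_le : lw L <= N /\ lh L <= N.
Proof. by rewrite /N xE /pre_b /pre_w /enc_unary !size_cat !size_nseq /=; lia. Qed.

Lemma nwalls_le : size walls <= N.
Proof.
have := @size_flatten_ge _ enc_cell 1 walls _.
rewrite mul1n => /(_ _) h; apply: leq_trans (h _) _.
  by move=> a; rewrite /enc_cell size_cat size_enc_nat; lia.
by rewrite /N xE /pre_b !size_cat; lia.
Qed.

Lemma enc_block_ge b : (size b.2).+1 <= size (enc_block b).
Proof.
rewrite /enc_block /enc_list size_cat size_cat.
have : 1 * size b.2 <= size (flatten (map enc_cell b.2)).
  by apply: size_flatten_ge => a; rewrite /enc_cell size_cat size_enc_nat; lia.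
by rewrite mul1n size_enc_nat; lia.
Qed.

Lemma nblocks_ncells_le : size blocks + ncells blocks <= N.
Proof.
rewrite /N xE size_cat; apply: leq_trans (leq_addl _ _).
rewrite /ncells; elim: blocks => //= b s IH; rewrite size_cat.
by have := enc_block_ge b; lia.
Qed.

Lemma colour_pos j : j < size blocks -> (blk j).1 <> None ->
  exists col post, [/\ (blk j).1 = Some col, drop (pbpos j).+1 x = enc_nat col ++ post &
    nth false x (pbpos j) = true /\ pbpos j < N].
Proof.
move=> hj hk; case e : (blk j).1 hk => [col|] // _; exists col.
have ex := xE_block hj; set A := pre_b ++ _ in ex.
have sA : size A = pbpos j by rewrite /A size_cat.
clearbody A.
move: ex; rewrite /enc_block e /= => ex.
eexists; split => //.
  by rewrite -sA ex -addn1 addnC -drop_drop drop_size_cat //= -?catA /= drop0 -?catA.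
by rewrite -sA /N ex nth_cat ltnn subnn size_cat /=; split => //; lia.
Qed.

Lemma kid_find col : Some col \in map fst blocks ->
  let j := find (fun b : block => b.1 == Some col) blocks in j < size blocks /\ (blk j).1 = Some col.
Proof.
move=> h; have hh : has (fun b : block => b.1 == Some col) blocks.
  by case/mapP: h => b hb ->; apply/hasP; exists b.
by rewrite /= -has_find hh; split => //; apply/eqP; apply: (nth_find dflt hh).
Qed.

Lemma kid_le c : kid c <= N.+1.
Proof. by case: c => [col|] //=; rewrite ltnS pbpos_le. Qed.

Lemma kid_good y c : c \in map fst blocks -> kgood (word x y) kid c.
Proof.
case: c => [col|] h; last by split => //; left.
have [hj e] := kid_find h; set j := find _ _ in hj e.
have [|col' [post [e1 e2 _]]] := colour_pos hj; first by rewrite e.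
have [h1 h2 _] := code_complete y e2.
have ecol : col' = col by move: e1; rewrite e => -[].
rewrite /kgood /kid -/j; split; last by right; rewrite /kval h2 valb_bin.
by rewrite /kd /kval h2 valb_bin ecol.
Qed.

(** * Acceptance of a certificate with the intended entries *)

Section WithArray.
Variables (y : seq bool) (T : nat) (f : nat -> gstate) (r : nat -> nat -> nat) (cr : nat -> nat -> nat).
Let W := word x y.
Hypothesis f0 : f 0 = (false, blocks).
Hypothesis ftr : trace (lw L) (lh L) walls T f.
Hypothesis fT : (f T).1 = true /\ solved (f T).2.

Hypothesis Hst : forall t, t <= T -> repstate W kid t (f t).
Hypothesis Hrk : forall t j, t < T -> j < size (f t).2 -> rk W t j = r t j.
Hypothesis Hr : forall t, t < T -> forall W' kid' t', zw W' = lw L -> zh W' = lh L -> wcells W' = walls ->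
    repstate W' kid' t' (f t) -> repstate W' kid' t'.+1 (f t.+1) ->
    (forall j, j < size (f t).2 -> kgood W' kid' (kind_of (f t).2 j)) ->
    (forall j, j < size (f t).2 -> rk W' t' j = r t j) -> stepb W' t'.
Hypothesis Hcr : forall j, j < size blocks -> forall q, q < size (blk j).2 -> q = 0 \/
    exists2 q', q' < size (blk j).2 &
      cr j q' < cr j q /\ adj4 (nth (0, 0) (blk j).2 q') (nth (0, 0) (blk j).2 q).
Hypothesis Hw : zw W = lw L.
Hypothesis Hh : zh W = lh L.
Hypothesis Hnw : znw W = size walls.
Hypothesis HT : ztime W = T.
Hypothesis Hwc : forall q, q < size walls -> (wx W q, wy W q) = nth (0, 0) walls q.
Hypothesis Hpw : forall q, q <= size walls -> pw W q = pwpos q.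
Hypothesis Hpb : forall j, j <= size blocks -> pb W j = pbpos j.
Hypothesis Hpc : forall j q, j < size blocks -> q <= size (blk j).2 -> pc W j q = pcpos j q.
Hypothesis Hcrk : forall j q, j < size blocks -> q < size (blk j).2 -> crk W j q = cr j q.

Lemma wcellsE : wcells W = walls.
Proof.
rewrite /wcells Hnw; apply: (@eq_from_nth _ (0, 0)); first by rewrite size_mkseq.
by move=> q; rewrite size_mkseq => hq; rewrite nth_mkseq // Hwc.
Qed.

(** No step creates a kind, so the names of the kinds of the initial blocks serve at all times. *)
Lemma trace_kinds t j : t <= T -> j < size (f t).2 -> kgood W kid (kind_of (f t).2 j).
Proof.
move=> ht hj; have := trace_follows (i := 0) (d := t) ftr ht; rewrite add0n f0.
case=> _ _ _ /(_ j hj) [i hi ->] _; apply: kid_good.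
by apply: map_f; apply: mem_nth.
Qed.

Lemma conf_trace t : t <= T -> conf W t = (f t).2.
Proof. by move=> ht; apply: repstate_conf (Hst ht) _ => j; apply: trace_kinds. Qed.

Lemma levelwE : levelw W = L.
Proof.
rewrite /levelw Hw Hh wcellsE conf_trace // f0 /blocks /walls.
by case: (L).
Qed.

Lemma start_block j : j < size blocks -> repblk W kid 0 j (blk j).
Proof. by move=> hj; have [_ _] := Hst (leq0n T); rewrite f0; apply. Qed.

Lemma nblE : nbl W 0 = size blocks.
Proof. by have [-> _ _] := Hst (leq0n T); rewrite f0. Qed.

Lemma parse_complete : parseb W.
Proof.
have ex1 : x = [::] ++ enc_unary (lw L) ++ (enc_unary (lh L) ++ enc_nat (size walls) ++
    flatten (map enc_cell walls) ++ enc_nat (size blocks) ++ flatten (map enc_block blocks)).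
  by rewrite xE /pre_b /pre_w -!catA.
have su n : size (enc_unary n) = n.+1 by rewrite /enc_unary size_cat size_nseq addn1.
have [u1 u2] := unary_complete y ex1 erefl.
have ex2 : x = enc_unary (lw L) ++ enc_unary (lh L) ++ (enc_nat (size walls) ++
    flatten (map enc_cell walls) ++ enc_nat (size blocks) ++ flatten (map enc_block blocks)).
  by rewrite ex1.
have [v1 v2] := unary_complete y ex2 erefl; rewrite su in v1 v2.
rewrite /parseb Hw Hh Hnw nblE; apply/andP; split; first by rewrite -(eq_all (a1 := fun q => sym W 2 (0 + q))).
apply/and5P; split => //.
  apply: (@nat_complete_at x y _ _ _ (enc_unary (lw L) ++ enc_unary (lh L))
    (flatten (map enc_cell walls) ++ enc_nat (size blocks) ++ flatten (map enc_block blocks))).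
  - by rewrite ex2 -!catA.
  - by rewrite size_cat !su; lia.
  - by rewrite Hpw // /pwpos take0 /pre_w 2!size_cat !su /=; lia.
apply/and4P; split.
- apply/all_iotaP; apply: (@cells_complete x y _ _ _ walls pre_w
     (enc_nat (size blocks) ++ flatten (map enc_block blocks))) => //.
  by rewrite xE /pre_b -!catA.
- apply: (@nat_complete_at x y _ _ _ (pre_w ++ flatten (map enc_cell walls)) (flatten (map enc_block blocks))).
  + by rewrite xE /pre_b -!catA.
  + by rewrite Hpw // /pwpos take_size size_cat.
  + by rewrite Hpb // Hpw // /pbpos /pwpos take0 take_size /pre_b !size_cat /=; lia.
- apply/all_iotaP => j hj.
  have [k1 l1 c1] := start_block hj.
  have ex := xE_block hj; set A := pre_b ++ _ in ex.
  have sA : size A = pbpos j by rewrite /A size_cat.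
  clearbody A.
  set C := flatten _ in ex; rewrite /enc_block /enc_list in ex.
  apply/andP; split; last (apply/andP; split).
  + apply/has_iotaP; exists (pbpos j + size (enc_kind (blk j).1)).
      rewrite ltnS lenx_word ex !size_cat sA; lia.
    apply/andP; split; last first.
      apply: (@nat_complete_at x y _ _ _ (A ++ enc_kind (blk j).1) (flatten (map enc_cell (blk j).2) ++ C)).
      * by rewrite l1 ex -!catA.
      * by rewrite size_cat sA.
      * by rewrite Hpc // /pcpos take0 /= addn0 l1.
    have hbk : kgood W kid (blk j).1 by apply: kid_good; apply: map_f; apply: mem_nth.
    rewrite /kindcode Hpb ?(ltnW hj) // k1.
    case e : (blk j).1 hbk => [col|] hbk; last first.
      apply/orP; left; rewrite /= addn1 !eqxx !andbT.
      have hlt : pbpos j < size x by rewrite -sA ex e !size_cat /=; lia.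
      by rewrite sym1_word // -sA ex e nth_cat ltnn subnn.
    apply/orP; right.
    have [|col' [post [e1 e2 [e3 e4]]]] := colour_pos hj; first by rewrite e.
    have ecol : col' = col by move: e1; rewrite e => -[].
    rewrite ecol in e2; have [h1 h2 h3] := code_complete y e2.
    have hm : Some col \in map fst blocks by rewrite -e; apply: map_f; apply: mem_nth.
    have [hj' e'] := kid_find hm; set j' := find _ _ in hj' e'.
    have [|col2 [post2 [e5 e6 _]]] := colour_pos hj'; first by rewrite e'.
    have ecol2 : col2 = col by move: e5; rewrite e' => -[].
    rewrite ecol2 in e6; have [g1 g2 g3] := code_complete y e6.
    apply/and5P; split.
    * by rewrite sym2_word.
    * by [].
    * by rewrite /kid -/j' samecolE ?g2 ?h2 ?valb_bin.
    * by rewrite /= -addSnnS.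
    * rewrite /kid -/j'; apply/has_iotaP; exists ((pbpos j').+1 + size (enc_nat col)) => //.
      by have /and5P [_ _ _ hle _] := g3; rewrite ltnS; exact: hle.
  + apply/all_iotaP; rewrite l1.
    apply: (@cells_complete x y (pc W j) (cx W 0 j) (cy W 0 j) (blk j).2
       (A ++ enc_kind (blk j).1 ++ enc_nat (size (blk j).2)) C).
    * by rewrite ex -!catA.
    * by move=> q hq; rewrite Hpc // /pcpos !size_cat sA !addnA.
    * exact: c1.
  + by rewrite l1 Hpc // Hpb // pbposS // pcpos_end.
- by rewrite Hpb // lenx_word /pbpos take_size xE size_cat.
Qed.

Lemma verify_complete : verify k W.
Proof.
have [wf1 wf2 wf3] := wfL.
have hfT : T <= T by [].
have hcanT l : l < nbl W T -> kcan W (knd W T l).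
  by apply: repstate_can (Hst hfT) _ l => j; apply: trace_kinds.
apply/and5P; split.
- exact: parse_complete.
- by rewrite boundbE levelwE Hw Hh.
- by apply/uniqbP; rewrite levelwE.
- apply/all_iotaP => j; rewrite nblE => hj; have [_ l1 _] := start_block hj.
  have hb : blk j \in blocks by apply: mem_nth.
  have [hne _] := wf3 _ hb; rewrite l1; apply/andP; split.
    by rewrite lt0n size_eq0.
  apply/all_iotaP => q hq; apply/orP; have [->|[q' hq' [h1 h2]]] := Hcr hj hq; first by left.
  right; apply/has_iotaP; exists q' => //; rewrite !Hcrk // h1 /=.
  have [-> ->] := repblk_xy (start_block hj) hq; have [-> ->] := repblk_xy (start_block hj) hq'.
  exact: h2.
- apply/and5P; split.
  + by rewrite nblE.
  + by have [_ -> _] := Hst (leq0n T); rewrite f0.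
  + by rewrite HT; have [_ -> _] := Hst hfT; rewrite fT.1.
  + by rewrite HT; apply/(solvedb_conf hcanT); rewrite conf_trace //; have [] := fT.
  + apply/all_iotaP => t; rewrite HT => ht; apply: (Hr ht (kid' := kid)) => //.
    * exact: wcellsE.
    * by apply: Hst; apply: ltnW.
    * exact: Hst.
    * by move=> j; apply: trace_kinds; apply: ltnW.
    * by move=> j hj; apply: Hrk.
Qed.
End WithArray.

Lemma inb_blocks : inb (lw L) (lh L) blocks.
Proof.
move=> j p hp; have [/allP h _ _] := wfL.
have : p \in all_cells L.
  rewrite /all_cells mem_cat; apply/orP; right; apply/flattenP; exists (cells_of blocks j) => //.
  case: (ltnP j (size blocks)) => hj; last by move: hp; rewrite /cells_of nth_default.
  by apply: map_f; apply: mem_nth.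
by move/h => /andP [].
Qed.

(** B bounds the length of the shortened play, so [B.+1] times are stored. Sizes, coordinates, ranks
    and positions are at most N and the length is at most B, whence the bound [N + B] on entries. *)
Lemma certificate_exists : solvable L ->
  let B := 2 * k.+1 * (N.+1 ^ 2) ^ k in
  exists2 y, size y <= B.+1 * (N + 12) ^ 3 * (N + B).+1 & verify k (word x y).
Proof.
move=> /solvableE [n [c [hr hs]]] B.
have [hwN hhN] := dims_le.
have [T hTB hT] := @trace_short _ _ _ N k n (false, lblocks L) (true, c) hwN hhN inb_blocks kL hr.
have [f [ftr f0 fT]] := jreach_trace hT.
have [r hrr] := fin_choice (fun=> 0) (fun t ht => step_complete (ftr t ht)).
have [wf1 wf2 wf3] := wfL.
have hcr j : j < size blocks -> exists cr, (forall q, cr q <= size (blk j).2) /\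
   forall q, q < size (blk j).2 -> q = 0 \/ exists2 q', q' < size (blk j).2 &
      cr q' < cr q /\ adj4 (nth (0, 0) (blk j).2 q') (nth (0, 0) (blk j).2 q).
  move=> hj; have hb : blk j \in blocks by apply: mem_nth.
  have [_ hcon] := wf3 _ hb; apply: connected_rank hcon.
  move: wf2; rewrite /all_cells cat_uniq => /and3P [_ _].
  rewrite -[lblocks L](cat_take_drop j) (drop_nth dflt hj) map_cat flatten_cat cat_uniq /= cat_uniq.
  by move=> /and3P [_ _ /and3P [-> _ _]].
have [cr hcrr] := fin_choice (fun=> 0) hcr.
have fol t : t <= T -> follows (lw L) (lh L) blocks (f t).2.
  by move=> ht; have := trace_follows (i := 0) (d := t) ftr ht; rewrite add0n f0.
have hNb := nblocks_ncells_le.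
have szN t : t <= T -> size (f t).2 <= N by move=> /fol [h1 _ _ _ _]; lia.
have cellsN t j : t <= T -> size (cells_of (f t).2 j) <= N.
  by move=> /fol [_ _ h3 _ _]; have := ncells_ge (f t).2 j; lia.
(* The table lists the fields in the numbering used by the verifier. *)
pose G t fl j q := match fl with
  | 0 => size (f t).2
  | 1 => kid (kind_of (f t).2 j)
  | 2 => size (cells_of (f t).2 j)
  | 3 => (nth (0, 0) (cells_of (f t).2 j) q).1
  | 4 => (nth (0, 0) (cells_of (f t).2 j) q).2
  | 5 => nat_of_bool (f t).1
  | 6 => r t j
  | 7 => match j with 0 => lw L | 1 => lh L | 2 => size walls | _ => T end
  | 8 => match j with 0 => (nth (0, 0) walls q).1 | 1 => (nth (0, 0) walls q).2 | _ => pwpos q end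
  | 9 => pbpos j
  | 10 => pcpos j q
  | _ => cr j q end.
have B0 : 0 < B by rewrite /B !muln_gt0 expn_gt0 expn_gt0.
have [y hy hG] := array_word x G B.+1 (N + B).
exists y; first exact: hy.
(* The side length [N + 12] leaves room for the 12 fields and, whatever the input, for the indices
   below 4 of the fields with fixed entries. *)
have {}hG t fl j q : t <= T -> fl < 12 -> (j <= N) || (j < 12) -> q <= N -> G t fl j q <= N + B ->
    z4 (word x y) t fl j q = G t fl j q.
  by move=> ht hf hj hq hv; apply: hG; lia.
have hN a : a <= N -> a <= N + B by lia.
have hst t : t <= T -> repstate (word x y) kid t (f t).
  move=> ht; split.
  - by rewrite /nbl hG //; apply: hN; apply: szN.
  - rewrite /phs hG //=; apply: leq_trans (leq_b1 _) _.
    by apply: leq_trans B0 (leq_addl _ _).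
  - move=> j hj; have hjN : j <= N by apply: leq_trans (ltnW hj) (szN t ht).
    split.
    (* A colour name can be as large as [N.+1]; it fits because B is positive. *)
    + by rewrite /knd hG ?hjN //=; apply: leq_trans (kid_le _) _; rewrite -addn1 leq_add2l.
    + by rewrite /len hG ?hjN //; apply: hN; apply: cellsN.
    + move=> q hq; have hqN : q <= N by apply: leq_trans (ltnW hq) (cellsN t j ht).
      have [_ hin _ _ _] := fol t ht.
      have [i1 i2] := hin inb_blocks j _ (mem_nth (0, 0) hq).
      rewrite /cx /cy !hG ?hjN //=; first by rewrite -surjective_pairing.
        by apply: hN; apply: leq_trans (ltnW i2) _.
      by apply: hN; apply: leq_trans (ltnW i1) _.
have hwall q : q < size walls -> (nth (0, 0) walls q).1 <= N /\ (nth (0, 0) walls q).2 <= N.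
  move=> hq; have /allP h1 := wf1.
  have : nth (0, 0) walls q \in all_cells L by rewrite /all_cells mem_cat mem_nth.
  by move/h1 => /andP [a b]; split; [apply: leq_trans (ltnW a) _ | apply: leq_trans (ltnW b) _].
have nwN := nwalls_le.
have nbN : size blocks <= N by lia.
have cj j q : j < size blocks -> q <= size (blk j).2 -> q <= N.
  by move=> hj hq; have := cellsN 0 j (leq0n T); rewrite f0 => h; exact: leq_trans hq h.
apply: (@verify_complete y T f r cr) => //.
- by rewrite fT.
- move=> t j ht hj; have hjN : j <= N by apply: leq_trans (ltnW hj) (szN t (ltnW ht)).
  rewrite /rk hG ?hjN ?(ltnW ht) //=; have [hle _] := hrr t ht.
  by apply: hN; apply: leq_trans (hle j) (szN t (ltnW ht)).
- by move=> t ht W' kid' t' h1 h2 h3 h4 h5 h6 h7; have [_] := hrr t ht; apply; eassumption.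
- by move=> j hj; have [_] := hcrr j hj.
- by rewrite /zw hG ?orbT //=; apply: hN.
- by rewrite /zh hG ?orbT //=; apply: hN.
- by rewrite /znw hG ?orbT //=; apply: hN.
- by rewrite /ztime hG ?orbT //=; lia.
- move=> q hq; have [a b] := hwall q hq; have hqN : q <= N by apply: leq_trans (ltnW hq) nwN.
  by rewrite /wx /wy !hG ?orbT //=; [rewrite -surjective_pairing | apply: hN | apply: hN].
- move=> q hq; rewrite /pw hG ?orbT //=; first exact: leq_trans hq nwN.
  by apply: hN; apply: pwpos_le.
- move=> j hj; rewrite /pb hG ?(leq_trans hj nbN) //=.
  by apply: hN; apply: pbpos_le.
- move=> j q hj hq; rewrite /pc hG ?(leq_trans (ltnW hj) nbN) //=; first exact: cj hj hq.
  by apply: hN; apply: pcpos_le.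
- move=> j q hj hq; rewrite /crk hG ?(leq_trans (ltnW hj) nbN) //=; first exact: cj hj (ltnW hq).
  by have [hle _] := hcrr j hj; apply: hN; apply: cj hj (hle q).
Qed.
End Complete.

Theorem theorem4 : forall k : nat, in_NP (JellyK k).
Proof.
move=> k; have [t ht] := verify_term k.
(* The length of the certificate as a function of [b = n + 2]; k is fixed, so it is dominated by one
   power. *)
have [E HE] : polyb (fun b => (2 * k.+1 * (b ^ 2) ^ k).+1 * (b + 12) ^ 3 * (b + 2 * k.+1 * (b ^ 2) ^ k).+1).
  have p1 : polyb (fun b => 2 * k.+1 * (b ^ 2) ^ k).
    apply: polyb_mul (polyb_const _) _.
    by apply: (@polyb_exp (fun b => b ^ 2)); apply: polyb_exp polyb_id.
  have p2 : polyb (fun b => 1 + 2 * k.+1 * (b ^ 2) ^ k) by apply: polyb_add (polyb_const _) p1.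
  have p3 : polyb (fun b => (b + 12) ^ 3) by apply: polyb_exp (polyb_add polyb_id (polyb_const _)).
  have p4 : polyb (fun b => 1 + (b + 2 * k.+1 * (b ^ 2) ^ k)).
    exact: polyb_add (polyb_const _) (polyb_add polyb_id p1).
  exact: polyb_mul (polyb_mul p2 p3) p4.
apply: (@term_NP t (JellyK k) E) => [x y|x].
  rewrite -/(word x y) ht => h; apply: (@verify_sound k x y).
  by move: h; case: (verify _ _).
move=> [L [wfL hk <- hs]].
have [y hy hv] := certificate_exists wfL hk hs.
exists y; last by rewrite -/(word _ y) ht hv.
apply: leq_trans hy (leq_trans _ (HE (size (enc_level L) + 2) _)); last by lia.
set n := size _.
have h1 : 2 * k.+1 * (n.+1 ^ 2) ^ k <= 2 * k.+1 * ((n + 2) ^ 2) ^ k.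
  have h0 : n.+1 <= n + 2 by lia.
  exact: leq_mul (leqnn _) (leq_expn2r k (leq_expn2r 2 h0)).
apply: leq_mul; last by rewrite ltnS; apply: leq_add h1; apply: leq_addr.
by apply: leq_mul; [rewrite ltnS | apply: leq_expn2r; rewrite leq_add2r leq_addr].
Qed.
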